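(* Let $\mathcal L$ be a language enriching the language of rings, $T$ an $\mathcal L$-theory of large fields, and $I$ a (possibly infinite) set of theories $T_i$, each eliminating quantifiers in a relational expansion $\mathcal L_i$ of the ring language, the expansions being pairwise disjoint. Let $K$ be an $\mathcal L$-field that is also a model of $T_I=\bigcup_i T_{i,\forall}$, such that, for every $i\in I$, any model of $T_{i,K}$ can be expanded to a model of $T_K$; and for every $i\in I$ fix $M_i\models T_{i,K}$. The following are equivalent: (i) any regular totally $T$ extension $K\leq F\models T_I$ is $\mathcal L_I$-existentially closed; (ii) for every geometrically integral totally $T$ variety $V$ over $K$ and every choice, for all $i\in I$, of $p_i\in\mathcal S^i(K)$ that is $K$-generic in $V$, the set $\bigcup_i p_i$ is realised in some elementary extension $K^\star\succcurlyeq K$; (iii) for every geometrically integral totally $T$ variety $V$ over $K$, every finite $I_0\subseteq I$ and every choice, for $i\in I_0$, of an $\mathcal L_i(K)$-definable $X_i(M_i)\subseteq V$ that is $K$-Zariski dense, one has $\bigcap_{i\in I_0}X_i(K)\neq\emptyset$ (equivalently, $\bigcap_{i\in I_0} X_i(K)$ is Zariski dense in $V$); (iv) for all $i\in I$, $\mathrm{dcl}_i(K)\subseteq K^{\mathrm a}$, and for every geometrically integral totally $T$ variety $V$ over $K$, every finite $I_0\subseteq I$ and every choice, for $i\in I_0$, of an $\mathcal L_i(K)$-definable $X_i(M_i)\subseteq V$ that is Zariski dense in $V$, one has $\bigcap_{i\in I_0}X_i(K)\neq\emptyset$ (equivalently, $\bigcap_{i\in I_0}X_i(K)$ is Zariski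 dense in $V$). Moreover, in (ii), (iii) and (iv), one may equivalently restrict to affine varieties $V$.
   Context: A variety over $K$ is a separated integral scheme of finite type over $K$; $V_{\mathrm{sm}}(M)$ is the set of smooth $M$-points. A field $K$ is large if every irreducible variety $V$ over $K$ with $V_{\mathrm{sm}}(K)\neq\emptyset$ has $V(K)$ Zariski dense. An $\mathcal L$-field is an $\mathcal L$-structure that is a field. $T_K$ is the theory of models of $T$ containing $K$ as an $\mathcal L$-substructure. As a harmless convention, algebraically closed fields are assumed to be (expandable to) models of $T$. A field extension $K\le F$ is totally $T$ if for every $M\models T_K$, $F$ embeds over $K$ as a ring in some $M^\star\succcurlyeq M$; a variety $V$ over $K$ is totally $T$ if $V_{\mathrm{sm}}(M)\ne\emptyset$ for every $M\models T_K$. An extension $K\le F$ is regular if $F$ is linearly disjoint over $K$ from the algebraic closure $K^{\mathrm a}$ of $K$. $\mathcal L_I=\bigcup_i\mathcal L_i$; $T_{i,\forall}$ is the set of universal consequences of $T_i$; all $\mathcal L_i$-formulas are taken quantifier-free. $T_{i,K}$ is the theory of models of $T_i$ containing $K$ as an $\mathcal L_i$-substructure. $\mathrm{dcl}_i$ is the definable closure in models of $T_i$ (computed in $M_i$). In (i), $K\le F$ is an extension of $\mathcal L_I$-structures. $\mathcal S^i(K)$ is the space of (quantifier-free) complete $\mathcal L_i$-types over $K$ (consistent with $T_{i,K}$); $p_i$ is $K$-generic in $V$ if its realizations lie in $V$ and in no proper subvariety of $V$ over $K$. A subset of $V$ is $K$-Zariski dense in $V$ if it is not contained in any proper subvariety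 of $V$ over $K$. For an $\mathcal L_i(K)$-definable set $X$, $X(K)$ denotes its set of $K$-rational points. *)

(* Defs.v *)
From HB Require Import structures.
From mathcomp Require Import all_boot all_algebra.
From mathcomp Require Import classical_sets cardinality.

Set Implicit Arguments.
Unset Strict Implicit.
Unset Printing Implicit Defensive.

Import GRing.Theory.
Local Open Scope ring_scope.

(** * First-order logic over expansions of the language of rings *)

(* A [lang] lists the symbols added to the language of rings 0, 1, +, -, *,
   which are part of every language below. *)
Record lang := Lang {
  fsym : Type; far : fsym -> nat;
  rsym : Type; rar : rsym -> nat }.

Definition relational (L : lang) := fsym L -> False.

Definition lsum (L1 L2 : lang) : lang :=
  @Lang (fsym L1 + fsym L2)%type
        (fun s => match s with inl f => far f | inr f => far f end)
        (rsym L1 + rsym L2)%type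
        (fun s => match s with inl r => rar r | inr r => rar r end).

(* Tagging by the index makes the added symbols of the [LI i] pairwise
   disjoint. *)
Definition lunion (I : Type) (LI : I -> lang) : lang :=
  @Lang {i : I & fsym (LI i)} (fun s => let: existT _ f := s in far f)
        {i : I & rsym (LI i)} (fun s => let: existT _ r := s in rar r).

(* [params L C] is L(C): L with a new constant symbol for each element of C. *)
Definition params (L : lang) (C : Type) : lang :=
  lsum L (@Lang C (fun=> 0%N) void (fun=> 0%N)).

(* The universe is the one of the carriers of [fieldType], so that structures
   and fields range over the same sets. *)
Record ringstr := RingStr {
  rcar :> Type@{GRing.Field.axioms_.u0};
  rzero : rcar; rone : rcar;
  radd : rcar -> rcar -> rcar; ropp : rcar -> rcar;
  rmul : rcar -> rcar -> rcar }.

Record interp (L : lang) (A : Type) := Interp {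
  fint : forall f : fsym L, ('I_(far f) -> A) -> A;
  rint : forall r : rsym L, ('I_(rar r) -> A) -> Prop }.

Record structure (L : lang) := Structure {
  rst :> ringstr;
  itp : interp L rst }.

Definition ring_of (F : fieldType) : ringstr :=
  @RingStr F 0 1 (fun x y => x + y) (fun x => - x) (fun x y => x * y).

Record lfield (L : lang) := LField {
  lcar :> fieldType;
  litp : interp L lcar }.

Definition lstr (L : lang) (F : lfield L) : structure L :=
  @Structure L (ring_of F) (litp F).

Coercion lstr : lfield >-> structure.

Section Interpretations.
Context (A : Type).

Definition isum (L1 L2 : lang) (e1 : interp L1 A) (e2 : interp L2 A) :
    interp (lsum L1 L2) A :=
  @Interp (lsum L1 L2) A
    (fun s => match s return ('I_(@far (lsum L1 L2) s) -> A) -> A with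
              | inl f => @fint _ _ e1 f | inr f => @fint _ _ e2 f end)
    (fun s => match s return ('I_(@rar (lsum L1 L2) s) -> A) -> Prop with
              | inl r => @rint _ _ e1 r | inr r => @rint _ _ e2 r end).

Definition isumr (L1 L2 : lang) (e : interp (lsum L1 L2) A) : interp L2 A :=
  @Interp L2 A (fun f => @fint _ _ e (inr f)) (fun r => @rint _ _ e (inr r)).

Definition iunion (I : Type) (LI : I -> lang) (e : forall i, interp (LI i) A) :
    interp (lunion LI) A :=
  @Interp (lunion LI) A
    (fun s => match s return ('I_(@far (lunion LI) s) -> A) -> A with
              | existT i f => @fint _ _ (e i) f end)
    (fun s => match s return ('I_(@rar (lunion LI) s) -> A) -> Prop with
              | existT i r => @rint _ _ (e i) r end).

Definition ired (I : Type) (LI : I -> lang) (e : interp (lunion LI) A) (i : I) :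
    interp (LI i) A :=
  @Interp (LI i) A
    (fun f => @fint _ _ e (existT _ i f)) (fun r => @rint _ _ e (existT _ i r)).

Definition iparams (L : lang) (C : Type) (e : interp L A) (h : C -> A) :
    interp (params L C) A :=
  isum e (@Interp (@Lang C (fun=> 0%N) void (fun=> 0%N)) A
            (fun c _ => h c) (fun r _ => match r with end)).

End Interpretations.

Definition sparams (L : lang) (C : Type) (M : structure L) (h : C -> M) :
    structure (params L C) :=
  @Structure (params L C) (rst M) (iparams (itp M) h).

Inductive term (L : lang) (n : nat) : Type :=
| Var of 'I_n
| Zero
| One
| Add of term L n & term L n
| Opp of term L n
| Mul of term L n & term L n
| App (f : fsym L) of ('I_(far f) -> term L n).

Inductive formula (L : lang) : nat -> Type :=
| Bot n : formula L n
| Eqn n of term L n & term L n : formula L n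
| Rel n (r : rsym L) of ('I_(rar r) -> term L n) : formula L n
| Imp n of formula L n & formula L n : formula L n
| All n of formula L n.+1 : formula L n.

Definition Not (L : lang) n (phi : formula L n) : formula L n :=
  Imp phi (Bot L n).

Fixpoint eval (L : lang) (M : structure L) n (v : 'I_n -> M) (t : term L n) :
    M :=
  match t with
  | Var i => v i
  | Zero => rzero M
  | One => rone M
  | Add s t => radd (eval v s) (eval v t)
  | Opp s => ropp (eval v s)
  | Mul s t => rmul (eval v s) (eval v t)
  | App f a => fint (itp M) (fun k => eval v (a k))
  end.

(* The variable bound by [All] is variable 0 of its body. *)
Definition scons (A : Type) n (x : A) (v : 'I_n -> A) : 'I_n.+1 -> A :=
  fun k => if unlift ord0 k is Some j then v j else x.

Fixpoint sat (L : lang) (M : structure L) n (phi : formula L n) :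
    ('I_n -> M) -> Prop :=
  match phi with
  | Bot n => fun _ => False
  | Eqn n s t => fun v => eval v s = eval v t
  | Rel n r a => fun v => rint (itp M) (fun k => eval v (a k))
  | Imp n p q => fun v => sat p v -> sat q v
  | All n p => fun v => forall x : M, sat p (scons x v)
  end.

Arguments sat {L} M {n} phi v.

Fixpoint qfree (L : lang) n (phi : formula L n) : bool :=
  match phi with
  | Imp _ p q => qfree p && qfree q
  | All _ _ => false
  | _ => true
  end.

Fixpoint universal (L : lang) n (phi : formula L n) : bool :=
  match phi with
  | All _ p => universal p
  | Bot _ | Eqn _ _ _ | Rel _ _ _ => true
  | Imp _ p q => qfree p && qfree q
  end.

Definition theory (L : lang) := set (formula L 0).

Definition models (L : lang) (M : structure L) (T : theory L) :=
  forall phi, T phi -> forall v, sat M phi v.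

Definition univ_part (L : lang) (T : theory L) : theory L :=
  [set phi | universal phi /\
             forall M : structure L, models M T -> forall v, sat M phi v]%classic.

Definition qelim (L : lang) (T : theory L) :=
  forall n (phi : formula L n), exists2 psi : formula L n, qfree psi &
    forall M : structure L, models M T -> forall v, sat M phi v <-> sat M psi v.

Definition embedding (L : lang) (A B : structure L) (h : A -> B) :=
  [/\ injective h,
      h (rzero A) = rzero B /\ h (rone A) = rone B,
      (forall x, h (ropp x) = ropp (h x)) /\
      (forall x y, h (radd x y) = radd (h x) (h y) /\
                   h (rmul x y) = rmul (h x) (h y)),
      forall f a, h (@fint _ _ (itp A) f a) = fint (itp B) (fun k => h (a k)) &
      forall r a, @rint _ _ (itp A) r a <-> rint (itp B) (fun k => h (a k))].

Definition elementary (L : lang) (A B : structure L) (h : A -> B) :=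
  forall n (phi : formula L n) v,
    sat A phi v <-> sat B phi (fun k => h (v k)).

(* Models of T_K, for T a theory all of whose models containing K are fields. *)
Record kmodel (L : lang) (T : theory L) (K : lfield L) := KModel {
  mfield :> lfield L;
  mstr : {rmorphism K -> mfield};
  _ : embedding (A := K) (B := mfield) mstr;
  _ : models mfield T }.

Definition kformula (L : lang) (K : Type) n := formula (params L K) n.

Definition ksat (L : lang) (K : Type) (M : structure L) (h : K -> M) n
    (phi : kformula L K n) (v : 'I_n -> M) : Prop :=
  sat (sparams h) phi v.

(* L-existentially closed; quantifier-free L(K)-formulas carry the
   parameters. *)
Definition exist_closed (L : lang) (K F : structure L) (j : K -> F) :=
  forall n (phi : kformula L (rcar K) n), qfree phi ->
    (exists v, ksat j phi v) -> exists v, ksat (M := K) id phi v.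

Definition qf_complete_type (L : lang) (T : theory L) (K : lfield L) n
    (p : set (kformula L K n)) :=
  [/\ forall phi, p phi -> qfree phi,
      forall phi, qfree phi -> p phi \/ p (Not phi) &
      exists (M : kmodel T K) (v : 'I_n -> M),
        forall phi, p phi -> ksat (M := M) (mstr M) phi v].

(** * Schemes over a field, as functors of points *)

Record kalg (K : fieldType) := KAlg {
  kring :> comPzRingType;
  kstr : {rmorphism K -> kring} }.

Record khom (K : fieldType) (A B : kalg K) := KHom {
  khfun :> {rmorphism A -> B};
  khomP : forall c, khfun (kstr A c) = kstr B c }.

Record kfunctor (K : fieldType) := KFunctor {
  pts :> kalg K -> Type;
  pmap : forall A B : kalg K, khom A B -> pts A -> pts B;
  pmap_id : forall A (f : khom A A) x, (forall a, f a = a) -> pmap f x = x;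
  pmap_comp : forall A B C (f : khom A B) (g : khom B C) (h : khom A C) x,
    (forall a, h a = g (f a)) -> pmap h x = pmap g (pmap f x) }.

Arguments pmap {K} X {A B} f x : rename.

Definition is_field (A : comPzRingType) :=
  (1 : A) != 0 /\ forall x : A, x != 0 -> exists y, x * y = 1.

Definition unit_ideal (A : comPzRingType) (S : set A) :=
  exists n (c s : 'I_n -> A), (forall i, S (s i)) /\ \sum_i c i * s i = 1.

Definition localization (K : fieldType) (A B : kalg K) (a : A) (l : khom A B) :=
  [/\ exists b, l a * b = 1,
      forall y, exists (x : A) (n : nat), l a ^+ n * y = l x &
      forall x, l x = 0 -> exists n : nat, a ^+ n * x = 0].

Section Functors.
Context (K : fieldType).
Implicit Types (X : kfunctor K) (A B C R : kalg K).

Definition zariski_sheaf X :=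
  forall A r (a : 'I_r -> A) (B : 'I_r -> kalg K) (l : forall i, khom A (B i)),
    unit_ideal (range a) -> (forall i, localization (a i) (l i)) ->
    forall x : forall i, X (B i),
      (forall i j C (g : khom (B i) C) (h : khom (B j) C),
         (forall c, g (l i c) = h (l j c)) -> pmap X g (x i) = pmap X h (x j)) ->
      exists! y : X A, forall i, pmap X (l i) y = x i.

Definition subfunctor X := forall A, X A -> Prop.

Definition open_subfunctor X (U : subfunctor X) :=
  forall A (x : X A), exists S : set A,
    forall B (f : khom A B), U B (pmap X f x) <-> unit_ideal (f @` S)%classic.

Definition closed_subfunctor X (Z : subfunctor X) :=
  forall A (x : X A), exists S : set A,
    forall B (f : khom A B), Z B (pmap X f x) <-> (forall s, S s -> f s = 0).

(* By Yoneda, u in X(R) is a morphism Spec R -> X, with image [yoneda u]. *)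
Definition yoneda X R (u : X R) : subfunctor X :=
  fun A x => exists f : khom R A, pmap X f u = x.

Definition open_immersion X R (u : X R) :=
  (forall A (f g : khom R A), pmap X f u = pmap X g u -> forall r, f r = g r) /\
  open_subfunctor (yoneda u).

Definition affine X := exists R (u : X R),
  (forall A (f g : khom R A), pmap X f u = pmap X g u -> forall r, f r = g r) /\
  (forall A (x : X A), yoneda u x).

(* Open subfunctors cover X when they do so on points over fields. *)
Definition affine_open_cover X (J : Type) (R : J -> kalg K)
    (u : forall j, X (R j)) :=
  (forall j, open_immersion (u j)) /\
  (forall A, is_field A -> forall x : X A, exists j, yoneda (u j) x).

Definition scheme X :=
  zariski_sheaf X /\
  exists (J : Type) (R : J -> kalg K) (u : forall j, X (R j)),
    affine_open_cover u.

Definition generates R n (a : 'I_n -> R) :=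
  forall S : set R, (forall c, S (kstr R c)) -> (forall k, S (a k)) ->
    (forall x y, S x -> S y -> S (x + y) /\ S (x * y)) -> forall r, S r.

Definition finite_type X :=
  exists (r : nat) (R : 'I_r -> kalg K) (u : forall j, X (R j)),
    affine_open_cover u /\
    forall j, exists n (a : 'I_n -> R j), generates a.

(* The diagonal is a closed immersion. *)
Definition separated X :=
  forall A (x y : X A), exists S : set A,
    forall B (f : khom A B),
      pmap X f x = pmap X f y <-> (forall s, S s -> f s = 0).

Definition integral X :=
  (exists A, (1 : A) != 0 /\ inhabited (X A)) /\
  (forall R (u : X R), open_immersion u -> (1 : R) != 0 ->
     forall a b : R, a * b = 0 -> a = 0 \/ b = 0).

Definition variety X :=
  [/\ scheme X, finite_type X, separated X & integral X].

Definition formally_smooth X (U : subfunctor X) :=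
  forall B C (pi : khom B C),
    (forall c, exists b, pi b = c) ->
    (forall a b, pi a = 0 -> pi b = 0 -> a * b = 0) ->
    forall y : X C, U C y -> exists2 z : X B, U B z & pmap X pi z = y.

(* For X of finite type over K, hence locally of finite presentation, smooth
   is the same as formally smooth. *)
Definition smooth_point X A (x : X A) :=
  exists U : subfunctor X, [/\ open_subfunctor U, formally_smooth U & U A x].

(* For X a variety, i.e. reduced, a closed subscheme is a proper closed subset
   exactly when it is not the whole of X. *)
Definition proper_closed X (Z : subfunctor X) :=
  closed_subfunctor Z /\ exists A (x : X A), ~ Z A x.

Definition zdense X A (S : set (X A)) :=
  ~ exists Z : subfunctor X, proper_closed Z /\ forall x, S x -> Z A x.

(* An affine open Spec R of X embedded in affine n-space by generators of R. *)
Record chart X := Chart {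
  cring : kalg K;
  cmap : X cring;
  cdim : nat;
  cgen : 'I_cdim -> cring;
  _ : open_immersion cmap;
  _ : generates cgen }.

Definition coords X (c : chart X) A (x : X A) (v : 'I_(cdim c) -> A) :=
  exists f : khom (cring c) A,
    pmap X f (cmap c) = x /\ forall k, v k = f (cgen (c := c) k).

End Functors.

Section BaseChange.
Context (K F : fieldType) (j : {rmorphism K -> F}).

Definition kres (A : kalg F) : kalg K :=
  @KAlg K A (kstr A \o j : {rmorphism K -> A}).

Definition kres_hom (A B : kalg F) (f : khom A B) : khom (kres A) (kres B) :=
  @KHom K (kres A) (kres B) f (fun c => khomP f (j c)).

Definition base_change (X : kfunctor K) : kfunctor F :=
  @KFunctor F (fun A => X (kres A)) (fun A B f => pmap X (kres_hom f))
    (fun A f => @pmap_id K X (kres A) (kres_hom f))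
    (fun A B C f g h =>
       @pmap_comp K X _ _ _ (kres_hom f) (kres_hom g) (kres_hom h)).

End BaseChange.

Definition kself (K : fieldType) : kalg K :=
  @KAlg K K (idfun : {rmorphism K -> K}).

(* X(F), for a field extension j : K -> F; by definition it is also the set of
   F-points of the base change of X to F. *)
Definition fpts (K F : fieldType) (j : {rmorphism K -> F}) (X : kfunctor K) :
    Type :=
  X (kres j (kself F)).

Definition kext (K F : fieldType) (j : {rmorphism K -> F}) :
    khom (kself K) (kres j (kself F)) :=
  @KHom K (kself K) (kres j (kself F)) j (fun c => erefl).

Definition geom_integral (K : fieldType) (X : kfunctor K) :=
  forall (F : fieldType) (j : {rmorphism K -> F}), integral (base_change j X).

Definition large (K : fieldType) :=
  forall X : kfunctor K, variety X ->
    (exists x : X (kself K), smooth_point x) ->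
    zdense (X := X) (A := kself K) setT.

(** * Fields and theories *)

Definition alg_closed (F : fieldType) := GRing.closed_field_axiom F.

Definition regular (K F : fieldType) (j : {rmorphism K -> F}) :=
  forall (W : fieldType) (g : {rmorphism F -> W}), alg_closed W ->
  forall n (a : 'I_n -> F),
    (forall c : 'I_n -> K, \sum_k j (c k) * a k = 0 -> forall k, c k = 0) ->
    forall b : 'I_n -> W, (forall k, algebraicOver (g \o j) (b k)) ->
      \sum_k b k * g (a k) = 0 -> forall k, b k = 0.

Definition ring_iso (A B : ringstr) (h : A -> B) :=
  [/\ bijective h, h (rzero A) = rzero B /\ h (rone A) = rone B,
      forall x, h (ropp x) = ropp (h x),
      forall x y, h (radd x y) = radd (h x) (h y) &
      forall x y, h (rmul x y) = rmul (h x) (h y)].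

Definition theory_of_large_fields (L : lang) (T : theory L) :=
  forall M : structure L, models M T ->
    exists (F : fieldType) (h : M -> F), @ring_iso M (ring_of F) h /\ large F.

Definition acf_convention (L : lang) (T : theory L) (K : fieldType) :=
  forall (F : fieldType) (j : {rmorphism K -> F}), alg_closed F ->
    exists e : interp L F, models (LField e) T.

(* Any model of T1_K can be expanded to a model of T_K, where K carries the
   L-structure e and the L1-structure e1. *)
Definition expandable (L L1 : lang) (T : theory L) (T1 : theory L1)
    (K : fieldType) (e : interp L K) (e1 : interp L1 K) :=
  forall (M : structure L1) (h : K -> M),
    models M T1 -> embedding (A := LField e1) (B := M) h ->
    exists e' : interp L M,
      models (Structure e') T /\
      embedding (A := LField e) (B := Structure e') h.

Definition totally_extension (L : lang) (T : theory L) (K : lfield L)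
    (F : fieldType) (j : {rmorphism K -> F}) :=
  forall M : kmodel T K,
    exists (N : lfield L) (h : {rmorphism M -> N}) (g : {rmorphism F -> N}),
      elementary (A := M) (B := N) h /\ forall c, g (j c) = h (mstr M c).

Definition totally_variety (L : lang) (T : theory L) (K : lfield L)
    (V : kfunctor K) :=
  forall M : kmodel T K, exists x : fpts (mstr M) V, smooth_point x.

(** * Definable subsets of a variety *)

Section Definable.
Context (L : lang) (T : theory L) (K : lfield L) (V : kfunctor K).

(* V need not be affine: a definable subset is given by finitely many
   formulas in affine coordinates. *)
Definition definable (M : kmodel T K) (S : set (fpts (mstr M) V)) :=
  exists (r : nat) (c : 'I_r -> chart V)
         (phi : forall k, kformula L K (cdim (c k))),
    (forall k, qfree (phi k)) /\
    forall x, S x <-> exists k v,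
      coords (c := c k) x v /\ ksat (M := M) (mstr M) (phi k) v.

Definition rational_points (M : kmodel T K) (S : set (fpts (mstr M) V)) :
    set (V (kself K)) :=
  [set x | S (pmap V (kext (mstr M)) x)]%classic.

(* The subset S of V(M) is dense in V, i.e. in the base change of V to M. *)
Definition zdense_over (M : kmodel T K) (S : set (fpts (mstr M) V)) :=
  zdense (X := base_change (mstr M) V) (A := kself M) S.

(* p, a type in the coordinates of the chart c, is K-generic in V. *)
Definition generic_in (c : chart V) (p : set (kformula L K (cdim c))) :=
  forall (M : kmodel T K) v,
    (forall phi, p phi -> ksat (M := M) (mstr M) phi v) ->
    exists x : fpts (mstr M) V, coords x v /\
      forall Z : subfunctor V, proper_closed Z -> ~ Z _ x.

End Definable.

Definition dcl (L : lang) (T : theory L) (K : lfield L) (M : kmodel T K) :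
    set M :=
  [set a | exists2 phi : kformula L K 1, qfree phi &
     forall b : M, ksat (M := M) (mstr M) phi (fun=> b) <-> b = a]%classic.

(** * The conditions *)

Section Conditions.
Context (L : lang) (T : theory L) (I : Type) (LI : I -> lang)
        (TI : forall i, theory (LI i)).
Context (K : fieldType) (eL : interp L K) (eI : forall i, interp (LI i) K).
Context (M : forall i, kmodel (@TI i) (LField (eI i))).

(* Geometrically integral totally T varieties, only affine ones if aff. *)
Definition admissible (aff : bool) (V : kfunctor K) :=
  [/\ variety V, geom_integral V, totally_variety T (K := LField eL) V &
      aff -> affine V].

Definition cond_i :=
  forall (F : lfield (lunion LI)) (j : {rmorphism K -> F}),
    embedding (A := LField (iunion eI)) (B := F) j ->
    (forall i, models (LField (ired (litp F) i)) (univ_part (@TI i))) ->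
    regular j -> totally_extension T (K := LField eL) j ->
    exist_closed (K := LField (iunion eI)) (F := F) j.

Definition cond_ii (aff : bool) :=
  forall V : kfunctor K, admissible aff V ->
  forall (c : I -> chart V) (p : forall i, set (kformula (LI i) K (cdim (c i)))),
    (forall i, qf_complete_type (@TI i) (K := LField (eI i)) (p i)) ->
    (forall i, generic_in (@TI i) (K := LField (eI i)) (p i)) ->
    exists (Ks : lfield (lsum L (lunion LI))) (h : {rmorphism K -> Ks}),
      elementary (A := LField (isum eL (iunion eI))) (B := Ks) h /\
      exists x : fpts h V, forall i, exists2 v, coords (c := c i) x v &
        forall phi, p i phi ->
          ksat (M := LField (ired (isumr (litp Ks)) i)) h phi v.

(* The common part of (iii) and (iv): dense is the density assumed of the
   X_i(M_i), and zd selects the Zariski dense form of the conclusion. *)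
Definition intersection_property
    (dense : forall (V : kfunctor K) i, set (fpts (mstr (M i)) V) -> Prop)
    (aff zd : bool) :=
  forall V : kfunctor K, admissible aff V ->
  forall I0 : set I, finite_set I0 ->
  forall X : forall i, set (fpts (mstr (M i)) V),
    (forall i, I0 i -> definable (X i) /\ dense V i (X i)) ->
    let XK : set (V (kself K)) :=
      (\bigcap_(i in I0) (rational_points (X i) : set (V (kself K))))%classic in
    if zd then zdense XK else (XK !=set0)%classic.

Definition cond_iii (aff zd : bool) :=
  intersection_property (fun V i S => zdense S) aff zd.

Definition cond_iv (aff zd : bool) :=
  (forall i a, dcl (M := M i) a -> algebraicOver (mstr (M i)) a) /\
  intersection_property (fun V i S => zdense_over S) aff zd.

End Conditions.

(* Main.v *)
(* Let V be a geometrically integral totally T variety, R the ring of functions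
   on a chart, and F its function field. Largeness makes V(M) dense in V for
   every model M of T_K, so ultrapowers of M indexed by its R-points show
   that F is totally T over K; geometric integrality makes F regular over K.
   K-generic points of V over models N_i of T_i are embeddings of R in the N_i,
   and pulling back the relations of the N_i makes F a model of T_I. Condition
   (i) for this F yields K-points of V satisfying finitely many formulas of the
   types of these points; an ultrapower of K gives (ii), and with N_i an
   ultrapower of M_i containing a generic point of X_i one gets (iii). Applied
   to the affine line, (iii) shows that dcl_i(K) is algebraic over K.

   Conversely, a finite tuple of a regular extension F lies in a smooth affine
   K-subalgebra D of F, by MacLane's separability criterion. Spec D is
   geometrically integral, and totally T when F is. Atomic formulas of distinct
   L_i involve disjoint sets of symbols, so the truth of a formula at a point of
   Spec D is controlled by one formula for each i, satisfied on a dense set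
   because T_i eliminates quantifiers. Hence (ii) and (iii) each imply (i).

   For (iv) => (iii), let X be definable over K and contained in a proper closed
   subset of the base change of V to M_i. A shortest relation over M_i between
   K-independent functions that holds on X is unique after normalization, so its
   coefficients are in dcl_i(K), hence algebraic over K, and taking a norm gives
   a nonzero function over K that vanishes on X. *)
From HB Require Import structures.
From mathcomp Require Import all_boot all_algebra.
From mathcomp Require Import boolp classical_sets cardinality filter ring.
From mathcomp Require Import mpoly.
Require Import Defs.

Set Implicit Arguments.
Unset Strict Implicit.
Unset Printing Implicit Defensive.

Import GRing.Theory.
Local Open Scope ring_scope.

(** * Rings, ideals and fields *)

(** Ultraproducts supply whatever compactness would give: fields splitting all polynomials,
    composita, generic points, elementary extensions. They are indexed by finite lists or by the
    points of a chart over a field. For a functor of points, the closure of a set of points has to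
    be built: [clos] is made from the functions vanishing on the set, and density is then mostly
    used through [zdense_chart], which finds a point of the set where a given nonzero function does
    not vanish. The algebra D is formally smooth everywhere because elementarity yields points of
    Spec D over a model without control on their position, while a totally T variety requires smooth
    ones. The delicate algebraic step is that regularity of F makes Spec D geometrically integral:
    the base change is to an arbitrary field, whereas linear disjointness is assumed only for
    elements algebraic over K; the gap is closed by specializing points of D to an algebraically
    closed field. Relationality of the languages serves two ends: structures can be pulled back
    along any embedding of fields, and terms over different [LI i] are the same. *)

Section MakeRing.
Context (T : Type) (z o : T) (a : T -> T -> T) (n : T -> T) (m : T -> T -> T).
Context (aA : associative a) (aC : commutative a) (a0 : left_id z a)
  (aN : left_inverse z n a) (mA : associative m) (mC : commutative m)
  (m1 : left_id o m) (mD : left_distributive m a).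

Definition mkring_type : Type := T.
HB.instance Definition _ := gen_eqMixin mkring_type.
HB.instance Definition _ := gen_choiceMixin mkring_type.
HB.instance Definition _ := GRing.isZmodule.Build mkring_type aA aC a0 aN.
HB.instance Definition _ :=
  GRing.Zmodule_isComPzRing.Build mkring_type mA mC m1 mD.
Definition mkring : comPzRingType := mkring_type.
End MakeRing.

Section NzRing.
Context (A : comPzRingType) (A1 : (1 : A) != 0).
Definition nz_type : Type := A.
HB.instance Definition _ := GRing.ComPzRing.on nz_type.
HB.instance Definition _ := GRing.PzSemiRing_isNonZero.Build nz_type A1.
Definition nz_of : comNzRingType := nz_type.
End NzRing.

Section UnitRingOf.
Context (A : comNzRingType).
Definition ur_type : Type := A.
HB.instance Definition _ := GRing.ComNzRing.on ur_type.
Definition ur_unit : {pred ur_type} := fun x => `[< exists y, y * x = 1 >].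
Definition ur_inv (x : ur_type) : ur_type :=
  if pselect (exists y, y * x = 1) is left h then projT1 (cid h) else x.
Fact ur_mulVr : {in ur_unit, left_inverse 1 ur_inv *%R}.
Proof.
move=> x /asboolP h; rewrite /ur_inv; case: pselect => // h'.
by case: cid.
Qed.
Fact ur_unitP x y : y * x = 1 -> ur_unit x.
Proof. by move=> h; apply/asboolP; exists y. Qed.
Fact ur_inv_out : {in [predC ur_unit], ur_inv =1 id}.
Proof.
by move=> x /asboolP h; rewrite /ur_inv; case: pselect.
Qed.
HB.instance Definition _ :=
  GRing.ComNzRing_hasMulInverse.Build ur_type ur_mulVr ur_unitP ur_inv_out.
Definition ur_of : comUnitRingType := ur_type.
End UnitRingOf.

Definition domain (A : comPzRingType) :=
  (1 : A) != 0 /\ forall a b : A, a * b = 0 -> a = 0 \/ b = 0.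

Section DomOf.
Context (A : comPzRingType) (dA : domain A).
Definition dom_type : Type := ur_of (nz_of dA.1).
HB.instance Definition _ := GRing.ComUnitRing.on dom_type.
Fact dom_int (x y : dom_type) : x * y = 0 -> (x == 0) || (y == 0).
Proof. by move=> /dA.2[->|->]; rewrite eqxx ?orbT. Qed.
HB.instance Definition _ := GRing.ComUnitRing_isIntegral.Build dom_type dom_int.
Definition dom_of : idomainType := dom_type.
End DomOf.

Section FieldOf.
Context (A : comPzRingType) (fA : is_field A).
Definition fld_type : Type := ur_of (nz_of fA.1).
HB.instance Definition _ := GRing.ComUnitRing.on fld_type.
Fact fld_ax : GRing.field_axiom fld_type.
Proof.
move=> x /fA.2[y xy]; rewrite unfold_in; apply/asboolP; exists y.
by rewrite mulrC.
Qed.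
HB.instance Definition _ := GRing.ComUnitRing_isField.Build fld_type fld_ax.
Definition fld_of : fieldType := fld_type.
End FieldOf.


(** The identity, declared as a morphism: the type carries one structure as a ring and another as a
    field. *)
Definition fld_in (A : comPzRingType) (fA : is_field A) : A -> fld_of fA := id.
HB.instance Definition _ (A : comPzRingType) (fA : is_field A) :=
  GRing.isZmodMorphism.Build A (fld_of fA) (fld_in fA) (fun _ _ => erefl).
HB.instance Definition _ (A : comPzRingType) (fA : is_field A) :=
  GRing.isMonoidMorphism.Build A (fld_of fA) (fld_in fA)
    (erefl, fun _ _ => erefl).
Definition fld_out (A : comPzRingType) (fA : is_field A) : fld_of fA -> A := id.
HB.instance Definition _ (A : comPzRingType) (fA : is_field A) :=
  GRing.isZmodMorphism.Build (fld_of fA) A (fld_out (fA := fA)) (fun _ _ => erefl).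
HB.instance Definition _ (A : comPzRingType) (fA : is_field A) :=
  GRing.isMonoidMorphism.Build (fld_of fA) A (fld_out (fA := fA))
    (erefl, fun _ _ => erefl).

Section MakeMorphism.
Context (A B : pzRingType) (f : A -> B) (f1 : f 1 = 1)
  (fD : {morph f : x y / x + y}) (fM : {morph f : x y / x * y}).
Definition mkrm_fun : A -> B := f.
Fact mkrm_zmod : zmod_morphism mkrm_fun.
Proof.
have f0 : f 0 = 0 by apply: (addrI (f 0)); rewrite -fD !addr0.
move=> x y; apply: (addIr (f y)); rewrite /mkrm_fun -fD !subrK //.
Qed.
HB.instance Definition _ := GRing.isZmodMorphism.Build A B mkrm_fun mkrm_zmod.
HB.instance Definition _ :=
  GRing.isMonoidMorphism.Build A B mkrm_fun (f1, fM).
Definition mkrm : {rmorphism A -> B} := mkrm_fun.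
End MakeMorphism.

Lemma Zorn_set (T : Type) (P : set (set T)) (S0 : set T) : P S0 ->
  (forall F : set (set T), (F !=set0)%classic -> (F `<=` P)%classic ->
     total_on F subset -> P (\bigcup_(X in F) X)%classic) ->
  exists M, [/\ P M, (S0 `<=` M)%classic &
    forall B, P B -> (M `<=` B)%classic -> (B `<=` M)%classic].
Proof.
move=> PS0 Pch; pose P' := [set B : set T | B = set0 \/ (P B /\ (S0 `<=` B)%classic)]%classic.
have [F FP tF|M [PM maxM]] := @Zorn_bigcup T P'.
  pose F' := [set B | F B /\ (B !=set0)%classic]%classic.
  have UE : (\bigcup_(X in F) X = \bigcup_(X in F') X)%classic.
    apply/seteqP; split=> x [X FX Xx]; exists X => //; last by case: FX.
    by split=> //; exists x.
  have FP' B : F' B -> P B /\ (S0 `<=` B)%classic.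
    by case=> /FP[->|//] [].
  have [[B FB]|nF] := pselect (F' !=set0)%classic; last first.
    left; rewrite UE; apply/seteqP; split=> x // [X FX Xx].
    by case: nF; exists X.
  right; rewrite UE; split; last first.
    by move=> x /(FP' _ FB).2 Bx; exists B.
  apply: Pch; first by exists B.
    by move=> C /FP'[].
  by move=> C D [FC _] [FD _]; apply: tF.
have maxM' B : P B -> (S0 `<=` B)%classic -> (M `<=` B)%classic -> (B `<=` M)%classic.
  move=> PB S0B MB; apply: contrapT => nBM; apply: (maxM B); last by right.
  by split.
case: PM => [M0|[PM S0M]]; last first.
  by exists M; split=> // B PB MB; apply: maxM' => //; apply: subset_trans MB.
exists S0; split=> // B PB S0B.
have h : (B `<=` M)%classic by apply: maxM' => //; rewrite M0.
by apply: (subset_trans h); rewrite M0.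
Qed.

Definition kid (K : fieldType) (A : kalg K) : khom A A :=
  @KHom K A A (idfun : {rmorphism A -> A}) (fun=> erefl).

Definition kcomp (K : fieldType) (A B C : kalg K) (g : khom B C) (f : khom A B) :
  khom A C := @KHom K A C (g \o f : {rmorphism A -> C})
    (fun c => etrans (congr1 g (khomP f c)) (khomP g c)).

Lemma pmap_ext (K : fieldType) (X : kfunctor K) (A B : kalg K) (f g : khom A B) x :
  (forall a, f a = g a) -> pmap X f x = pmap X g x.
Proof.
move=> fg; rewrite (@pmap_comp _ X A B B g (kid B) f) //.
by rewrite (@pmap_id _ X B (kid B)).
Qed.

Lemma pmap_kid (K : fieldType) (X : kfunctor K) (A : kalg K) x :
  pmap X (kid A) x = x.
Proof. exact: pmap_id. Qed.

Lemma pmap_kcomp (K : fieldType) (X : kfunctor K) (A B C : kalg K)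
  (g : khom B C) (f : khom A B) x :
  pmap X (kcomp g f) x = pmap X g (pmap X f x).
Proof. exact: pmap_comp. Qed.

Definition kpush (K : fieldType) (A : kalg K) (B : comPzRingType)
  (f : {rmorphism A -> B}) : kalg K := KAlg (f \o kstr A : {rmorphism K -> B}).

Definition khpush (K : fieldType) (A : kalg K) (B : comPzRingType)
  (f : {rmorphism A -> B}) : khom A (kpush f) :=
  @KHom K A (kpush f) f (fun=> erefl).

Section Ideals.
Context (A : comPzRingType).
Implicit Types S J : set A.

Definition ideal J :=
  [/\ J 0, forall x y, J x -> J y -> J (x + y) & forall a x, J x -> J (a * x)].

Definition span S : set A := [set x | exists n (c s : 'I_n -> A),
  (forall i, S (s i)) /\ \sum_i c i * s i = x]%classic.

Lemma idealB J x y : ideal J -> J x -> J y -> J (x - y).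
Proof. by case=> _ JD JM Jx Jy; apply: JD => //; rewrite -mulN1r; apply: JM. Qed.

Lemma ideal_sum J (I : Type) (r : seq I) (P : pred I) F : ideal J ->
  (forall i, P i -> J (F i)) -> J (\sum_(i <- r | P i) F i).
Proof. by case=> J0 JD _ JF; apply: (big_ind J). Qed.

Lemma ideal_span S : ideal (span S).
Proof.
split.
- by exists 0%N, (fun=> 0), (fun=> 0); split=> [[]//|]; rewrite big_ord0.
- move=> _ _ [n [c [s [Ss <-]]]] [m [d [t [St <-]]]].
  exists (n + m)%N, (fun i => match split i with inl j => c j | inr j => d j end),
    (fun i => match split i with inl j => s j | inr j => t j end).
  split=> [i|]; first by case: (split i).
  rewrite big_split_ord; congr (_ + _); apply: eq_bigr => i _.
    by rewrite (unsplitK (inl i : 'I_n + 'I_m)%type).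
  by rewrite (unsplitK (inr i : 'I_n + 'I_m)%type).
- move=> a _ [n [c [s [Ss <-]]]]; exists n, (fun i => a * c i), s; split=> //.
  by rewrite mulr_sumr; apply: eq_bigr => i _; rewrite mulrA.
Qed.

Lemma sub_span S x : S x -> span S x.
Proof.
move=> Sx; exists 1%N, (fun=> 1), (fun=> x); split=> //.
by rewrite big_ord1 mul1r.
Qed.

Lemma span_min S J : ideal J -> (S `<=` J)%classic -> (span S `<=` J)%classic.
Proof.
move=> iJ SJ _ [n [c [s [Ss <-]]]]; apply: ideal_sum => // i _.
by case: iJ => _ _; apply; apply: SJ.
Qed.

Lemma span_mono S S' : (S `<=` span S')%classic -> (span S `<=` span S')%classic.
Proof. by apply: span_min; apply: ideal_span. Qed.

Lemma ideal_max J : ideal J -> ~ J 1 -> exists M,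
  [/\ ideal M, (J `<=` M)%classic, ~ M 1 &
     forall x, ~ M x -> exists a, M (1 - a * x)].
Proof.
move=> iJ J1.
have [|F [X0 FX0] FP tF|M [[iM M1] JM maxM]] :=
  @Zorn_set A [set B | ideal B /\ ~ B 1]%classic J; first by split.
  split; last by case=> X /FP[].
  split.
  - by exists X0 => //; case: (FP _ FX0) => -[].
  - move=> x y [X FX Xx] [Y FY Yy].
    have [[_ XD _] _] := FP _ FX; have [[_ YD _] _] := FP _ FY.
    by have [XY|YX] := tF _ _ FX FY;
      [exists Y => //; apply: YD => //; apply: XY|
       exists X => //; apply: XD => //; apply: YX].
  - move=> a x [X FX Xx]; exists X => //.
    by have [[_ _ XM] _] := FP _ FX; apply: XM.
exists M; split=> // x Mx; apply: contrapT => na.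
have [M0 MD MM] := iM.
pose N := [set y | exists2 m, M m & exists a, y = m + a * x]%classic.
apply: Mx; apply: (maxM N); first split.
- split.
  + by exists 0 => //; exists 0; rewrite mul0r addr0.
  + move=> _ _ [m Mm [a ->]] [m' Mm' [a' ->]]; exists (m + m'); first exact: MD.
    by exists (a + a'); rewrite mulrDl addrACA.
  + move=> b _ [m Mm [a ->]]; exists (b * m); first exact: MM.
    by exists (b * a); rewrite mulrDr mulrA.
- by case=> m Mm [a e]; apply: na; exists a; rewrite e addrK.
- by move=> m Mm; exists m => //; exists 0; rewrite mul0r addr0.
- by exists 0 => //; exists 1; rewrite mul1r add0r.
Qed.

End Ideals.

Section Quotient.
Context (A : comPzRingType) (J : set A) (iJ : ideal J).
(** The choice made by [xget] depends only on the set of elements congruent to x, so congruent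
    elements receive the same representative. The quotient is the subtype of chosen
    representatives. *)
Definition quo_rep (x : A) : A := xget 0 [set y | J (y - x)]%classic.
Lemma quo_repP x : J (quo_rep x - x).
Proof.
rewrite /quo_rep; case: xgetP => [y _ //|/(_ x)].
by rewrite /= subrr; case: iJ.
Qed.
Lemma quo_rep_eq x y : quo_rep x = quo_rep y <-> J (x - y).
Proof.
split=> [e|Jxy].
  have := idealB iJ (quo_repP y) (quo_repP x).
  by rewrite e opprB addrC addrA subrK.
rewrite /quo_rep; congr (xget 0); apply/seteqP; split=> z /= Jz.
  have [_ JD _] := iJ; have := JD _ _ Jz Jxy; by rewrite addrA subrK.
by have := idealB iJ Jz Jxy; rewrite opprB addrA subrK.
Qed.
Lemma quo_rep_id x : quo_rep (quo_rep x) = quo_rep x.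
Proof. exact/quo_rep_eq/quo_repP. Qed.
Definition quo_car := {x : A | quo_rep x = x}.
Definition quo_pi (x : A) : quo_car := exist _ (quo_rep x) (quo_rep_id x).
Lemma quo_piE x y : quo_pi x = quo_pi y <-> J (x - y).
Proof.
split=> [[/quo_rep_eq//]|/quo_rep_eq e].
by apply: eq_exist.
Qed.
Lemma quo_valK (q : quo_car) : quo_pi (sval q) = q.
Proof. by case: q => x hx; apply: eq_exist. Qed.
Definition quo_op1 (f : A -> A) (q : quo_car) : quo_car := quo_pi (f (sval q)).
Definition quo_op2 (f : A -> A -> A) (q r : quo_car) : quo_car := quo_pi (f (sval q) (sval r)).
Lemma quo_op1E f : (forall x y, J (x - y) -> J (f x - f y)) ->
  forall x, quo_op1 f (quo_pi x) = quo_pi (f x).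
Proof. by move=> h x; apply/quo_piE/h/quo_repP. Qed.
Lemma quo_op2E f :
  (forall x y x' y', J (x - x') -> J (y - y') -> J (f x y - f x' y')) ->
  forall x y, quo_op2 f (quo_pi x) (quo_pi y) = quo_pi (f x y).
Proof. by move=> h x y; apply/quo_piE/h; apply: quo_repP. Qed.
Lemma quo_addE x y :
  quo_op2 +%R (quo_pi x) (quo_pi y) = quo_pi (x + y).
Proof.
apply: quo_op2E => {}x {}y x' y' h h'.
by rewrite opprD addrACA; case: iJ => _ + _; apply.
Qed.
Lemma quo_oppE x : quo_op1 -%R (quo_pi x) = quo_pi (- x).
Proof.
apply: quo_op1E => {}x y h.
by rewrite -opprD -mulN1r; case: iJ => _ _; apply.
Qed.
Lemma quo_mulE x y : quo_op2 *%R (quo_pi x) (quo_pi y) = quo_pi (x * y).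
Proof.
apply: quo_op2E => {}x {}y x' y' h h'; have [_ JD JM] := iJ.
rewrite -(subrK (x * y') (x * y)) -addrA; apply: JD.
  by rewrite -mulrBr; apply: JM.
by rewrite -mulrBl mulrC; apply: JM.
Qed.
Definition quo : comPzRingType.
Proof.
refine (@mkring quo_car (quo_pi 0) (quo_pi 1) (quo_op2 +%R) (quo_op1 -%R)
  (quo_op2 *%R) _ _ _ _ _ _ _ _).
- by move=> x y z; rewrite -(quo_valK x) -(quo_valK y) -(quo_valK z) !quo_addE addrA.
- by move=> x y; rewrite -(quo_valK x) -(quo_valK y) !quo_addE addrC.
- by move=> x; rewrite -(quo_valK x) !quo_addE add0r.
- by move=> x; rewrite -(quo_valK x) quo_oppE quo_addE addNr.
- by move=> x y z; rewrite -(quo_valK x) -(quo_valK y) -(quo_valK z) !quo_mulE mulrA.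
- by move=> x y; rewrite -(quo_valK x) -(quo_valK y) !quo_mulE mulrC.
- by move=> x; rewrite -(quo_valK x) !quo_mulE mul1r.
- move=> x y z; rewrite -(quo_valK x) -(quo_valK y) -(quo_valK z).
  by rewrite !(quo_mulE, quo_addE) mulrDl.
Defined.
Definition qpi : {rmorphism A -> quo} :=
  @mkrm A quo quo_pi erefl (fun x y => esym (quo_addE x y))
    (fun x y => esym (quo_mulE x y)).
Lemma qpi_eq x y : qpi x = qpi y <-> J (x - y).
Proof. exact: quo_piE. Qed.
Lemma qpi0 x : qpi x = 0 <-> J x.
Proof. by rewrite -(rmorph0 qpi) qpi_eq subr0. Qed.
Lemma qpi_surj (q : quo) : exists x, qpi x = q.
Proof. by exists (sval q); apply: quo_valK. Qed.
Lemma qpi_lift (B : comPzRingType) (f : {rmorphism A -> B}) :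
  (forall x, J x -> f x = 0) -> exists g : {rmorphism quo -> B},
    forall x, g (qpi x) = f x.
Proof.
move=> fJ; have fE x y : qpi x = qpi y -> f x = f y.
  by move/qpi_eq/fJ/eqP; rewrite rmorphB subr_eq0 => /eqP.
have [g gE] : exists g : quo -> B, forall x, g (qpi x) = f x.
  exists (fun q => f (sval q)) => x; apply: fE.
  exact: quo_valK.
have g1 : g 1 = 1 by rewrite -(rmorph1 qpi) gE rmorph1.
have gD : {morph g : x y / x + y}.
  move=> x y; have [[a <-] [b <-]] := (qpi_surj x, qpi_surj y).
  by rewrite -rmorphD !gE rmorphD.
have gM : {morph g : x y / x * y}.
  move=> x y; have [[a <-] [b <-]] := (qpi_surj x, qpi_surj y).
  by rewrite -rmorphM !gE rmorphM.
by exists (mkrm g1 gD gM).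
Qed.
End Quotient.

(** The substitute for the points of Spec A: a set that does not generate the unit ideal lies in a
    maximal ideal, so being the unit ideal can be tested on residue fields. *)
Lemma residue (K : fieldType) (A : kalg K) (S : set A) : ~ unit_ideal S ->
  exists (k : kalg K) (f : khom A k), is_field k /\ forall s, S s -> f s = 0.
Proof.
move=> S1; have [M [iM SM M1 Mx]] := ideal_max (ideal_span S) S1.
exists (kpush (qpi iM)), (khpush (qpi iM)); split; last first.
  by move=> s Ss; apply/(qpi0 iM)/SM/sub_span.
split.
  by apply/eqP => /= e; apply: M1; apply/(qpi0 iM); rewrite rmorph1.
move=> x /eqP x0; have [a ax] := qpi_surj x.
have [|b Mb] := Mx a; first by move=> /(qpi0 iM); rewrite ax.
exists (qpi iM b); apply/esym/eqP.
rewrite -ax -rmorphM mulrC -(rmorph1 (qpi iM)) -subr_eq0 -rmorphB.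
exact/eqP/(qpi0 iM).
Qed.

Lemma dchoice (T : Type) (U : T -> Type) (P : forall x, U x -> Prop) :
  (forall x, exists y, P x y) -> exists f : forall x, U x, forall x, P x (f x).
Proof.
by move=> h; exists (fun x => projT1 (cid (h x))) => x; apply: projT2 (cid (h x)).
Qed.

(** * Localization *)

Section Localization.
Context (K : fieldType).
Implicit Types A B C R : kalg K.

(** The values of g are forced: if [l a ^+ n * y = l x] then g y must be [f x * b ^+ n]. The
    relation R records this prescription, and the kernel clause of [localization] makes it
    single-valued. *)
Lemma loc_lift A B C (a : A) (l : khom A B) (f : khom A C) b :
  localization a l -> f a * b = 1 ->
  exists g : khom B C, forall x, g (l x) = f x.
Proof.
move=> [[a' aa'] lsurj lker] fab.
have fabn n : f a ^+ n * b ^+ n = 1 by rewrite -exprMn fab expr1n.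
pose R y z := exists x n, l a ^+ n * y = l x /\ z = f x * b ^+ n.
have Rf y z z' : R y z -> R y z' -> z = z'.
  move=> [x [n [e ->]]] [x' [n' [e' ->]]].
  have /lker[m] : l (a ^+ n' * x - a ^+ n * x') = 0.
    by rewrite rmorphB !rmorphM !rmorphXn -e -e' mulrCA subrr.
  move=> /(congr1 f); rewrite rmorph0 !(rmorphM, rmorphB, rmorphXn) => h.
  have {}h : f a ^+ n' * f x = f a ^+ n * f x'.
    apply/eqP; rewrite -subr_eq0; apply/eqP.
    by rewrite -[LHS]mul1r -(fabn m) mulrAC h mul0r.
  rewrite -[LHS]mulr1 -(fabn n') mulrACA [X in X * _]mulrC h mulrACA.
  by rewrite fabn mul1r.
have Rl x : R (l x) (f x) by exists x, 0%N; rewrite !expr0 mul1r mulr1.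
have RD y z y' z' : R y z -> R y' z' -> R (y + y') (z + z').
  move=> [x [n [e ->]]] [x' [n' [e' ->]]].
  exists (a ^+ n' * x + a ^+ n * x'), (n + n')%N; split.
    by rewrite !(rmorphD, rmorphM, rmorphXn) -e -e' exprD; ring.
  rewrite !(rmorphD, rmorphM, rmorphXn) exprD.
  rewrite -[f x * _]mulr1 -(fabn n') -[f x' * _]mulr1 -{1}(fabn n); ring.
have RM y z y' z' : R y z -> R y' z' -> R (y * y') (z * z').
  move=> [x [n [e ->]]] [x' [n' [e' ->]]]; exists (x * x'), (n + n')%N; split.
    by rewrite rmorphM -e -e' exprD mulrACA.
  by rewrite rmorphM exprD mulrACA.
have /choice[g gR] : forall y, exists z, R y z.
  by move=> y; have [x [n e]] := lsurj y; exists (f x * b ^+ n), x, n.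
have gl x : g (l x) = f x by apply: Rf (gR _) (Rl x).
have g1 : g 1 = 1 by rewrite -(rmorph1 l) gl rmorph1.
have gD : {morph g : x y / x + y} by move=> x y; apply: Rf (gR _) (RD _ _ _ _ _ _).
have gM : {morph g : x y / x * y} by move=> x y; apply: Rf (gR _) (RM _ _ _ _ _ _).
exists (@KHom K B C (mkrm g1 gD gM) (fun c => etrans (congr1 g (esym (khomP l c)))
  (etrans (gl _) (khomP f c)))).
exact: gl.
Qed.

Lemma loc_exists A (a : A) : exists B (l : khom A B), localization a l.
Proof.
(* Polynomials require a nonzero ring; the zero ring is its own localization. *)
have [A1|/eqP A1] := eqVneq (1 : A) 0.
  have A0 (x y : A) : x = y by rewrite -[x]mul1r -[y]mul1r A1 !mul0r.
  exists A, (kid A); split; first by exists 1.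
    by move=> y; exists y, 0%N.
  by move=> x _; exists 0%N; apply: A0.
pose A' := nz_of (introN eqP A1).
pose nzi : {rmorphism A -> A'} :=
  @mkrm A A' id erefl (fun _ _ => erefl) (fun _ _ => erefl).
pose d : {poly A'} := (a : A') *: 'X - 1.
pose J := [set p : {poly A'} | exists q, p = q * d]%classic.
have iJ : ideal J.
  split; first by exists 0; rewrite mul0r.
    by move=> _ _ [q ->] [q' ->]; exists (q + q'); rewrite mulrDl.
  by move=> c _ [q ->]; exists (c * q); rewrite mulrA.
pose li : {rmorphism A -> quo iJ} := qpi iJ \o polyC \o nzi.
have liX : li a * qpi iJ 'X = 1.
  suff : qpi iJ ((a : A')%:P * 'X) = qpi iJ 1 by rewrite rmorphM rmorph1.
  by apply/(qpi_eq iJ); exists 1; rewrite mul1r /d mul_polyC.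
exists (kpush li), (khpush li); split; first by exists (qpi iJ 'X).
  move=> y; have [p <-] := qpi_surj y; elim/poly_ind: p => [|p c [x [n e]]].
    by exists 0, 0%N; rewrite !rmorph0 mulr0.
  have Hp : qpi iJ (p * 'X + c%:P) = qpi iJ p * qpi iJ 'X + li c.
    by rewrite rmorphD rmorphM.
  exists (x + a ^+ n.+1 * c), n.+1; change (li a ^+ n * qpi iJ p = li x) in e.
  change (li a ^+ n.+1 * qpi iJ (p * 'X + c%:P) = li (x + a ^+ n.+1 * c)).
  rewrite Hp rmorphD (rmorphM li) (rmorphXn li) -e exprSr.
  rewrite mulrDr mulrACA; congr (_ + _); rewrite -[RHS]mulr1 -liX.
  by [].
move=> x /(qpi0 iJ)[q]; change ((x : A')%:P = q * d -> exists n : nat, a ^+ n * x = 0) => xq.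
exists (size q).
(* Comparing coefficients in x = q (a X - 1) gives these values; the coefficient of index [size q]
   is zero, so that power of a kills x. *)
have qE i : q`_i = - (a ^+ i * x).
  elim: i => [|i IH]; first have := congr1 (coefp 0) xq.
    rewrite /= coefC eqxx => ->; rewrite /d mulrBr mulr1 coefB -scalerAr coefZ.
    by rewrite coefMX eqxx mulr0 sub0r expr0 mul1r opprK.
  have := congr1 (coefp i.+1) xq.
  rewrite /= coefC /d mulrBr mulr1 coefB -scalerAr coefZ coefMX /= => /esym/eqP.
  by rewrite subr_eq0 => /eqP <-; rewrite IH exprS mulrN -mulrA.
apply: oppr_inj; rewrite oppr0.
by have := qE (size q); rewrite nth_default // => /esym.
Qed.

(** If T were proper it would vanish in a residue field. Then a power of each s in S, hence s
    itself, would vanish there, although S generates 1. *)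
Lemma unit_rad A (S T : set A) : unit_ideal S ->
  (forall s, S s -> exists n : nat, span T (s ^+ n)) -> unit_ideal T.
Proof.
move=> [n [c [s [Ss e]]]] h; apply: contrapT => nT.
have [k [f [[k1 kf] fT]]] := residue nT.
have fsp x : span T x -> f x = 0.
  move=> [m [d [t [Tt <-]]]]; rewrite rmorph_sum big1 // => i _.
  by rewrite rmorphM (fT _ (Tt i)) mulr0.
have fS x : S x -> f x = 0.
  move=> /h[m] /fsp; rewrite rmorphXn => e0.
  apply: contrapT => /eqP /kf[y xy]; have : f x ^+ m * y ^+ m = 1.
    by rewrite -exprMn xy expr1n.
  by rewrite e0 mul0r => /esym/eqP; rewrite (negPf k1).
move/eqP: k1; apply; rewrite -(rmorph1 f) -e rmorph_sum big1 // => i _.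
by rewrite rmorphM (fS _ (Ss i)) mulr0.
Qed.

(** The annihilator of x contains a power of each s, so it contains 1. This is how equations are
    checked locally from here on. *)
Lemma unit_pow_ann A (S : set A) x : unit_ideal S ->
  (forall s, S s -> exists n : nat, s ^+ n * x = 0) -> x = 0.
Proof.
move=> uS h; have [|n [c [s [ss e]]]] := @unit_rad A S [set y | y * x = 0]%classic uS.
  by move=> s /h[n e]; exists n; apply: sub_span.
by rewrite -[x]mul1r -e mulr_suml big1 // => i _; rewrite -mulrA ss mulr0.
Qed.

Lemma unit_range A r (a : 'I_r -> A) : unit_ideal (range a) ->
  exists c, \sum_i c i * a i = 1.
Proof.
move=> [n [c [s [Ss e]]]].
have /choice[k Hk] : forall i, exists j, a j = s i.
  by move=> i; have [j _ <-] := Ss i; exists j.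
exists (fun j => \sum_(i | k i == j) c i); rewrite -e.
rewrite (partition_big k predT) //=; apply: eq_bigr => j _.
by rewrite mulr_suml; apply: eq_bigr => i /eqP <-; rewrite Hk.
Qed.

(** The structure sheaf of an affine scheme. The sections are written as x i / a i ^ N with a common
    N, they agree on overlaps after multiplication by a common power M, and a partition of unity
    among the a i ^ (N + M) glues them. *)
Lemma glue A r (a : 'I_r -> A) (B : 'I_r -> kalg K) (l : forall i, khom A (B i))
  (b : forall i, B i) : unit_ideal (range a) ->
  (forall i, localization (a i) (l i)) ->
  (forall i j C (g : khom (B i) C) (h : khom (B j) C),
     (forall c, g (l i c) = h (l j c)) -> g (b i) = h (b j)) ->
  exists! y, forall i, l i y = b i.
Proof.
move=> ua loc cmp.
have uniq y y' : (forall i, l i y = b i) -> (forall i, l i y' = b i) -> y = y'.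
  move=> e e'; apply/eqP; rewrite -subr_eq0; apply/eqP.
  apply: unit_pow_ann ua _ => _ [i _ <-].
  by have [_ _] := loc i; apply; rewrite rmorphB e e' subrr.
have /choice[x0 /choice[n0 x0E]] : forall i, exists x n, l i (a i) ^+ n * b i = l i x.
  by move=> i; have [_ + _] := loc i; apply.
pose N := (\max_i n0 i)%N.
have [x xE] : exists x, forall i, l i (a i) ^+ N * b i = l i (x i).
  exists (fun i => a i ^+ (N - n0 i) * x0 i) => i.
  by rewrite rmorphM -x0E rmorphXn mulrA -exprD subnK // leq_bigmax.
(* The two fractions agree once a i * a j is inverted, so a power of a i * a j kills the difference
   of the cross products. *)
have /choice[m0 m0E] : forall ij : 'I_r * 'I_r, exists m : nat,
   (a ij.1 * a ij.2) ^+ m * (x ij.1 * a ij.2 ^+ N - x ij.2 * a ij.1 ^+ N) = 0.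
  move=> [i j] /=; have [C [lc lcP]] := loc_exists (a i * a j).
  have [[u]] := lcP; rewrite rmorphM => uE _ lck.
  have [g gE] := loc_lift (f := lc) (loc i) (etrans (mulrA _ _ _) uE).
  have [h hE] := @loc_lift _ _ _ _ _ lc (lc (a i) * u) (loc j)
    (etrans (mulrCA _ _ _) (etrans (mulrA _ _ _) uE)).
  have /cmp e : forall c, g (l i c) = h (l j c) by move=> c; rewrite gE hE.
  have e1 : lc (a i) ^+ N * g (b i) = lc (x i).
    by have := congr1 g (xE i); rewrite rmorphM rmorphXn !gE.
  have e2 : lc (a j) ^+ N * h (b j) = lc (x j).
    by have := congr1 h (xE j); rewrite rmorphM rmorphXn !hE.
  by apply: lck; rewrite rmorphB !rmorphM !rmorphXn -e1 -e2 e; ring.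
pose M := (\max_ij m0 ij)%N.
have cross i j : (a i * a j) ^+ M * (x i * a j ^+ N - x j * a i ^+ N) = 0.
  have hM : (m0 (i, j) <= M)%N := leq_bigmax (F := m0) (i, j).
  rewrite -(subnK hM) exprD -mulrA.
  by have := m0E (i, j) => /= ->; rewrite mulr0.
have : unit_ideal (range (fun i => a i ^+ (N + M))).
  apply: unit_rad ua _ => _ [i _ <-]; exists (N + M)%N; apply: sub_span.
  by exists i.
move=> /unit_range[c cE].
suff main j : l j (\sum_i c i * (a i ^+ M * x i)) = b j.
  by exists (\sum_i c i * (a i ^+ M * x i)); split=> // y' h; apply: uniq.
have [[u uE] _ _] := loc j.
  have uEn : l j (a j) ^+ (N + M) * u ^+ (N + M) = 1 by rewrite -exprMn uE expr1n.
  suff h : a j ^+ (N + M) * (\sum_i c i * (a i ^+ M * x i)) = a j ^+ M * x j.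
    have := congr1 (l j) h; rewrite !rmorphM !rmorphXn -xE => h'.
    rewrite -[LHS]mul1r -[RHS]mul1r -uEn.
    transitivity (u ^+ (N + M) *
      (l j (a j) ^+ (N + M) * l j (\sum_i c i * (a i ^+ M * x i)))).
      by ring.
    by rewrite h' !exprD; ring.
  rewrite mulr_sumr -[RHS]mul1r -cE mulr_suml; apply: eq_bigr => i _.
  rewrite mulrCA -!mulrA; congr (_ * _).
  have /eqP := cross i j; rewrite mulrBr subr_eq0 exprMn => /eqP h.
  rewrite !exprD.
  transitivity (a i ^+ M * a j ^+ M * (x i * a j ^+ N)); first by ring.
  by rewrite h; ring.
Qed.
End Localization.

(** * Open and closed subfunctors *)

Section Zariski.
Context (K : fieldType).
Implicit Types (X : kfunctor K) (A B C R : kalg K).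

Definition mono X R (u : X R) :=
  forall A (f g : khom R A), pmap X f u = pmap X g u -> forall r, f r = g r.

Lemma zero_ring_eq A (x y : A) : (1 : A) = 0 -> x = y.
Proof. by move=> A1; rewrite -[x]mul1r -[y]mul1r A1 !mul0r. Qed.

Lemma zero_ring_unit A (S : set A) : (1 : A) = 0 -> unit_ideal S.
Proof.
move=> A1; exists 0%N, (fun=> 0), (fun=> 0); split=> [[]//|].
exact: zero_ring_eq.
Qed.

Lemma unit_ideal1 A (S : set A) s b : S s -> s * b = 1 -> unit_ideal S.
Proof.
move=> Ss sb; exists 1%N, (fun=> b), (fun=> s); split=> //.
by rewrite big_ord1 mulrC.
Qed.

Lemma unit_ideal_img A B (f : khom A B) (S : set A) :
  unit_ideal S -> unit_ideal (f @` S)%classic.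
Proof.
move=> [n [c [s [Ss e]]]]; exists n, (f \o c), (f \o s); split.
  by move=> i; exists (s i).
rewrite -(rmorph1 f) -e rmorph_sum; apply: eq_bigr => i _ /=.
by rewrite rmorphM.
Qed.

Lemma unit_ideal_nz A (S : set A) : (1 : A) != 0 -> unit_ideal S ->
  exists2 s, S s & s <> 0.
Proof.
move=> /eqP A1 [n [c [s [Ss e]]]]; apply: contrapT => h; apply: A1.
rewrite -e big1 // => i _.
suff -> : s i = 0 by rewrite mulr0.
by apply: contrapT => si; apply: h; exists (s i).
Qed.

Lemma khom_zero_ring A B (f : khom A B) : (1 : A) = 0 -> (1 : B) = 0.
Proof. by move=> /(congr1 f); rewrite rmorph1 rmorph0. Qed.

Lemma hom_glue A r (a : 'I_r -> A) (B : 'I_r -> kalg K)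
  (l : forall i, khom A (B i)) R (gs : forall i, khom R (B i)) :
  unit_ideal (range a) -> (forall i, localization (a i) (l i)) ->
  (forall i j C (g : khom (B i) C) (h : khom (B j) C),
     (forall c, g (l i c) = h (l j c)) -> forall x, g (gs i x) = h (gs j x)) ->
  exists f : khom R A, forall i x, l i (f x) = gs i x.
Proof.
move=> ua loc cmp.
have G x : exists! y, forall i, l i y = gs i x.
  by apply: glue ua loc _ => i j C g h gh; apply: cmp.
have /choice[f fP] : forall x, exists y, forall i, l i y = gs i x.
  by move=> x; have [y [yP _]] := G x; exists y.
have fU x y : (forall i, l i y = gs i x) -> f x = y.
  have [z [_ zU]] := G x => h; have <- := zU _ h; exact/esym/zU.
have f1 : f 1 = 1 by apply: fU => i; rewrite !rmorph1.
have fD : {morph f : x y / x + y}.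
  by move=> x y; apply: fU => i; rewrite !rmorphD !fP.
have fM : {morph f : x y / x * y}.
  by move=> x y; apply: fU => i; rewrite !rmorphM !fP.
have fc c : mkrm f1 fD fM (kstr R c) = kstr A c.
  by apply: fU => i; rewrite !khomP.
by exists (KHom fc).
Qed.

Lemma yoneda_local X R (u : X R) A r (a : 'I_r -> A) (B : 'I_r -> kalg K)
  (l : forall i, khom A (B i)) (y : X A) :
  zariski_sheaf X -> mono u ->
  unit_ideal (range a) -> (forall i, localization (a i) (l i)) ->
  (forall i, yoneda u (pmap X (l i) y)) -> yoneda u y.
Proof.
move=> sX mu ua loc yu.
have [gs gsE] : exists gs : forall i, khom R (B i),
  forall i, pmap X (gs i) u = pmap X (l i) y := dchoice yu.
have [|f fE] := @hom_glue A r a B l R gs ua loc.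
  move=> i j C g h gh x.
  apply: (mu C (kcomp g (gs i)) (kcomp h (gs j))).
  rewrite !pmap_kcomp !gsE -!pmap_kcomp.
  exact: (pmap_ext (f := kcomp g (l i)) (g := kcomp h (l j))).
exists f.
have [|z [_ zU]] := sX A r a B l ua loc (fun i => pmap X (l i) y).
  move=> i j C g h gh; rewrite -!pmap_kcomp.
  exact: (pmap_ext (f := kcomp g (l i)) (g := kcomp h (l j))).
rewrite -(zU y) //; apply/esym/zU => i; rewrite -gsE -pmap_kcomp.
by apply: pmap_ext => x; rewrite -fE.
Qed.

Lemma yoneda_local_set X R (u : X R) A (S : set A) (y : X A) :
  zariski_sheaf X -> mono u -> unit_ideal S ->
  (forall s B (l : khom A B), S s -> localization s l ->
     yoneda u (pmap X l y)) -> yoneda u y.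
Proof.
move=> sX mu [n [c [s [Ss e]]]] h.
have /choice[B /dchoice[l lP]] : forall i, exists B, exists l : khom A B,
  localization (s i) l by move=> i; apply: loc_exists.
apply: (yoneda_local (a := s) (l := l)) => //.
  exists n, c, s; split=> // i; by exists i.
by move=> i; apply: h (Ss i) (lP i).
Qed.

Definition cov X A (x : X A) : set A := [set s | exists R (u : X R) B
  (l : khom A B), [/\ open_immersion u, localization s l &
    yoneda u (pmap X l x)]]%classic.

Lemma loc_unit A B (s : A) (l : khom A B) (S : set A) :
  S s -> localization s l -> unit_ideal (l @` S)%classic.
Proof. by move=> Ss [[b sb] _ _]; apply: unit_ideal1 sb; exists s. Qed.

(** If [cov x] vanished in a residue field k, the k-point above x would lie in some affine open of
    the cover. So would the principal open of some s that is nonzero in k, and this s belongs to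
    [cov x]. *)
Lemma cov_unit X A (x : X A) : scheme X -> unit_ideal (cov x).
Proof.
move=> [_ [J [R [u [ou cu]]]]]; apply: contrapT => /residue[k [f [fk f0]]].
have [j ujx] := cu _ fk (pmap X f x).
have [S SP] := (ou j).2 A x.
have /(unit_ideal_nz fk.1)[_ [s Ss <-] fs] := (SP k f).1 ujx.
apply: fs; apply: f0; have [B [l lP]] := loc_exists s.
exists (R j), (u j), B, l; split=> //.
exact/SP/(loc_unit Ss).
Qed.

Lemma span_local A (S T : set A) x : unit_ideal S ->
  (forall s, S s -> exists n : nat, span T (s ^+ n * x)) -> span T x.
Proof.
move=> uS h; have [_ TD TM] := ideal_span T.
have [|n [c [s [ss e]]]] := @unit_rad K A S [set y | span T (y * x)]%classic uS.
  by move=> s /h[n e]; exists n; apply: sub_span.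
rewrite -[x]mul1r -e mulr_suml; apply: ideal_sum (ideal_span T) _ => i _.
by rewrite -mulrA; apply: TM; apply: ss.
Qed.

(** * The closure of a family of points, as a closed subfunctor *)

Section Closure.
Context (X : kfunctor K) (sX : scheme X) (Q : forall A, X A -> Prop).

Definition van R (u : X R) : set R := [set r | forall A (f : khom R A),
  is_field A -> Q (pmap X f u) -> f r = 0]%classic.

(** A point is in the closure when, on every affine open it meets, the functions vanishing on Q
    vanish at it. Quantifying over all extensions C and all affine opens makes this independent of
    any cover; that it is given by equations is the content of [clos_closed]. *)
Definition clos : subfunctor X := fun B y => forall C (h : khom B C) R (u : X R)
  (g : khom R C), open_immersion u -> pmap X g u = pmap X h y ->
  forall r, van u r -> g r = 0.

(** The vanishing ideals on two affine opens agree where these meet. On a principal open t of u'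
    contained in u, the function r becomes a / t^n, and t * a vanishes on Q over all of u': where t
    is zero because of the factor t, elsewhere because r does. *)
Lemma van_compat R R' (u : X R) (u' : X R') A (g : khom R A) (g' : khom R' A) r :
  open_immersion u -> pmap X g u = pmap X g' u' -> van u r ->
  span (g' @` van u')%classic (g r).
Proof.
move=> ou e vr; have [S SP] := ou.2 R' u'.
have uS : unit_ideal (g' @` S)%classic by apply/SP; exists g.
apply: span_local uS _ => _ [t St <-].
have [R't [l lP]] := loc_exists t.
have [psi psiE] : yoneda u (pmap X l u') by apply/SP/(loc_unit St).
have [_ /(_ (psi r))[a [n an]] _] := lP.
have ta : van u' (t * a).
  move=> k f fk Qf; rewrite rmorphM; have [->|ft0] := eqVneq (f t) 0.
    by rewrite mul0r.
  have [b ftb] := fk.2 _ ft0; have [f' f'E] := loc_lift lP ftb.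
  have /(_ k (kcomp f' psi) fk) := vr.
  rewrite pmap_kcomp psiE -pmap_kcomp (@pmap_ext _ X _ _ _ f) // => /(_ Qf).
  move=> /= h; rewrite -(f'E a) -an rmorphM h mulr0 mulr0 //.
have [As [lA lAP]] := loc_exists (g' t); have [[b hb] _ lAk] := lAP.
have [h hE'] := loc_lift (f := kcomp lA g') lP hb.
have hE y : h (l y) = lA (g' y) := hE' y.
have gr : lA (g r) = h (psi r).
  apply: (ou.1 _ (kcomp lA g) (kcomp h psi)).
  rewrite !pmap_kcomp e psiE -!pmap_kcomp; apply: pmap_ext => x /=.
  by rewrite hE.
have /lAk[m hm] : lA (g' t ^+ n * g r - g' a) = 0.
  rewrite rmorphB rmorphM gr rmorphXn -(hE t) -(hE a) -an rmorphM rmorphXn.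
  by rewrite subrr.
exists (m + n).+1; have -> : g' t ^+ (m + n).+1 * g r = g' t ^+ m * g' (t * a).
  move/eqP: hm; rewrite mulrBr subr_eq0 => /eqP hm.
  by rewrite rmorphM mulrCA -hm exprS exprD; ring.
by have [_ _ SM] := ideal_span (g' @` van u')%classic; apply/SM/sub_span; exists (t * a).
Qed.

Lemma clos_closed : closed_subfunctor clos.
Proof.
move=> A x; have [n [c [s [cs e1]]]] := cov_unit x sX.
have /choice[D DP] : forall i, exists D : {R : kalg K & X R} * {B : kalg K & khom A B},
  [/\ open_immersion (projT2 D.1), localization (s i) (projT2 D.2) &
    yoneda (projT2 D.1) (pmap X (projT2 D.2) x)].
  move=> i; have [R [u [B [l h]]]] := cs i.
  by exists (existT _ R u, existT _ B l).
have /all_and3[ou lP yD] := DP.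
have [g gE] : exists g : forall i, khom (projT1 (D i).1) (projT1 (D i).2),
  forall i, pmap X (g i) (projT2 (D i).1) = pmap X (projT2 (D i).2) x :=
  dchoice yD.
(* The equations at x are the elements of A that lie, on each piece s i of the cover, in the ideal
   generated by the functions vanishing on Q. *)
exists [set a | forall i, span (g i @` van (projT2 (D i).1))%classic
  (projT2 (D i).2 a)]%classic => B f; split=> [cf a Sa|fS].
- have uB : unit_ideal (f @` (range s))%classic.
    apply: unit_ideal_img; exists n, c, s; split=> // i; by exists i.
  apply: unit_pow_ann uB _ => _ [_ [i _ <-] <-].
  have [Bs [lB lBP]] := loc_exists (f (s i)); have [[b hb] _ lBk] := lBP.
  have [h hE'] := loc_lift (f := kcomp lB f) (lP i) hb.
  have hE y : h (projT2 (D i).2 y) = lB (f y) := hE' y.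
  apply: lBk; rewrite -hE.
  have [m [d [t [Tt <-]]]] := Sa i; rewrite rmorph_sum big1 // => j _.
  have [r vr <-] := Tt j; rewrite rmorphM.
  suff -> : h (g i r) = 0 by rewrite mulr0.
  apply: (cf _ lB _ _ (kcomp h (g i)) (ou i)) => //.
  rewrite pmap_kcomp gE -!pmap_kcomp; apply: pmap_ext => y /=; by rewrite hE.
(* Conversely, let r vanish on Q over an arbitrary affine open u. On a principal open t of A mapped
   into u it is a fraction a / t^q, and [van_compat] on each s i shows that t^N * a is one of the
   equations for N large. So r is killed locally on C. *)
move=> C h R u k opu ku r vr.
have [T TP] := opu.2 A x.
have uT : unit_ideal (kcomp h f @` T)%classic.
  by apply/TP; exists k; rewrite pmap_kcomp.
apply: unit_pow_ann uT _ => _ [t Tt <-].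
have [At [l ltP]] := loc_exists t.
have [psi psiE] : yoneda u (pmap X l x) by apply/TP/(loc_unit Tt).
have [_ /(_ (psi r))[a [q aq]] _] := ltP.
have /choice[m mP] : forall i, exists m : nat,
   span (g i @` van (projT2 (D i).1))%classic (projT2 (D i).2 (t ^+ m * a)).
  move=> i; set li := projT2 (D i).2; set ui := projT2 (D i).1.
  have [Bt [lB lBP]] := loc_exists (li t); have [[b hb] _ lBk] := lBP.
  have [h' h'E'] := loc_lift (f := kcomp lB li) ltP hb.
  have h'E y : h' (l y) = lB (li y) := h'E' y.
  have := @van_compat _ _ u ui _ (kcomp h' psi) (kcomp lB (g i)) r opu.
  rewrite !pmap_kcomp psiE gE -!pmap_kcomp.
  rewrite (@pmap_ext _ X _ _ (kcomp h' l) (kcomp lB li)); last first.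
    by move=> y /=; rewrite h'E.
  move=> /(_ erefl vr)[p [d [w [ww we]]]].
  have [y ye] : exists y, lB (y) = lB (li a) /\ exists m : nat,
      span (g i @` van ui)%classic (li t ^+ m * y).
    have /choice[v vP] : forall j, exists v, van ui v /\ lB (g i v) = w j.
      by move=> j; have [v vv <-] := ww j; exists v.
    have lsurj : forall z, exists (x : projT1 (D i).2) (n : nat),
        lB (li t) ^+ n * z = lB x by have [] := lBP.
    have /choice[d' /choice[nd dE]] := fun j => lsurj (d j).
    pose N := (\max_j nd j)%N.
    pose z := \sum_j (li t ^+ (N - nd j) * d' j) * g i (v j).
    have zE : lB z = lB (li t) ^+ N * h' (psi r).
      rewrite /z rmorph_sum -[h' (psi r)]we mulr_sumr; apply: eq_bigr => j _.
      rewrite !rmorphM -dE (vP j).2 rmorphXn !mulrA -exprD subnK //.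
      exact: leq_bigmax.
    have /lBk[m0 m0E] : lB (li t ^+ N * li a - li t ^+ q * z) = 0.
      rewrite rmorphB !rmorphM zE !rmorphXn.
      have -> : lB (li a) = lB (li t) ^+ q * h' (psi r).
        have := congr1 h' aq; rewrite rmorphM rmorphXn !h'E /= => <- //.
      by rewrite mulrCA subrr.
    exists (li a); split=> //; exists (m0 + N)%N.
    have -> : li t ^+ (m0 + N) * li a = li t ^+ m0 * li t ^+ q * z.
      move/eqP: m0E; rewrite mulrBr subr_eq0 => /eqP m0E.
      by rewrite exprD -!mulrA m0E.
    have [_ _ SM] := ideal_span (g i @` van ui)%classic; apply: (SM).
    apply: ideal_sum (ideal_span _) _ => j _; apply: SM; apply: sub_span.
    by exists (v j) => //; have [] := vP j.
  have [ye1 [m hm]] := ye.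
  have /lBk[m1 hm1] : lB (li a - y) = 0 by rewrite rmorphB ye1 subrr.
  exists (m + m1)%N; rewrite rmorphM rmorphXn exprD.
  have -> : li t ^+ m * li t ^+ m1 * li a = li t ^+ m1 * (li t ^+ m * y).
    move/eqP: hm1; rewrite mulrBr subr_eq0 => /eqP hm1.
    by rewrite -mulrA hm1 mulrCA.
  by have [_ _ SM] := ideal_span (g i @` van ui)%classic; apply: SM.
pose N := (\max_i m i)%N.
have /fS fN : [set a | forall i, span (g i @` van (projT2 (D i).1))%classic
  (projT2 (D i).2 a)]%classic (t ^+ N * a).
  move=> i /=; have hN : (m i <= N)%N := leq_bigmax (F := m) i.
  rewrite -(subnK hN) exprD -mulrA rmorphM.
  by have [_ _ SM] := ideal_span (g i @` van (projT2 (D i).1))%classic; apply: SM.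
have [Ct [lC lCP]] := loc_exists (kcomp h f t); have [[b hb] _ lCk] := lCP.
have [h' h'E'] := loc_lift (f := kcomp lC (kcomp h f)) ltP hb.
have h'E y : h' (l y) = lC (h (f y)) := h'E' y.
have kr : lC (k r) = h' (psi r).
  apply: (opu.1 _ (kcomp lC k) (kcomp h' psi)).
  rewrite !pmap_kcomp ku psiE -!pmap_kcomp; apply: pmap_ext => y /=.
  by rewrite h'E.
have /lCk[m1 hm1] : lC (kcomp h f t ^+ (N + q) * k r) = 0.
  have := congr1 h' aq; rewrite rmorphM rmorphXn !h'E => aq'.
  rewrite rmorphM rmorphXn exprD -mulrA kr aq' -rmorphXn -rmorphM.
  have -> : kcomp h f t ^+ N * h (f a) = 0; last by rewrite rmorph0.
  by rewrite -rmorphXn -(rmorphM (kcomp h f)) /= fN rmorph0.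
by exists (m1 + (N + q))%N; rewrite exprD -mulrA.
Qed.

Lemma closP A (x : X A) : is_field A -> Q x -> clos x.
Proof.
move=> fA Qx C h R u g ou e r vr.
have [C1|/eqP C1] := eqVneq (1 : C) 0; first exact: zero_ring_eq.
have [S SP] := ou.2 A x.
have : unit_ideal (h @` S)%classic by apply/SP; exists g.
move=> /(unit_ideal_nz (introN eqP C1))[_ [s Ss <-] hs].
have [|b sb] := fA.2 s; first by apply: contra_notN hs => /eqP ->; rewrite rmorph0.
have [f fE] : yoneda u x.
  rewrite -(pmap_kid x); apply/SP; apply: unit_ideal1 sb; exists s => //.
have -> : g r = kcomp h f r.
  by apply: ou.1; rewrite e pmap_kcomp fE.
by rewrite /= vr ?rmorph0 // fE.
Qed.

Lemma clos_van R (u : X R) r : open_immersion u -> clos u -> van u r -> r = 0.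
Proof.
move=> ou cu vr.
by apply: (cu R (kid R) R u (kid R) ou).
Qed.

End Closure.
End Zariski.

(** * Affine and integral schemes *)

Section Spec.
Context (K : fieldType).
Implicit Types (X : kfunctor K) (A B C R : kalg K).

Lemma rmorph_eq (A B : pzRingType) (f g : {rmorphism A -> B}) :
  (forall a, f a = g a) -> f = g.
Proof.
case: f g => [f [[fD] [f1]]] [g [[gD] [g1]]] /= fg.
have e : f = g by apply/funext.
by subst g; rewrite (Prop_irrelevance fD gD) (Prop_irrelevance f1 g1).
Qed.

Lemma khom_eq A B (f g : khom A B) : (forall a, f a = g a) -> f = g.
Proof.
case: f g => [f hf] [g hg] /= fg; have e := rmorph_eq fg; subst g.
by congr KHom; apply: Prop_irrelevance.
Qed.

Fact spec_id R A (f : khom A A) (x : khom R A) :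
  (forall a, f a = a) -> kcomp f x = x.
Proof. by move=> fE; apply: khom_eq => r /=; rewrite fE. Qed.

Fact spec_comp R A B C (f : khom A B) (g : khom B C) (h : khom A C)
  (x : khom R A) : (forall a, h a = g (f a)) -> kcomp h x = kcomp g (kcomp f x).
Proof. by move=> hE; apply: khom_eq => r /=; rewrite hE. Qed.

Definition spec R : kfunctor K :=
  @KFunctor K (khom R) (fun A B => @kcomp K R A B) (@spec_id R) (@spec_comp R).

Definition represents X R (u : X R) :=
  mono u /\ forall A (x : X A), yoneda u x.

Lemma spec_represents R : represents (kid R : spec R R).
Proof.
split=> [A f g|A x]; last by exists x; apply: khom_eq.
by move=> /(congr1 (fun h : khom R A => h : R -> A)) /= fg r; apply: (congr1 (@^~ r) fg).
Qed.

Lemma represents_open X R (u : X R) : represents u -> open_immersion u.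
Proof.
move=> [mu su]; split=> // A x; exists [set 1]%classic => B f; split=> _.
  by apply: (@unit_ideal1 _ _ _ 1 1); rewrite ?mulr1 //; exists 1; rewrite ?rmorph1.
exact: su.
Qed.

Lemma spec_sheaf R : zariski_sheaf (spec R).
Proof.
move=> A r a B l ua loc x cmp.
have [|f fE] := @hom_glue K A r a B l R x ua loc.
  move=> i j C g h gh y.
  by have /(congr1 (fun h : khom R C => h y)) := cmp i j C g h gh.
exists f; split=> [i|g gE]; first by apply: khom_eq => y; apply: fE.
apply: khom_eq => y.
have [|z [_ zU]] := glue (b := fun i => x i y) ua loc.
  move=> i j C g' h gh.
  by have /(congr1 (fun h : khom R C => h y)) := cmp i j C g' h gh.
rewrite -(zU (f y)) // -(zU (g y)) // => i.
exact: (congr1 (fun h : khom R (B i) => h y) (gE i)).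
Qed.

Lemma spec_scheme R : scheme (spec R).
Proof.
split; first exact: spec_sheaf.
exists unit, (fun=> R), (fun=> kid R); split=> [_|A _ x].
  exact/represents_open/spec_represents.
by exists tt; apply: (spec_represents R).2.
Qed.

Lemma spec_finite_type R n (a : 'I_n -> R) : generates a -> finite_type (spec R).
Proof.
move=> ga; exists 1%N, (fun=> R), (fun=> kid R); split; last by exists n, a.
split=> [_|A _ x]; first exact/represents_open/spec_represents.
by exists ord0; apply: (spec_represents R).2.
Qed.

Lemma spec_separated R : separated (spec R).
Proof.
move=> A x y; exists [set s | exists r, s = x r - y r]%classic => B f; split.
  move=> e _ [r ->]; apply/eqP; rewrite rmorphB subr_eq0; apply/eqP.
  exact: (congr1 (fun h : khom R B => h r) e).
move=> h; apply: khom_eq => r; have /eqP := h _ (ex_intro _ r erefl).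
by rewrite rmorphB subr_eq0 => /eqP.
Qed.

Lemma spec_affine R : affine (spec R).
Proof. by exists R, (kid R); exact: (spec_represents R). Qed.

Lemma loc_domain A B (s : A) (l : khom A B) : domain A -> s <> 0 ->
  localization s l ->
  (forall a, l a = 0 -> a = 0) /\ forall x y : B, x * y = 0 -> x = 0 \/ y = 0.
Proof.
move=> [A1 dA] s0 [[b sb] ls lk].
have sn n a : s ^+ n * a = 0 -> a = 0.
  by elim: n => [|n IH]; rewrite ?mul1r // exprS -mulrA => /dA[].
have inj a : l a = 0 -> a = 0 by move=> /lk[n /sn].
split=> // x y xy; have [[x0 [n xE]] [y0 [m yE]]] := (ls x, ls y).
have un k z : l s ^+ k * z = 0 -> z = 0.
  move=> e; rewrite -[z]mul1r -(expr1n _ k) -sb exprMn mulrAC e mul0r //.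
have /dA[x00|y00] : x0 * y0 = 0.
  by apply: inj; rewrite rmorphM -xE -yE mulrACA xy mulr0.
- by left; apply: (un n); rewrite xE x00 rmorph0.
- by right; apply: (un m); rewrite yE y00 rmorph0.
Qed.

(** An affine open R' of Spec R is covered by localizations R_s that are also open in Spec R. By
    [key], R' embeds in each R_s with s nonzero, because a nonzero s is a nonzerodivisor in every
    other R_t. Hence R' is a domain. *)
Lemma represents_integral X R (u0 : X R) : represents u0 -> domain R -> integral X.
Proof.
move=> [mu0 su0] dR; split; first by exists R; split; [exact: dR.1|exists].
move=> R' u' [mu' ou'] R'1 a b ab0.
have [phi phiE] := su0 _ u'.
have [S SP] := ou' R u0.
have uS : unit_ideal (phi @` S)%classic.
  by apply/SP; rewrite phiE; exists (kid R'); rewrite pmap_kid.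
have psiP s : S s -> exists (Rs : kalg K) (l : khom R Rs) (psi : khom R' Rs),
   [/\ localization s l, forall r, psi (phi r) = l r &
     forall x, psi x = 0 -> exists n : nat, phi s ^+ n * x = 0].
  move=> Ss; have [Rs [l lP]] := loc_exists s.
  have [psi psiE] : yoneda u' (pmap X l u0) by apply/SP/(loc_unit Ss).
  exists Rs, l, psi; split=> // [r|x x0].
    by apply: (mu0 _ (kcomp psi phi) l); rewrite pmap_kcomp phiE psiE.
  have [R's [l' l'P]] := loc_exists (phi s); have [[c hc] _ l'k] := l'P.
  have [h hE] := loc_lift (f := kcomp l' phi) lP hc.
  apply: l'k; have -> : l' x = kcomp h psi x.
    apply: mu'; rewrite pmap_kcomp psiE -[in LHS]phiE -!pmap_kcomp.
    by apply: pmap_ext => r; rewrite [RHS]hE.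
  by rewrite /= x0 rmorph0.
have key s x : S s -> s <> 0 -> (exists n : nat, phi s ^+ n * x = 0) -> x = 0.
  move=> Ss s0 [n sx]; apply: unit_pow_ann uS _ => _ [t St <-].
  have [->|/eqP t0] := eqVneq t 0.
    by exists 1%N; rewrite rmorph0 mul0r.
  have [Rt [l [psi [lP psiE psik]]]] := psiP t St.
  have [linj dRt] := loc_domain dR t0 lP; apply: psik.
  have := congr1 psi sx; rewrite rmorphM rmorphXn psiE rmorph0 => /dRt[]// ls0.
  case: s0; apply: linj; elim: n ls0 {sx} => [|n IH].
    by rewrite expr0 => /(congr1 ( *%R (l s))); rewrite mulr1 mulr0.
  by rewrite exprS => /dRt[].
have [_ [s Ss <-] phis0] := unit_ideal_nz R'1 uS.
have s0 : s <> 0 by move=> e; apply: phis0; rewrite e rmorph0.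
have [Rs [l [psi [lP psiE psik]]]] := psiP s Ss.
have [_ dRs] := loc_domain dR s0 lP.
have := congr1 psi ab0; rewrite rmorphM rmorph0 => /dRs[/psik h|/psik h].
- by left; apply: key Ss s0 h.
- by right; apply: key Ss s0 h.
Qed.

Lemma spec_variety R n (a : 'I_n -> R) :
  generates a -> domain R -> variety (spec R).
Proof.
move=> ga dR; split.
- exact: spec_scheme.
- exact: spec_finite_type ga.
- exact: spec_separated.
- exact: represents_integral (spec_represents R) dR.
Qed.

(** * Two nonempty affine opens of an integral scheme meet *)

Section Irreducible.
Context (X : kfunctor K) (sX : zariski_sheaf X).
Context (R1 R2 : kalg K) (u1 : X R1) (u2 : X R2).
Context (o1 : open_immersion u1) (o2 : open_immersion u2).
Context (disj : forall A (x : X A), is_field A -> yoneda u1 x -> ~ yoneda u2 x).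

Let P : kalg K :=
  @KAlg K (R1 * R2)%type (@mkrm K (R1 * R2)%type
    (fun c => (kstr R1 c, kstr R2 c))
    (congr2 pair (rmorph1 _) (rmorph1 _))
    (fun x y => congr2 pair (rmorphD _ _ _) (rmorphD _ _ _))
    (fun x y => congr2 pair (rmorphM _ _ _) (rmorphM _ _ _))).

Let Rb (b : bool) : kalg K := if b then R1 else R2.
Let ub (b : bool) : X (Rb b) := if b return X (Rb b) then u1 else u2.
Let pr1 : khom P R1 := @KHom K P R1
  (@mkrm P R1 (fun z : R1 * R2 => z.1) erefl (fun _ _ => erefl) (fun _ _ => erefl))
  (fun=> erefl).
Let pr2 : khom P R2 := @KHom K P R2
  (@mkrm P R2 (fun z : R1 * R2 => z.2) erefl (fun _ _ => erefl) (fun _ _ => erefl))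
  (fun=> erefl).
Let prb b : khom P (Rb b) := if b return khom P (Rb b) then pr1 else pr2.
Let eb (b : bool) : P := if b then (1, 0) else (0, 1).

Let prbE b : prb b (eb b) = 1. Proof. by case: b. Qed.
Let prbN b : prb (~~ b) (eb b) = 0. Proof. by case: b. Qed.
Let ebD : eb true + eb false = 1.
Proof. by congr pair; rewrite ?addr0 ?add0r. Qed.

Let eb_loc b : localization (eb b) (prb b).
Proof.
split.
- by exists 1; rewrite prbE mulr1.
- case: b => y; [exists (y, 0), 0%N|exists (0, y), 0%N]; by rewrite mul1r.
- case: b => -[x1 x2] h; exists 1%N.
    by have -> : x1 = 0 := h; congr pair; rewrite ?mulr0 ?mul0r.
  by have -> : x2 = 0 := h; congr pair; rewrite ?mulr0 ?mul0r.
Qed.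

Let lift_prb b C (g : khom P C) : g (eb b) = 1 ->
  exists h : khom (Rb b) C, forall x, h (prb b x) = g x.
Proof.
by move=> e; apply: (@loc_lift _ _ _ _ _ _ g 1 (eb_loc b)); rewrite e mulr1.
Qed.

(** The zero ring is covered by the empty family, so a sheaf has at most one point over it. This
    gives the compatibility of u1 and u2 on their empty overlap. *)
Let zero_pt C (x y : X C) : (1 : C) = 0 -> x = y.
Proof.
move=> C1; have u0 : unit_ideal (range (fun _ : 'I_0 => 0 : C)).
  exact: zero_ring_unit.
have [||z [_ zU]] := sX (B := fun=> C) (l := fun=> kid C) u0 _
  (x := fun i : 'I_0 => match i with Ordinal m h => False_rect _ (notF h) end).
- by case.
- by case.
by rewrite -(zU x) ?(zU y) //; case.
Qed.

Let o (i : 'I_2) : bool := i == ord0.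

Let w_exists : exists w : X P, forall b, pmap X (prb b) w = ub b.
Proof.
have uu : unit_ideal (range (fun i : 'I_2 => eb (o i))).
  exists 2%N, (fun=> 1), (fun i : 'I_2 => eb (o i)); split.
    by move=> i; exists i.
  by rewrite big_ord_recl big_ord1 !mul1r; apply: ebD.
have [|w [wP _]] := sX (B := fun i => Rb (o i)) (l := fun i => prb (o i)) uu
  (fun i => eb_loc (o i)) (x := fun i => ub (o i)); last first.
  by exists w => -[]; [apply: (wP ord0)|apply: (wP ord_max)].
move=> i j C; move: (o i) (o j) => b b' g h gh.
have [e|ne] := eqVneq b' b.
  subst b'; apply: pmap_ext => r.
  by have [x <-] : exists x, prb b x = r;
    [case: (b) r => r; [exists (r, 0)|exists (0, r)]|apply: gh].
apply: zero_pt; rewrite -(rmorph1 g) -(prbE b) gh.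
have e : b' = ~~ b by move: ne; clear; case: b'; case: b.
by subst b'; rewrite prbN rmorph0.
Qed.

Let field_eb k (g : khom P k) : is_field k -> exists b, g (eb b) = 1.
Proof.
move=> fk; have [g1|n1] := eqVneq (g (eb true)) 0.
  by exists false; rewrite -(rmorph1 g) -ebD rmorphD g1 add0r.
have [c hc] := fk.2 _ n1; exists true.
have ee : eb true * eb true = eb true by congr pair; rewrite ?mulr1 ?mulr0.
by rewrite -[RHS]hc -{2}ee rmorphM -mulrA hc mulr1.
Qed.

Let disjb b A (x : X A) : is_field A -> yoneda (ub b) x -> ~ yoneda (ub (~~ b)) x.
Proof.
by move=> fA; case: b => h1 h2; [apply: (disj fA h1 h2)|apply: (disj fA h2 h1)].
Qed.

Let ob b : open_immersion (ub b). Proof. by case: b. Qed.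

Let yoneda_w w : (forall b, pmap X (prb b) w = ub b) -> forall A (f : khom P A) b,
  f (eb b) = 1 -> yoneda (ub b) (pmap X f w).
Proof.
move=> wP A f b fe; have [h hE] := lift_prb fe.
exists h; rewrite -wP -pmap_kcomp; exact: pmap_ext.
Qed.

Let ebM b : eb b * eb b = eb b.
Proof. by case: b; congr pair; rewrite ?mulr1 ?mulr0. Qed.
Let ebN b : eb (~~ b) = 1 - eb b.
Proof. by rewrite -ebD; case: b; [rewrite addrC addKr|rewrite addrK]. Qed.

(** Two homomorphisms f and g giving the same point must split the target ring in the same way. The
    idempotent [f (eb b) * g (eb (~~ b))] vanishes, since otherwise the point would lie in both
    disjoint opens over some residue field. On each piece injectivity is that of u1 or u2. *)
Let w_mono w : (forall b, pmap X (prb b) w = ub b) -> mono w.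
Proof.
move=> wP A f g fg.
have half b : f (eb b) * g (eb (~~ b)) = 0.
  set e := _ * _; apply: contrapT => e0.
  have ee : e * e = e by rewrite /e mulrACA -!rmorphM !ebM.
  have nu : ~ unit_ideal [set 1 - e]%classic.
    move=> [n [c [s [Ss h]]]]; apply: e0; rewrite -[e]mulr1 -h mulr_sumr big1 // => i _.
    by rewrite Ss mulrCA mulrBr mulr1 ee subrr mulr0.
  have [k [q [fk qe]]] := residue nu.
  have qe1 : q (f (eb b)) * q (g (eb (~~ b))) = 1.
    by apply/esym/eqP; rewrite -subr_eq0 -rmorphM -(rmorph1 q) -rmorphB qe.
  have i1 (z : k) z' : z * z' = 1 -> z * z = z -> z = 1.
    by move=> h1 h2; rewrite -[LHS]mulr1 -h1 mulrA h2.
  have y1 : q (f (eb b)) = 1 by apply: i1 qe1 _; rewrite -!rmorphM ebM.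
  have y2 : q (g (eb (~~ b))) = 1.
    by rewrite mulrC in qe1; apply: i1 qe1 _; rewrite -!rmorphM ebM.
  apply: (disjb (b := b) (x := pmap X (kcomp q f) w) fk).
    exact: yoneda_w.
  rewrite pmap_kcomp fg -pmap_kcomp; exact: yoneda_w.
have fge b : f (eb b) = g (eb b).
  have := half b; have := half (~~ b); rewrite negbK ebN !(rmorphB, rmorph1).
  rewrite mulrBl mul1r mulrBr mulr1 => /eqP h1 /eqP h2.
  move: h1 h2; rewrite !subr_eq0 => /eqP h1 /eqP h2.
  exact: etrans h2 (esym h1).
have main b x : f (eb b) * (f x - g x) = 0.
  have [B [l lP]] := loc_exists (f (eb b)); have [[c hc] _ lk] := lP.
  have l1 : l (f (eb b)) = 1.
    by rewrite -[LHS]mulr1 -{1}hc mulrA -!rmorphM ebM.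
  have [h hE] := lift_prb (g := kcomp l f) l1.
  have [h' h'E] := lift_prb (g := kcomp l g) (etrans (congr1 l (esym (fge b))) l1).
  have e : l (f x) = l (g x).
    have hE' y : h (prb b y) = l (f y) := hE y.
    have h'E' y : h' (prb b y) = l (g y) := h'E y.
    rewrite -hE' -h'E'; apply: (ob b).1; rewrite -wP -!pmap_kcomp.
    rewrite (pmap_ext (g := kcomp l f)) // [RHS](pmap_ext (g := kcomp l g)) //.
    by rewrite !pmap_kcomp fg.
  have /lk[n hn] : l (f x - g x) = 0 by rewrite rmorphB e subrr.
  case: n hn => [|n]; first by rewrite mul1r => ->; rewrite mulr0.
  suff -> : f (eb b) ^+ n.+1 = f (eb b) by [].
  by elim: n => // n IH; rewrite exprS IH -rmorphM ebM.
move=> x; apply/eqP; rewrite -subr_eq0; apply/eqP.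
by rewrite -[LHS]mul1r -(rmorph1 f) -ebD rmorphD mulrDl !main addr0.
Qed.

Let w_open w : (forall b, pmap X (prb b) w = ub b) -> open_immersion w.
Proof.
move=> wP; have mw := w_mono wP; split=> // A x.
have [S SP] : exists S : bool -> set A, forall b B (f : khom A B),
    yoneda (ub b) (pmap X f x) <-> unit_ideal (f @` S b)%classic.
  apply: (@dchoice bool (fun=> set A) (fun b S => forall B (f : khom A B),
    yoneda (ub b) (pmap X f x) <-> unit_ideal (f @` S)%classic)) => b.
  exact: (ob b).2.
exists [set a | exists b, S b a]%classic => B f; split.
  move=> [g gE]; apply: contrapT => nu.
  have [k [q [fk qS]]] := residue nu.
  have [b gb] := field_eb (kcomp q g) fk.
  have : yoneda (ub b) (pmap X (kcomp q f) x).
    by rewrite pmap_kcomp -gE -pmap_kcomp; apply: yoneda_w.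
  move=> /SP /(unit_ideal_nz fk.1)[_ [s Ss <-]]; apply; apply: qS.
  by exists s => //; exists b.
move=> uS; apply: (yoneda_local_set (S := (f @` [set a | exists b, S b a])%classic)) => //.
move=> _ C l [a [b Sb] <-] lP.
have [h hE] : yoneda (ub b) (pmap X l (pmap X f x)).
  rewrite -pmap_kcomp; apply/SP; have [[c hc] _ _] := lP.
  by apply: unit_ideal1 hc; exists a.
by exists (kcomp h (prb b)); rewrite pmap_kcomp wP.
Qed.

(** Disjoint affine opens together form the affine open Spec (R1 * R2), and its two idempotents have
    product 0. *)
Lemma disjoint_opens : integral X -> (1 : R1) != 0 -> (1 : R2) = 0.
Proof.
move=> [_ iX] R11; have [w wP] := w_exists.
have := iX P w (w_open wP) _ (eb true) (eb false).
have P1 : (1 : P) != 0.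
  apply: contraNneq R11 => /(congr1 (prb true)) h; apply/eqP; exact: h.
case=> //.
- by congr pair; rewrite ?mulr0 ?mul0r.
- by move=> /(congr1 (prb true)) h; move/eqP: R11; case; exact: h.
- by move=> /(congr1 (prb false)) h; exact: h.
Qed.

End Irreducible.

Section IntegralSchemes.
Context (X : kfunctor K) (sX : scheme X) (iX : integral X).

Lemma opens_meet R1 R2 (u1 : X R1) (u2 : X R2) :
  open_immersion u1 -> open_immersion u2 -> (1 : R1) != 0 -> (1 : R2) != 0 ->
  exists A (x : X A), [/\ is_field A, yoneda u1 x & yoneda u2 x].
Proof.
move=> o1 o2 R11 R21; apply: contrapT => h; move/eqP: R21; apply.
apply: (disjoint_opens sX.1 o1 o2) => // A x fA y1 y2.
by apply: h; exists A, x.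
Qed.

(** The functions on R2 that define Z vanish on a principal open of R2 lying in u1, which exists
    because the two opens meet. R2 is a domain and embeds in that localization. *)
Lemma closed_dense (Z : subfunctor X) R1 R2 (u1 : X R1) (u2 : X R2) :
  closed_subfunctor Z -> open_immersion u1 -> open_immersion u2 ->
  (1 : R1) != 0 -> Z R1 u1 -> Z R2 u2.
Proof.
move=> cZ o1 o2 R11 Zu1; have [S SP] := cZ R2 u2.
rewrite -(pmap_kid u2); apply/SP => s Ss /=.
have [R21|R21] := eqVneq (1 : R2) 0; first exact: zero_ring_eq.
have [A [x [fA [f1 f1E] [f2 f2E]]]] := opens_meet o1 o2 R11 R21.
have [T TP] := o1.2 R2 u2.
have : unit_ideal (f2 @` T)%classic by apply/TP; exists f1; rewrite f1E.
move=> /(unit_ideal_nz fA.1)[_ [t Tt <-] t0].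
have t0' : t <> 0 by move=> e; apply: t0; rewrite e rmorph0.
have [B [l lP]] := loc_exists t.
have [g gE] : yoneda u1 (pmap X l u2) by apply/TP/(loc_unit Tt).
have dR2 : domain R2 by split=> //; exact: (iX.2 R2 u2 o2 R21).
apply: (loc_domain dR2 t0' lP).1.
have [S1 S1P] := cZ R1 u1.
move: s Ss; apply/SP; rewrite -gE; apply/S1P => s Ss.
suff -> : s = 0 by rewrite rmorph0.
have : Z R1 (pmap X (kid R1) u1) by rewrite pmap_kid.
by move=> /S1P /(_ s Ss).
Qed.

Lemma proper_open (Z : subfunctor X) R (u : X R) : proper_closed Z ->
  open_immersion u -> (1 : R) != 0 -> ~ Z R u.
Proof.
move=> [cZ [A [x nZ]]] ou R1 Zu; apply: nZ; have [S SP] := cZ A x.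
rewrite -(pmap_kid x); apply/SP => a Sa /=.
apply: unit_pow_ann (cov_unit x sX) _ => s [R' [u' [B [l [ou' [_ _ lk] [g gE]]]]]].
apply: lk; move: a Sa; apply/SP; rewrite -gE.
have [S' S'P] := cZ R' u'; apply/S'P => r S'r.
suff -> : r = 0 by rewrite rmorph0.
have : Z R' (pmap X (kid R') u') by rewrite pmap_kid; apply: closed_dense R1 Zu.
by move=> /S'P /(_ r S'r).
Qed.

(** The form in which proper closed subsets are used: inside a nonempty affine open they lie in the
    zero set of a single nonzero function. *)
Lemma proper_open_fun (Z : subfunctor X) R (u : X R) : proper_closed Z ->
  open_immersion u -> (1 : R) != 0 ->
  exists2 r : R, r <> 0 & forall A (f : khom R A), Z A (pmap X f u) -> f r = 0.
Proof.
move=> pZ ou R1; have [S SP] := pZ.1 R u.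
apply: contrapT => h; apply: (proper_open pZ ou R1).
rewrite -(pmap_kid u); apply/SP => s Ss /=; apply: contrapT => s0.
by apply: h; exists s => // A f /SP; apply.
Qed.

End IntegralSchemes.
End Spec.

(** * Finitely presented algebras *)

Section Evaluation.
Context (R : idomainType) (A : comPzRingType) (f : {rmorphism R -> A}) (x : A).

Definition evp_fun (p : {poly R}) : A := \sum_(i < size p) f p`_i * x ^+ i.

Fact evp_morph : [/\ evp_fun 1 = 1, {morph evp_fun : p q / p + q} &
  {morph evp_fun : p q / p * q}].
Proof.
have [A1|A1] := eqVneq (1 : A) 0.
  have A0 (y z : A) : y = z by rewrite -[y]mul1r -[z]mul1r A1 !mul0r.
  by split=> [|p q|p q]; apply: A0.
pose f' : {rmorphism R -> nz_of A1} :=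
  @mkrm R (nz_of A1) f (rmorph1 f) (rmorphD f) (rmorphM f).
have fE p : evp_fun p = (map_poly f' p).[x : nz_of A1].
  rewrite (@horner_coef_wide _ (size p)) ?size_poly //.
  by apply: eq_bigr => i _; rewrite coef_map.
by split=> [|p q|p q]; rewrite !fE ?rmorph1 ?rmorphD ?rmorphM ?hornerE.
Qed.

Definition evp : {rmorphism {poly R} -> A} :=
  let: And3 f1 fD fM := evp_morph in mkrm f1 fD fM.

Lemma evpE p : evp p = evp_fun p.
Proof. by rewrite /evp; case: evp_morph. Qed.

Lemma evp_wide n (p : {poly R}) : (size p <= n)%N -> evp p = \sum_(i < n) f p`_i * x ^+ i.
Proof.
move=> sn; rewrite evpE /evp_fun (big_ord_widen n (fun i => f p`_i * x ^+ i)) //.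
rewrite big_mkcond; apply: eq_bigr => i _; case: ltnP => // h.
by rewrite nth_default // rmorph0 mul0r.
Qed.

Lemma evpC c : evp c%:P = f c.
Proof.
by rewrite (@evp_wide 1) ?size_polyC ?leq_b1 // big_ord1 coefC eqxx mulr1.
Qed.

Lemma evpX : evp 'X = x.
Proof.
rewrite (@evp_wide 2) ?size_polyX // big_ord_recl big_ord1 !coefX /=.
by rewrite rmorph0 rmorph1 mul0r add0r mul1r.
Qed.

End Evaluation.

Lemma evp_comp (R : idomainType) (A B : comPzRingType) (f : {rmorphism R -> A})
  (g : {rmorphism A -> B}) (h : {rmorphism R -> B}) x p :
  (forall c, h c = g (f c)) -> g (evp f x p) = evp h (g x) p.
Proof.
move=> hE; rewrite !evpE rmorph_sum; apply: eq_bigr => i _.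
by rewrite rmorphM rmorphXn hE.
Qed.

(** Polynomials in n variables as iterated univariate ones, so that the basis theorem, base change
    and specialization go by induction on n. Variable 0 is the outermost. *)
Fixpoint itpoly (R : idomainType) (n : nat) : idomainType :=
  if n is m.+1 then ({poly itpoly R m} : idomainType) else R.

Fixpoint itC (R : idomainType) n : {rmorphism R -> itpoly R n} :=
  match n return {rmorphism R -> itpoly R n} with
  | 0 => idfun
  | m.+1 => polyC \o itC R m
  end.

Fixpoint itX (R : idomainType) n : 'I_n -> itpoly R n :=
  match n return 'I_n -> itpoly R n with
  | 0 => fun k => 0
  | m.+1 => fun k => if unlift ord0 k is Some i then (itX R i)%:P else 'X
  end.

Section Ev.
Context (R : idomainType).

Fixpoint ev (A : comPzRingType) (h : {rmorphism R -> A}) n :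
  ('I_n -> A) -> {rmorphism itpoly R n -> A} :=
  match n return ('I_n -> A) -> {rmorphism itpoly R n -> A} with
  | 0 => fun _ => h
  | m.+1 => fun v => evp (ev h (v \o lift ord0)) (v ord0)
  end.

Lemma ev_itC (A : comPzRingType) (h : {rmorphism R -> A}) n (v : 'I_n -> A) c :
  ev h v (itC R n c) = h c.
Proof. by elim: n v => //= n IH v; rewrite evpC. Qed.

Lemma ev_itX (A : comPzRingType) (h : {rmorphism R -> A}) n (v : 'I_n -> A) k :
  ev h v (itX R k) = v k.
Proof.
elim: n v k => [|n IH] v k; first by case: k.
by rewrite /=; case: unliftP => [i ->|->]; rewrite ?evpC ?IH ?evpX.
Qed.

Lemma ev_comp (A B : comPzRingType) (h : {rmorphism R -> A}) (g : {rmorphism A -> B})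
  (h' : {rmorphism R -> B}) n (v : 'I_n -> A) (w : 'I_n -> B) p :
  (forall c, h' c = g (h c)) -> (forall k, w k = g (v k)) ->
  g (ev h v p) = ev h' w p.
Proof.
move=> hE; elim: n v w p => [|n IH] v w p wE; first by rewrite /= hE.
rewrite /= wE; apply: evp_comp => c.
by apply/esym/IH => k /=; rewrite wE.
Qed.

Lemma ev_ext (A : comPzRingType) (h : {rmorphism R -> A}) n (v w : 'I_n -> A) p :
  (forall k, v k = w k) -> ev h v p = ev h w p.
Proof. by move=> vw; rewrite (_ : v = w) //; apply/funext. Qed.

Lemma ev_univ n p : ev (itC R n) (itX R (n := n)) p = p.
Proof.
elim: n p => //= n IH p.
have -> : unlift ord0 (ord0 : 'I_n.+1) = None by case: unliftP.
rewrite evpE -[RHS]coefK poly_def; apply: eq_bigr => i _.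
rewrite -mul_polyC; congr (_ * _).
rewrite -[in RHS](IH p`_i); apply/esym/(ev_comp (g := polyC)) => // k /=.
by rewrite liftK.
Qed.

Lemma itpoly_ind n (S : itpoly R n -> Prop) :
  (forall c, S (itC R n c)) -> (forall k, S (itX R k)) ->
  (forall x y, S x -> S y -> S (x + y)) ->
  (forall x y, S x -> S y -> S (x * y)) -> forall p, S p.
Proof.
elim: n S => //= n IH S SC SX SD SM p.
have S0 : S 0 by have := SC 0; rewrite !rmorph0.
have SP q : S q%:P.
  apply: (IH (fun q => S q%:P)) => [c|k|x y Sx Sy|x y Sx Sy].
  - exact: SC.
  - by have := SX (lift ord0 k); rewrite liftK.
  - by rewrite polyCD; apply: SD.
  - by rewrite polyCM; apply: SM.
elim/poly_ind: p => // p c Sp; apply: SD => //; apply: SM => //.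
by have := SX ord0; case: unliftP.
Qed.

End Ev.

(** * Hilbert's basis theorem *)

Section Noetherian.

Definition noeth (A : comPzRingType) := forall S : set A, exists s : seq A,
  (forall x, x \in s -> S x) /\
  forall x, S x -> span [set y | y \in s]%classic x.

Lemma span_fin (A : comPzRingType) (S : set A) x : span S x ->
  exists s : seq A, (forall y, y \in s -> S y) /\
    span [set y | y \in s]%classic x.
Proof.
move=> [n [c [s [Ss e]]]]; exists [seq s i | i <- enum 'I_n]; split.
  by move=> _ /mapP[i _ ->].
by exists n, c, s; split=> // i /=; apply: map_f; rewrite mem_enum.
Qed.

Lemma noeth_field (K : fieldType) : noeth K.
Proof.
move=> S; have [[x [Sx x0]]|h] := pselect (exists x, S x /\ x <> 0).
  exists [:: x]; split=> [y|y _]; first by rewrite inE => /eqP ->.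
  have [_ _ SM] := ideal_span [set z | z \in [:: x]]%classic.
  rewrite -[y](mulfVK (introN eqP x0)); apply: SM; apply: sub_span.
  by rewrite /= inE.
exists [::]; split=> // x Sx; have -> : x = 0.
  by apply: contrapT => x0; apply: h; exists x.
have [S0 _ _] := @ideal_span K [set z | z \in ([::] : seq K)]%classic.
exact: S0.
Qed.

Lemma noeth_ideal (A : comPzRingType) : (forall J : set A, ideal J ->
   exists s : seq A, (forall x, x \in s -> J x) /\
     forall x, J x -> span [set y | y \in s]%classic x) -> noeth A.
Proof.
move=> h S; have [s [sJ Js]] := h _ (ideal_span S).
have [t tP] : exists t : A -> seq A, forall x, x \in s ->
    (forall y, y \in t x -> S y) /\ span [set y | y \in t x]%classic x.
  suff /choice[t tP] : forall x, exists t : seq A, x \in s ->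
    (forall y, y \in t -> S y) /\ span [set y | y \in t]%classic x by exists t.
  move=> x; have [xs|] := boolP (x \in s); last by exists [::].
  by have [t tP] := span_fin (sJ x xs); exists t.
exists (flatten [seq t x | x <- s]); split.
  by move=> y /flatten_mapP[x /tP[tx _] /tx].
move=> x /sub_span/Js; apply: span_mono => y /= ys.
have [_] := tP y ys; apply: span_mono => z /= zt; apply: sub_span.
by apply/flatten_mapP; exists y.
Qed.

(** By ideals of leading coefficients: L d collects the coefficients of index d of the members of J
    of degree at most d. Finitely many generators of the union of the L d deal with all degrees from
    N on, and finitely many generators of each L d with d < N deal with the others. *)
Lemma hilbert_basis (R : idomainType) : noeth R -> noeth {poly R}.
Proof.
move=> nR; apply: noeth_ideal => J iJ; have [J0 JD JM] := iJ.
pose L d := [set c | exists p, [/\ J p, (size p <= d.+1)%N & p`_d = c]]%classic.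
(* A combination of leading coefficients is the leading coefficient of the same combination of
   polynomials, once each of these is shifted to degree d by a power of X. *)
have lift (t : seq R) (e : R -> nat) (g : R -> {poly R}) d c :
    (forall b, b \in t -> [/\ J (g b), (size (g b) <= (e b).+1)%N,
      (g b)`_(e b) = b & (e b <= d)%N]) ->
    span [set b | b \in t]%classic c ->
    exists q, [/\ span [set p | p \in [seq g b | b <- t]]%classic q,
      (size q <= d.+1)%N & q`_d = c].
  move=> tP; have [T0 TD TM] :=
    ideal_span [set p | p \in [seq g b | b <- t]]%classic.
  apply: (@span_min _ _ [set c | exists q,
    [/\ span [set p | p \in [seq g b | b <- t]]%classic q,
      (size q <= d.+1)%N & q`_d = c]]%classic); first split.
  - by exists 0; rewrite size_poly0 coef0.
  - move=> x y [q [Tq sq <-]] [q' [Tq' sq' <-]]; exists (q + q').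
    split; [exact: TD| |by rewrite coefD].
    by rewrite (leq_trans (size_polyD _ _)) // geq_max sq.
  - move=> a x [q [Tq sq <-]]; exists (a%:P * q); split; first exact: TM.
      by rewrite mul_polyC (leq_trans (size_scale_leq _ _)).
    by rewrite coefCM.
  move=> b /= bt; have [Jb sb cb eb] := tP b bt.
  exists ('X^(d - e b) * g b); split.
  - by apply: TM; apply: sub_span; apply: map_f.
  - have [->|nz] := eqVneq (g b) 0; first by rewrite mulr0 size_poly0.
    rewrite mulrC size_mulXn //.
    by rewrite (leq_trans (leq_add (leqnn _) sb)) // addnS subnK.
  - by rewrite coefXnM ltnNge leq_subr /= subKn.
have fin T : (T `<=` \bigcup_d L d)%classic -> exists (t : seq R) (e : R -> nat)
    (g : R -> {poly R}), (forall b, b \in t -> [/\ J (g b),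
      (size (g b) <= (e b).+1)%N, (g b)`_(e b) = b & T b]) /\
    forall c, T c -> span [set b | b \in t]%classic c.
  move=> TL; have [t [tT Tt]] := nR T.
  have /choice[eg egP] : forall b, exists eg : nat * {poly R}, T b ->
      [/\ J eg.2, (size eg.2 <= eg.1.+1)%N & eg.2`_(eg.1) = b].
    move=> b; have [/TL[d _ [p [Jp sp cp]]]|nT] := pselect (T b).
      by exists (d, p).
    by exists (0%N, 0).
  exists t, (fun b => (eg b).1), (fun b => (eg b).2); split=> // b /tT Tb.
  by have [] := egP b Tb.
have [t [e [g [tP tL]]]] := fin _ (@subset_refl _ _).
pose N := (\max_(b <- t) e b)%N.
have /choice[G GP] : forall d, exists G : seq {poly R}, (forall p, p \in G -> J p) /\
   forall c, L d c -> exists q, [/\ span [set p | p \in G]%classic q,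
      (size q <= d.+1)%N & q`_d = c].
  move=> d; have [|td [ed [gd [tdP tdL]]]] := fin (L d); first by move=> c; exists d.
  have td' b : b \in td -> exists p, [/\ J p, (size p <= d.+1)%N & p`_d = b].
    by move=> /tdP[].
  have /choice[g' g'P] : forall b, exists p, b \in td ->
      [/\ J p, (size p <= d.+1)%N & p`_d = b].
    by move=> b; have [/td'[p pP]|] := boolP (b \in td); [exists p|exists 0].
  exists [seq g' b | b <- td]; split.
    by move=> _ /mapP[b /g'P[? _ _] ->].
  move=> c /tdL; apply: (lift _ (fun=> d)) => b /g'P[Jb sb cb].
  by split.
pose GG := flatten [seq G d | d <- iota 0 N] ++ [seq g b | b <- t].
exists GG; split.
  move=> p; rewrite mem_cat => /orP[/flatten_mapP[d _]|/mapP[b /tP[? _ _ _] ->] //].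
  by have [+ _] := GP d; apply.
move=> p; have [T0 TD TM] := ideal_span [set p | p \in GG]%classic.
have [m] := ubnP (size p); elim: m p => // m IH p pm Jp.
have [->//|nz] := eqVneq p 0.
have [d sp] : exists d, size p = d.+1.
  by exists (size p).-1; rewrite prednK // size_poly_gt0.
have Ld : L d p`_d by exists p; rewrite sp leqnn.
have [q [Tq sq cq]] : exists q, [/\ span [set p | p \in GG]%classic q,
    (size q <= d.+1)%N & q`_d = p`_d].
  have [dN|Nd] := ltnP d N.
    have [_ /(_ _ Ld)[q [Gq sq cq]]] := GP d; exists q; split=> //.
    apply: span_mono Gq => r Gr; apply: sub_span => /=.
    rewrite mem_cat; apply/orP; left; apply/flatten_mapP; exists d => //.
    by rewrite mem_iota.
  have [||q [Gq sq cq]] := lift t e g d p`_d.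
  - move=> b bt; have [? ? ? _] := tP b bt; split=> //.
    by apply: leq_trans Nd; apply: leq_bigmax_seq.
  - by apply: tL; exists d.
  exists q; split=> //; apply: span_mono Gq => r Gr; apply: sub_span => /=.
  by rewrite mem_cat Gr orbT.
have JG r : span [set p | p \in GG]%classic r -> J r.
  apply: span_min => // {}r /=; rewrite mem_cat.
  move=> /orP[/flatten_mapP[d' _]|/mapP[b /tP[? _ _ _] ->] //].
  by have [+ _] := GP d'; apply.
have Jq := JG q Tq.
rewrite -(subrK q p); apply: TD Tq; apply: IH; last exact: idealB Jq.
apply: leq_trans (_ : d.+1 <= m)%N; last by rewrite -sp.
rewrite ltnS; apply/leq_sizeP => i; rewrite leq_eqVlt => /orP[/eqP <-|di].
  by rewrite coefB cq subrr.
have qi : (size q <= i)%N by apply: leq_trans di.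
by rewrite coefB !nth_default ?subrr // sp.
Qed.

Lemma noeth_itpoly (K : fieldType) n : noeth (itpoly K n).
Proof. by elim: n => [|n IH]; [apply: noeth_field|apply: hilbert_basis]. Qed.

End Noetherian.

Section Presentation.
Context (K : fieldType).
Implicit Types (R A : kalg K).

Lemma gen_surj R n (a : 'I_n -> R) : generates a ->
  forall r, exists p, ev (kstr R) a p = r.
Proof.
move=> ga; apply: ga => [c|k|x y [p <-] [q <-]].
- by exists (itC K n c); rewrite ev_itC.
- by exists (itX K k); rewrite ev_itX.
- by split; [exists (p + q); rewrite rmorphD|exists (p * q); rewrite rmorphM].
Qed.

Lemma gen_eq R n (a : 'I_n -> R) A (f g : khom R A) : generates a ->
  (forall k, f (a k) = g (a k)) -> forall r, f r = g r.
Proof.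
move=> ga fg; apply: ga => [c|//|x y xE yE]; first by rewrite !khomP.
by rewrite !rmorphD !rmorphM xE yE.
Qed.

Lemma khom_ev R A (f : khom R A) n (a : 'I_n -> R) p :
  f (ev (kstr R) a p) = ev (kstr A) (f \o a) p.
Proof. by apply: ev_comp => // c; rewrite khomP. Qed.

Lemma gen_hom R n (a : 'I_n -> R) A (v : 'I_n -> A) : generates a ->
  (forall q, ev (kstr R) a q = 0 -> ev (kstr A) v q = 0) ->
  exists f : khom R A, forall p, f (ev (kstr R) a p) = ev (kstr A) v p.
Proof.
move=> ga h; have /choice[p pE] := gen_surj ga.
have wd q q' : ev (kstr R) a q = ev (kstr R) a q' ->
    ev (kstr A) v q = ev (kstr A) v q'.
  move=> e; apply/eqP; rewrite -subr_eq0 -rmorphB h //.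
  by rewrite rmorphB e subrr.
pose f r := ev (kstr A) v (p r).
have f1 : f 1 = 1 by rewrite /f -(rmorph1 (ev (kstr A) v)); apply: wd; rewrite pE rmorph1.
have fD : {morph f : x y / x + y}.
  by move=> x y; rewrite /f -rmorphD; apply: wd; rewrite rmorphD !pE.
have fM : {morph f : x y / x * y}.
  by move=> x y; rewrite /f -rmorphM; apply: wd; rewrite rmorphM !pE.
have fc c : mkrm f1 fD fM (kstr R c) = kstr A c.
  by rewrite -(ev_itC (kstr A) v); apply: wd; rewrite pE ev_itC.
by exists (KHom fc) => q; apply: wd; rewrite pE.
Qed.

(** By noetherianity finitely many relations decide whether a tuple is the image of the generators.
    This is what lets a first-order formula speak of homomorphisms. *)
Lemma fin_pres R n (a : 'I_n -> R) : generates a ->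
  exists E : seq (itpoly K n), (forall q, q \in E -> ev (kstr R) a q = 0) /\
    forall A (v : 'I_n -> A), (forall q, q \in E -> ev (kstr A) v q = 0) ->
      exists f : khom R A, forall p, f (ev (kstr R) a p) = ev (kstr A) v p.
Proof.
move=> ga; have [E [Ea aE]] :=
  @noeth_itpoly K n [set q | ev (kstr R) a q = 0]%classic.
exists E; split=> // A v Ev; apply: gen_hom => // q /aE[m [c [s [sE <-]]]].
by rewrite rmorph_sum big1 // => i _; rewrite rmorphM [X in _ * X]Ev ?mulr0 //; apply: sE.
Qed.

End Presentation.

(** * Base change *)

Section LinearAlgebra.
Context (K : fieldType).
Implicit Types A : kalg K.

Definition indep A m (e : 'I_m -> A) :=
  forall c : 'I_m -> K, \sum_k kstr A (c k) * e k = 0 -> forall k, c k = 0.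

Lemma fin_basis A n (b : 'I_n -> A) : exists m (e : 'I_m -> A)
  (q : 'I_n -> 'I_m -> K), indep e /\
  forall k, b k = \sum_t kstr A (q k t) * e t.
Proof.
suff main m (e : 'I_m -> A) (q : 'I_n -> 'I_m -> K) :
    (forall k, b k = \sum_t kstr A (q k t) * e t) ->
    exists m (e : 'I_m -> A) (q : 'I_n -> 'I_m -> K), indep e /\
      forall k, b k = \sum_t kstr A (q k t) * e t.
  apply: (main n b (fun k t => (t == k)%:R)) => k.
  rewrite (bigD1 k) //= eqxx rmorph1 mul1r big1 ?addr0 // => t /negPf ->.
  by rewrite rmorph0 mul0r.
elim: m e q => [|m IH] e q bE; first by exists 0%N, e, q; split=> // c _ [].
have [ie|] := pselect (indep e); first by exists m.+1, e, q.
move=> /existsNP[c /not_implyP[ce /existsNP[t0 /eqP c0]]].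
pose d s := c (lift t0 s) / c t0.
apply: (IH (e \o lift t0) (fun k s => q k (lift t0 s) - q k t0 * d s)) => k.
have e0 : e t0 = - \sum_s kstr A (d s) * e (lift t0 s).
  move: ce; rewrite (bigD1_ord t0) //= => /eqP; rewrite addr_eq0 => /eqP ce.
  rewrite -[LHS]mul1r -(rmorph1 (kstr A)) -(mulVf c0) rmorphM -mulrA ce mulrN.
  congr (- _); rewrite mulr_sumr; apply: eq_bigr => s _.
  by rewrite /d rmorphM; ring.
rewrite bE (bigD1_ord t0) //= e0 mulrN mulr_sumr -sumrN -big_split.
by apply: eq_bigr => s _ /=; rewrite rmorphB !(rmorphM (kstr A)); ring.
Qed.

(** A subspace H maximal among those containing the other e k and avoiding e k0 is a hyperplane; f
    is the coordinate along e k0 modulo H. *)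
Lemma lin_functional A m (e : 'I_m -> A) (k0 : 'I_m) : indep e ->
  exists f : A -> K, [/\ {morph f : x y / x + y},
    forall c x, f (kstr A c * x) = c * f x & forall k, f (e k) = (k == k0)%:R].
Proof.
move=> ie; set e0 := e k0.
pose sub (H : set A) := [/\ H 0, forall x y, H x -> H y -> H (x + y) &
  forall c x, H x -> H (kstr A c * x)].
pose P := [set H | sub H /\ ~ H e0]%classic.
pose S0 := [set x | exists c : 'I_m -> K, c k0 = 0 /\ x = \sum_k kstr A (c k) * e k]%classic.
have [||H [[sH He0] S0H maxH]] := @Zorn_set A P S0.
- split.
    split; first by exists (fun=> 0); split=> //; rewrite big1 // => k _; rewrite rmorph0 mul0r.
      move=> _ _ [c [c0 ->]] [d [d0 ->]]; exists (fun k => c k + d k).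
      rewrite c0 d0 addr0 -big_split; split=> //; apply: eq_bigr => k _ /=.
      by rewrite rmorphD mulrDl.
    move=> b _ [c [c0 ->]]; exists (fun k => b * c k); rewrite c0 mulr0; split=> //.
    by rewrite mulr_sumr; apply: eq_bigr => k _; rewrite rmorphM mulrA.
  move=> [c [c0 ce]]; have := ie (fun k => c k - (k == k0)%:R).
  have -> : \sum_k kstr A (c k - (k == k0)%:R) * e k = 0.
    under eq_bigr do rewrite rmorphB mulrBl.
    rewrite sumrB -ce (bigD1 k0) //= eqxx rmorph1 mul1r big1 ?addr0 ?subrr //.
    by move=> k /negPf ->; rewrite rmorph0 mul0r.
  move=> /(_ erefl k0) /eqP; rewrite c0 eqxx sub0r oppr_eq0.
  by rewrite oner_eq0.
- move=> F [B0 FB0] FP tF; split; last by case=> B /FP[].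
  split.
  + by exists B0 => //; have [[]] := FP _ FB0.
  + move=> x y [B FB Bx] [C FC Cy].
    have [[_ BD _] _] := FP _ FB; have [[_ CD _] _] := FP _ FC.
    by have [BC|CB] := tF _ _ FB FC; [exists C => //; apply: CD => //; apply: BC|
      exists B => //; apply: BD => //; apply: CB].
  + by move=> c x [B FB Bx]; exists B => //; have [[_ _ BM] _] := FP _ FB; apply: BM.
have [H0 HD HM] := sH.
have HN x : H x -> H (- x) by move/(HM (-1)); rewrite rmorphN1 mulN1r.
have HB x y : H x -> H y -> H (x - y) by move=> Hx /HN; apply: HD.
have Hc c : H (kstr A c * e0) -> c = 0.
  move=> Hc; apply: contrapT => /eqP c0; apply: He0.
  by rewrite -[e0]mul1r -(rmorph1 (kstr A)) -(mulVf c0) rmorphM -mulrA; apply: HM.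
have /choice[f fP] x : exists c, H (x - kstr A c * e0).
  have [Hx|nHx] := pselect (H x); first by exists 0; rewrite rmorph0 mul0r subr0.
  pose H' := [set y | exists h a, H h /\ y = h + kstr A a * x]%classic.
  have [[h [a [Hh e0E]]]|nH'] := pselect (H' e0); last first.
    exfalso; apply: nHx; apply: (maxH H') => //.
    - split=> //; split.
      + by exists 0, 0; rewrite rmorph0 mul0r addr0.
      + move=> _ _ [h [a [Hh ->]]] [h' [a' [Hh' ->]]].
        exists (h + h'), (a + a'); split; first exact: HD.
        by rewrite rmorphD mulrDl addrACA.
      + move=> c _ [h [a [Hh ->]]]; exists (kstr A c * h), (c * a).
        by split; [apply: HM|rewrite rmorphM mulrDr mulrA].
    - by move=> h Hh; exists h, 0; rewrite rmorph0 mul0r addr0.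
    - by exists 0, 1; rewrite rmorph1 mul1r add0r.
  have a0 : a != 0.
    apply/eqP => a0; apply: He0; rewrite e0E a0 rmorph0 mul0r addr0 //.
  exists a^-1; have -> : x - kstr A a^-1 * e0 = - (kstr A a^-1 * h).
    rewrite e0E mulrDr mulrA -rmorphM mulVf // rmorph1 mul1r.
    by rewrite opprD addrCA subrr addr0.
  by apply/HN/HM.
have fU x c : H (x - kstr A c * e0) -> f x = c.
  move=> h; apply/eqP; rewrite -subr_eq0; apply/eqP/Hc.
  have -> : kstr A (f x - c) * e0 = (x - kstr A c * e0) - (x - kstr A (f x) * e0).
    by rewrite rmorphB; ring.
  exact: HB h (fP x).
exists f; split.
- move=> x y; apply: fU; rewrite rmorphD mulrDl opprD addrACA.
  exact: HD (fP x) (fP y).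
- move=> c x; apply: fU; rewrite rmorphM -mulrA -mulrBr.
  exact: HM (fP x).
- move=> k; apply: fU; have [->|kk0] := eqVneq k k0.
    by rewrite rmorph1 mul1r subrr.
  rewrite rmorph0 mul0r subr0; apply: S0H; exists (fun t => (t == k)%:R).
  rewrite eq_sym (negPf kk0); split=> //.
  rewrite (bigD1 k) //= eqxx rmorph1 mul1r big1 ?addr0 // => t /negPf ->.
  by rewrite rmorph0 mul0r.
Qed.

End LinearAlgebra.

Section BaseRing.
Context (K E : fieldType) (j : {rmorphism K -> E}).

Fixpoint imap n : {rmorphism itpoly K n -> itpoly E n} :=
  match n return {rmorphism itpoly K n -> itpoly E n} with
  | 0 => j
  | m.+1 => map_poly (imap m) : {rmorphism {poly itpoly K m} -> {poly itpoly E m}}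
  end.

Lemma ev_imap (A : comPzRingType) (h : {rmorphism E -> A})
  (h' : {rmorphism K -> A}) n (v : 'I_n -> A) p :
  (forall c, h' c = h (j c)) -> ev h v (imap n p) = ev h' v p.
Proof.
move=> hE; elim: n v p => [|n IH] v p; first by rewrite /= hE.
rewrite /= (@evp_wide _ _ _ _ (size p)) ?size_poly // evpE.
by apply: eq_bigr => i _; rewrite coef_map IH.
Qed.

Section Functional.
Context (f : E -> K) (fD : {morph f : x y / x + y})
  (fM : forall c x, f (j c * x) = c * f x).

Let f0 : f 0 = 0. Proof. by have := fM 0 0; rewrite rmorph0 !mul0r. Qed.

(** The functional f applied to each coefficient. It is K[X]-linear by [lmapM], so it sends an ideal
    extended from K[X] back into the original ideal. *)
Fixpoint lmap n : itpoly E n -> itpoly K n :=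
  match n return itpoly E n -> itpoly K n with
  | 0 => f
  | m.+1 => fun p : {poly itpoly E m} => map_poly (lmap (n := m)) p
  end.

Lemma lmap0 n : lmap (0 : itpoly E n) = 0.
Proof. by case: n => [|n]; [exact: f0|rewrite /= map_poly0]. Qed.

Lemma lmapD n : {morph @lmap n : x y / x + y}.
Proof.
elim: n => [|n IH]; first exact: fD.
by move=> p q; apply/polyP => i; rewrite /= coefD !coef_map_id0 ?lmap0 // coefD IH.
Qed.

Lemma lmap_sum n (I : Type) (r : seq I) (F : I -> itpoly E n) :
  lmap (\sum_(i <- r) F i) = \sum_(i <- r) lmap (F i).
Proof.
elim: r => [|i r IH]; first by rewrite !big_nil lmap0.
by rewrite !big_cons lmapD IH.
Qed.

Lemma lmapM n (G : itpoly E n) q : lmap (G * imap n q) = lmap G * q.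
Proof.
elim: n G q => [|n IH] G q /=; first by rewrite mulrC fM mulrC.
apply/polyP => i; rewrite coef_map_id0 ?lmap0 // !coefM lmap_sum.
by apply: eq_bigr => k _; rewrite coef_map IH coef_map_id0 ?lmap0.
Qed.

Lemma lmapC n c : lmap (itC E n c) = itC K n (f c).
Proof.
elim: n => //= n IH; apply/polyP => i; rewrite coef_map_id0 ?lmap0 // !coefC.
by case: eqP => _; rewrite ?IH ?lmap0.
Qed.
End Functional.

(* The first two clauses characterize the base change of R to E up to
   isomorphism; the last one records that it is the tensor product. *)
Definition is_base_ring (R : kalg K) (RE : kalg E) (i : khom R (kres j RE)) :=
  [/\ forall (A : kalg E) (f : khom R (kres j A)), exists f' : khom RE A,
        forall r, f' (i r) = f r,
      forall (A : kalg E) (f g : khom RE A), (forall r, f (i r) = g (i r)) ->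
        forall x, f x = g x,
      forall n (a : 'I_n -> R), generates a -> @generates E RE n (i \o a) &
      forall m (e : 'I_m -> kres j (kself E)) (x : 'I_m -> R), indep e ->
        \sum_k kstr RE (e k) * i (x k) = 0 -> forall k, x k = 0].

(** If R = K[X]/I, take E[X]/(I E[X]). For the tensor clause, lift the relation to a member of I
    E[X] and apply coefficientwise a functional dual to e k: the result is in I and represents x
    k. *)
Lemma base_ring_exists (R : kalg K) n (a : 'I_n -> R) : generates a ->
  exists (RE : kalg E) (i : khom R (kres j RE)), is_base_ring i.
Proof.
move=> ga; pose ker := [set q | ev (kstr R) a q = 0]%classic.
have iJ := ideal_span (imap n @` ker)%classic.
pose RE : kalg E := KAlg (qpi iJ \o itC E n : {rmorphism E -> quo iJ}).
pose v k : RE := qpi iJ (itX E k).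
have evE p : ev (kstr RE) v p = qpi iJ p.
  by rewrite -[in RHS](ev_univ p); apply/esym/ev_comp.
have evK q : ev (kstr (kres j RE)) v q = qpi iJ (imap n q).
  by rewrite -evE; apply/esym/ev_imap.
have [|i iE] := @gen_hom _ R n a (kres j RE) v ga.
  by move=> q q0; rewrite evK; apply/(qpi0 iJ); apply: sub_span; exists q.
have iv k : i (a k) = v k by have := iE (itX K k); rewrite !ev_itX.
have gv : generates v.
  move=> S SC Sv Sop r; have [p <-] := qpi_surj r; rewrite -evE.
  elim/itpoly_ind: p => [c|k|x y Sx Sy|x y Sx Sy].
  - by rewrite ev_itC.
  - by rewrite ev_itX.
  - by rewrite rmorphD; have [] := Sop _ _ Sx Sy.
  - by rewrite rmorphM; have [] := Sop _ _ Sx Sy.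
exists RE, i; split.
- move=> A f; pose w k := f (a k).
  have [|g gE] := @qpi_lift _ _ iJ A (ev (kstr A) w).
    move=> x; move: x; apply: span_min.
      split; first by rewrite /= rmorph0.
        by move=> x y /= x0 y0; rewrite rmorphD x0 y0 addr0.
      by move=> x y /= y0; rewrite rmorphM y0 mulr0.
    move=> _ [q q0 <-] /=; rewrite (@ev_imap _ _ (kstr (kres j A))) //.
    by rewrite -(khom_ev f) q0 rmorph0.
  have gc c : g (kstr RE c) = kstr A c by rewrite gE ev_itC.
  exists (KHom gc) => r; have [q <-] := gen_surj ga r.
  by rewrite iE evK gE (@ev_imap _ _ (kstr (kres j A))) // (khom_ev f).
- move=> A f g fg; apply: gen_eq gv _ => k.
  by rewrite -iv.
- move=> m b gb S SC Sb Sop; apply: gv => [c|k|]; [exact: SC| |exact: Sop].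
  rewrite -iv.
  move: (a k); apply: gb => // [c|x y Sx Sy].
    rewrite (khomP i); exact: SC.
  by rewrite rmorphD rmorphM; apply: Sop.
- move=> m e x ie ex k; have [f [fD fM fe]] := lin_functional k ie.
  have fM' c y : f (j c * y) = c * f y by apply: fM.
  have /choice[q qE] : forall t, exists q, ev (kstr R) a q = x t.
    by move=> t; apply: gen_surj.
  have : span (imap n @` ker)%classic (\sum_t itC E n (e t) * imap n (q t)).
    apply/(qpi0 iJ); rewrite -[RHS]ex rmorph_sum; apply: eq_bigr => t _.
    by rewrite rmorphM -qE iE evK.
  have kE : forall y, span (imap n @` ker)%classic y -> ker (lmap f y).
    move=> _ [p [G [s [sk <-]]]]; rewrite (lmap_sum fD fM') /ker /= rmorph_sum big1 // => t _.
    by have [r rk <-] := sk t; rewrite (lmapM fD fM') rmorphM rk mulr0.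
  move=> /kE; rewrite (lmap_sum fD fM') /ker /= (bigD1 k) //= big1 => [|t /negPf tk].
    by rewrite (lmapM fD fM') (lmapC fM') fe eqxx rmorph1 mul1r addr0 qE.
  by rewrite (lmapM fD fM') (lmapC fM') fe tk rmorph0 mul0r.
Qed.

Section BaseRingTheory.
Context (R : kalg K) (RE : kalg E) (i : khom R (kres j RE)) (bc : is_base_ring i).

Lemma base_inj r : i r = 0 -> r = 0.
Proof.
move=> ir; have [_ _ _ h] := bc.
apply: (h 1%N (fun=> 1) (fun=> r)) ord0; last by rewrite big_ord1 rmorph1 mul1r.
move=> c; rewrite big_ord1 mulr1 => /= c0 k; rewrite (ord1 k).
by apply: (fmorph_inj j); rewrite rmorph0.
Qed.

(** The mirror image of the tensor clause of [is_base_ring], obtained by expanding the e k in a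
    K-independent family. *)
Lemma base_indep m (e : 'I_m -> E) (x : 'I_m -> R) : indep x ->
  \sum_k kstr RE (e k) * i (x k) = 0 -> forall k, e k = 0.
Proof.
move=> ix ex k; have [n [b [q [ib bE]]]] := @fin_basis K (kres j (kself E)) m e.
have [_ _ _ h] := bc.
have q0 t : forall k, q k t = 0.
  apply: ix; move: t; apply: (h _ b) => //.
  rewrite -[RHS]ex; under eq_bigr do rewrite rmorph_sum mulr_sumr.
  rewrite exchange_big; apply: eq_bigr => s _; rewrite bE rmorph_sum mulr_suml.
  apply: eq_bigr => t _; rewrite !rmorphM (khomP i) /=; ring.
rewrite bE big1 // => t _; rewrite q0 rmorph0 mul0r //.
Qed.

Lemma base_repr n (a : 'I_n -> R) : generates a -> forall z, exists m (e : 'I_m -> E) (x : 'I_m -> R),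
  indep x /\ z = \sum_k kstr RE (e k) * i (x k).
Proof.
move=> ga z.
have [s ->] : exists s : seq (E * R), z = \sum_(p <- s) kstr RE p.1 * i p.2.
  have [_ _ /(_ _ _ ga) gia _] := bc.
  move: z; apply: gia => [c|k|x y [s ->] [t ->]].
  - by exists [:: (c, 1)]; rewrite big_seq1 rmorph1 mulr1.
  - by exists [:: (1, a k)]; rewrite big_seq1 rmorph1 mul1r.
  - split; first by exists (s ++ t); rewrite big_cat.
    exists [seq (p.1 * q.1, p.2 * q.2) | p <- s, q <- t].
    rewrite big_allpairs_dep mulr_suml; apply: eq_bigr => p _.
    rewrite mulr_sumr; apply: eq_bigr => q _ /=.
    by rewrite !rmorphM; ring.
have [m [b [q [ib bE]]]] := @fin_basis K R (size s) (fun k => (tnth (in_tuple s) k).2).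
exists m, (fun t => \sum_k j (q k t) * (tnth (in_tuple s) k).1), b; split=> //.
rewrite big_tnth; under eq_bigr do rewrite bE rmorph_sum mulr_sumr.
rewrite exchange_big; apply: eq_bigr => t _; rewrite rmorph_sum mulr_suml.
apply: eq_bigr => k _; rewrite !rmorphM (khomP i) /=; ring.
Qed.

End BaseRingTheory.

Section BaseVariety.
Context (X : kfunctor K).

Lemma base_mono (R : kalg K) (u : X R) (RE : kalg E) (i : khom R (kres j RE)) : is_base_ring i ->
  mono u -> mono (pmap X i u : base_change j X RE).
Proof.
move=> [_ iU _ _] mu A f g fg; apply: iU => r.
apply: (mu _ (kcomp (kres_hom j f) i) (kcomp (kres_hom j g) i)).
by rewrite !pmap_kcomp.
Qed.

Lemma base_yoneda (R : kalg K) (u : X R) (RE : kalg E) (i : khom R (kres j RE)) (A : kalg E)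
  (x : base_change j X A) : is_base_ring i ->
  yoneda (pmap X i u : base_change j X RE) x <-> yoneda u (x : X (kres j A)).
Proof.
move=> [iL _ _ _]; split=> [[f <-]|[f <-]].
  by exists (kcomp (kres_hom j f) i); rewrite pmap_kcomp.
have [f' f'E] := iL A f; exists f'; rewrite /= -pmap_kcomp.
exact: pmap_ext.
Qed.

Lemma base_open (R : kalg K) (u : X R) (RE : kalg E) (i : khom R (kres j RE)) : is_base_ring i ->
  open_immersion u -> open_immersion (pmap X i u : base_change j X RE).
Proof.
move=> bi [mu ou]; split; first exact: base_mono.
move=> A x; have [S SP] := ou (kres j A) x; exists S => B f.
rewrite base_yoneda //; exact: (SP (kres j B) (kres_hom j f)).
Qed.

Lemma base_represents (R : kalg K) (u : X R) (RE : kalg E) (i : khom R (kres j RE)) : is_base_ring i ->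
  represents u -> represents (pmap X i u : base_change j X RE).
Proof.
move=> bi [mu su]; split; first exact: base_mono.
by move=> A x; apply/base_yoneda => //; apply: su.
Qed.

Lemma base_sheaf : zariski_sheaf X -> zariski_sheaf (base_change j X).
Proof.
move=> sX A r a B l ua loc x cmp.
apply: (sX (kres j A) r a (fun k => kres j (B k)) (fun k => kres_hom j (l k)) ua loc x).
move=> k k' C g h gh.
(* The test algebra C is only a K-algebra. It becomes an E-algebra through g, and since g and h
   agree on A, which is an E-algebra, h respects this structure too. *)
pose strC : {rmorphism E -> C} := g \o kstr (B k).
pose C' : kalg E := KAlg strC.
pose g' : khom (B k) C' := @KHom E (B k) C' (khfun g) (fun=> erefl).
have hc c : h (kstr (B k') c) = strC c.
  by rewrite -(khomP (l k')) -gh /strC /= -(khomP (l k)).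
pose h' : khom (B k') C' := @KHom E (B k') C' (khfun h) hc.
have Cc c : g (kstr (kres j (B k)) c) = kstr C c := khomP g c.
pose back : khom (kres j C') C := @KHom K (kres j C') C (idfun : {rmorphism C -> C}) Cc.
have e : pmap X (kres_hom j g') (x k) = pmap X (kres_hom j h') (x k') :=
  cmp k k' C' g' h' gh.
rewrite (@pmap_ext _ X _ _ g (kcomp back (kres_hom j g'))) //.
rewrite (@pmap_ext _ X _ _ h (kcomp back (kres_hom j h'))) //.
by rewrite !pmap_kcomp e.
Qed.

Lemma base_variety : variety X -> geom_integral X -> variety (base_change j X).
Proof.
move=> [sX [r [R [u [[ou cu] ft]]]] sep iX] gX.
have H k : exists RE : kalg E, exists i : khom (R k) (kres j RE), is_base_ring i.
  by have [n [a ga]] := ft k; apply: base_ring_exists ga.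
have /choice[RE /dchoice[i iP]] := H.
pose uE k : base_change j X (RE k) := pmap X (i k) (u k).
have cE : affine_open_cover uE.
  split=> [k|A fA x]; first exact: base_open.
  by have [k uk] := cu (kres j A) fA x; exists k; apply/base_yoneda.
split; last exact: gX.
- by split; [apply: base_sheaf; case: sX|exists 'I_r, RE, uE].
- exists r, RE, uE; split=> // k; have [n [a ga]] := ft k; exists n, (i k \o a).
  by have [_ _ + _] := iP k; apply.
- move=> A x y; have [S SP] := sep (kres j A) x y; exists S => B f.
  exact: (SP (kres j B) (kres_hom j f)).
Qed.

End BaseVariety.
End BaseRing.

(** * Ultraproducts and algebraic closures *)

Lemma nz_exists (A : comPzRingType) : (1 : A) != 0 ->
  exists (B : comNzRingType) (f : {rmorphism A -> B}) (g : {rmorphism B -> A}),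
    cancel f g.
Proof.
move=> A1; exists (nz_of A1).
exists (@mkrm A (nz_of A1) id erefl (fun _ _ => erefl) (fun _ _ => erefl)).
by exists (@mkrm (nz_of A1) A id erefl (fun _ _ => erefl) (fun _ _ => erefl)).
Qed.

Lemma evp_horner (R : idomainType) (A : comNzRingType) (f : {rmorphism R -> A}) x p :
  evp f x p = (map_poly f p).[x].
Proof.
rewrite evpE (@horner_coef_wide _ (size p)) ?size_poly //.
by apply: eq_bigr => i _; rewrite coef_map.
Qed.

Lemma evp_id (R : idomainType) p : evp (polyC : {rmorphism R -> {poly R}}) 'X p = p.
Proof. by rewrite evp_horner -/(p \Po 'X) comp_polyXr. Qed.

Definition is_subring (K : fieldType) (A : kalg K) (S : set A) :=
  [/\ forall c, S (kstr A c), forall x y, S x -> S y -> S (x + y) &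
    forall x y, S x -> S y -> S (x * y)].

Lemma subring_kalg (K : fieldType) (A : kalg K) (S : set A) : is_subring S ->
  exists (B : kalg K) (i : khom B A), injective i /\
    forall x, S x <-> exists b, i b = x.
Proof.
move=> [SC SD SM]; pose T := {x : A | S x}.
have S0 : S 0 by rewrite -(rmorph0 (kstr A)).
have S1 : S 1 by rewrite -(rmorph1 (kstr A)).
have SN x : S x -> S (- x).
  by move=> Sx; rewrite -mulN1r -(rmorphN1 (kstr A)); apply: SM.
pose mk x (h : S x) : T := exist _ x h.
have Tq (s t : T) : sval s = sval t -> s = t.
  by case: s t => [x hx] [y hy] /= e; apply: eq_exist.
pose add (s t : T) : T := mk _ (SD _ _ (svalP s) (svalP t)).
pose mul (s t : T) : T := mk _ (SM _ _ (svalP s) (svalP t)).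
pose opp (s : T) : T := mk _ (SN _ (svalP s)).
have h1 : associative add by move=> x y z; apply: Tq => /=; rewrite addrA.
have h2 : commutative add by move=> x y; apply: Tq => /=; rewrite addrC.
have h3 : left_id (mk 0 S0) add by move=> x; apply: Tq => /=; rewrite add0r.
have h4 : left_inverse (mk 0 S0) opp add by move=> x; apply: Tq => /=; rewrite addNr.
have h5 : associative mul by move=> x y z; apply: Tq => /=; rewrite mulrA.
have h6 : commutative mul by move=> x y; apply: Tq => /=; rewrite mulrC.
have h7 : left_id (mk 1 S1) mul by move=> x; apply: Tq => /=; rewrite mul1r.
have h8 : left_distributive mul add by move=> x y z; apply: Tq => /=; rewrite mulrDl.
pose B0 : comPzRingType := mkring h1 h2 h3 h4 h5 h6 h7 h8.
pose str (c : K) : B0 := mk _ (SC c).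
have s1 : str 1 = 1 by apply: Tq; apply: rmorph1.
have sD : {morph str : x y / x + y} by move=> x y; apply: Tq; apply: rmorphD.
have sM : {morph str : x y / x * y} by move=> x y; apply: Tq; apply: rmorphM.
pose B : kalg K := KAlg (mkrm s1 sD sM).
pose i : khom B A := @KHom K B A (@mkrm B A (fun s : T => sval s) erefl
  (fun _ _ => erefl) (fun _ _ => erefl)) (fun=> erefl).
exists B, i; split=> [s t|x]; first exact: Tq.
split=> [Sx|[b <-]]; first by exists (mk x Sx).
exact: (svalP b).
Qed.

Definition fk (K F : fieldType) (j : {rmorphism K -> F}) : kalg K :=
  kres j (kself F).

Lemma is_field_fk (K F : fieldType) (j : {rmorphism K -> F}) : is_field (fk j).
Proof.
split=> [|x x0]; first exact: oner_neq0.
by exists (x^-1 : F); rewrite mulfV.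
Qed.

Section Ultraproduct.
Context (J : Type).

Record ultra (U : set (set J)) : Prop := Ultra {
  ultraI : forall A B, U A -> U B -> U (A `&` B)%classic;
  ultraS : forall A B, (A `<=` B)%classic -> U A -> U B;
  ultraVC : forall A, U A \/ U (~` A)%classic;
  ultra0 : ~ U set0 }.

Lemma ultra_exists (B : set (set J)) : (B !=set0)%classic ->
  (forall A, B A -> (A !=set0)%classic) ->
  (forall A A', B A -> B A' -> exists2 C, B C & (C `<=` A `&` A')%classic) ->
  exists2 U, ultra U & (B `<=` U)%classic.
Proof.
move=> [A0 BA0] Bne BI.
have FF : ProperFilter (filter_from B id).
  apply: filter_from_proper; last by move=> A /Bne.
  apply: filter_from_filter; first by exists A0.
  by move=> A A' BA BA'; have [C BC h] := BI _ _ BA BA'; exists C.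
have [U [UU sU]] := ultraFilterLemma FF; exists U.
  split.
  - by move=> A A'; apply: filterI.
  - by move=> A A' h; apply: filterS.
  - by move=> A; apply: in_ultra_setVsetC.
  - exact: filter_not_empty.
by move=> A BA; apply: sU; exists A.
Qed.

Context (U : set (set J)) (uU : ultra U) (W : J -> fieldType).

Lemma ultraT : U setT.
Proof.
have [//|] := ultraVC uU setT; rewrite setCT => h.
by have := ultra0 uU h.
Qed.

Lemma ultra_or A B : U (A `|` B)%classic -> U A \/ U B.
Proof.
move=> UAB; have [|UA] := ultraVC uU A; [by left|right].
apply: (ultraS uU _ (ultraI uU UAB UA)) => x [[]//]; by move=> Ax /(_ Ax).
Qed.

Definition uprod : comPzRingType.
Proof.
refine (@mkring (forall s, W s) (fun=> 0) (fun=> 1) (fun a b s => a s + b s)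
  (fun a s => - a s) (fun a b s => a s * b s) _ _ _ _ _ _ _ _).
- by move=> a b c; apply: functional_extensionality_dep => s; rewrite addrA.
- by move=> a b; apply: functional_extensionality_dep => s; rewrite addrC.
- by move=> a; apply: functional_extensionality_dep => s; rewrite add0r.
- by move=> a; apply: functional_extensionality_dep => s; rewrite addNr.
- by move=> a b c; apply: functional_extensionality_dep => s; rewrite mulrA.
- by move=> a b; apply: functional_extensionality_dep => s; rewrite mulrC.
- by move=> a; apply: functional_extensionality_dep => s; rewrite mul1r.
- by move=> a b c; apply: functional_extensionality_dep => s; rewrite mulrDl.
Defined.

Definition unull : set uprod := [set a | U [set s | a s = 0]]%classic.

Lemma unull_ideal : ideal unull.
Proof.
split.
- by apply: (ultraS uU _ ultraT).
- move=> a b Ua Ub; apply: (ultraS uU _ (ultraI uU Ua Ub)) => s [/= a0 b0].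
  by change (a s + b s = 0); rewrite a0 b0 addr0.
- move=> a b Ub; apply: (ultraS uU _ Ub) => s /= b0.
  by change (a s * b s = 0); rewrite b0 mulr0.
Qed.

Let Q := quo unull_ideal.
Let qp := qpi unull_ideal.

Fact ult_field : is_field Q.
Proof.
split.
  apply/eqP => h; have : qp 1 = 0 by rewrite rmorph1.
  move/(qpi0 unull_ideal) => h1; apply: (ultra0 uU); apply: (ultraS uU _ h1) => s /=.
  by move=> /eqP; rewrite oner_eq0.
move=> x /eqP x0; have [a ax] := qpi_surj x.
have Ua : U [set s | a s <> 0]%classic.
  have [Ua|//] := ultraVC uU [set s | a s = 0]%classic.
  by case: x0; rewrite -ax; apply/(qpi0 unull_ideal).
exists (qp (fun s => (a s)^-1)); rewrite -ax -(rmorph1 qp) -rmorphM.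
apply/(qpi_eq unull_ideal); apply: (ultraS uU _ Ua) => s /eqP as0.
by change (a s * (a s)^-1 - 1 = 0); rewrite mulfV ?subrr.
Qed.

Lemma ult_exists : exists (N : fieldType) (p : {rmorphism uprod -> N}),
  (forall a b : uprod, p a = p b <-> U [set s | a s = b s]%classic) /\
  forall x, exists a, p a = x.
Proof.
exists (fld_of ult_field), (fld_in ult_field \o qp); split=> [a b|x].
  split=> [/(qpi_eq unull_ideal) h|h].
    by apply: (ultraS uU _ h) => s /eqP; rewrite subr_eq0 => /eqP.
  apply/(qpi_eq unull_ideal); apply: (ultraS uU _ h) => s /= e.
  by change (a s - b s = 0); rewrite e subrr.
exact: (qpi_surj (x : Q)).
Qed.

End Ultraproduct.

Lemma root_ext (L : fieldType) (p : {poly L}) : (1 < size p)%N ->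
  exists (L' : fieldType) (i : {rmorphism L -> L'}) x, root (map_poly i p) x.
Proof.
move=> sp; pose A : kalg L := KAlg (polyC : {rmorphism L -> {poly L}}).
have nu : ~ @unit_ideal A [set p]%classic.
  move=> [n [c [s [Ss e]]]].
  have e' : (\sum_i c i) * p = 1.
    by rewrite mulr_suml -[RHS]e; apply: eq_bigr => i _; rewrite Ss.
  have := dvdp_mull (\sum_i c i) (dvdpp p); rewrite e' dvdp1 => /eqP sp1.
  by rewrite sp1 in sp.
have [k [f [fk f0]]] := residue nu.
pose f' : {rmorphism {poly L} -> fld_of fk} := fld_in fk \o f.
exists (fld_of fk), (f' \o polyC : {rmorphism L -> fld_of fk}), (f' 'X).
rewrite /root -(evp_horner (f' \o polyC : {rmorphism L -> fld_of fk})).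
have -> : evp (f' \o polyC) (f' 'X) p = f' p.
  rewrite -{2}(evp_id p); apply/esym; exact: evp_comp.
by apply/eqP; apply: f0.
Qed.

Definition splits (L : fieldType) (p : {poly L}) :=
  exists rs : seq L, p = lead_coef p *: \prod_(r <- rs) ('X - r%:P).

Lemma splits_map (L L' : fieldType) (i : {rmorphism L -> L'}) p :
  splits p -> splits (map_poly i p).
Proof.
move=> [rs pE]; exists [seq i r | r <- rs].
rewrite lead_coef_map {1}pE map_polyZ rmorph_prod big_map; congr (_ *: _).
by apply: eq_bigr => r _; rewrite rmorphB /= map_polyX map_polyC.
Qed.

Lemma split_ext (L : fieldType) (p : {poly L}) :
  exists (L' : fieldType) (i : {rmorphism L -> L'}), splits (map_poly i p).
Proof.
have [n] := ubnP (size p); elim: n L p => // n IH L p pn.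
have [sp|sp] := leqP (size p) 1.
  exists L, idfun, [::]; rewrite big_nil map_poly_id // (size1_polyC sp).
  by rewrite lead_coefC -mul_polyC mulr1.
have [L1 [i [x /factor_theorem[q qE]]]] := root_ext sp.
have q0 : q != 0.
  apply/eqP => q0; move: qE; rewrite q0 mul0r => /eqP; rewrite map_poly_eq0.
  by move=> /eqP p0; rewrite p0 size_poly0 in sp.
have [|L2 [i2 [rs rsE]]] := IH L1 q.
  have := congr1 (size \o @polyseq _) qE; rewrite /= size_map_poly.
  rewrite size_Mmonic ?monicXsubC // size_XsubC addn2 /= => sE.
  by rewrite sE ltnS in pn.
exists L2, (i2 \o i : {rmorphism L -> L2}), (i2 x :: rs).
rewrite map_poly_comp qE rmorphM rmorphB /= map_polyX map_polyC /= rsE.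
rewrite lead_coefM lead_coefXsubC mulr1 lead_coefZ big_cons.
rewrite (monicP (monic_prod_XsubC _ _ _)) mulr1 -scalerAl.
by rewrite mulrC.
Qed.

Lemma split_ext_seq (L : fieldType) (s : seq {poly L}) :
  exists (L' : fieldType) (i : {rmorphism L -> L'}),
    forall p, p \in s -> splits (map_poly i p).
Proof.
elim: s => [|p s [L1 [i1 IH]]]; first by exists L, idfun.
have [L2 [i2 i2p]] := split_ext (map_poly i1 p).
exists L2, (i2 \o i1 : {rmorphism L -> L2}) => q.
rewrite inE map_poly_comp => /predU1P[->//|/IH]; exact: splits_map.
Qed.

(** An ultraproduct indexed by these sequences satisfies a condition as soon as, for some finite
    list, all sequences containing that list do. *)
Lemma seq_ultra (T : eqType) : exists2 U : set (set (seq T)), ultra U &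
  forall x, U [set s : seq T | x \in s]%classic.
Proof.
pose B := [set A : set (seq T) | exists t : seq T,
  A = [set s : seq T | {subset t <= s}]%classic]%classic.
have [|||U uU BU] := @ultra_exists (seq T) B.
- by exists [set s : seq T | {subset [::] <= s}]%classic, [::].
- by move=> _ [t ->]; exists t.
- move=> _ _ [t ->] [t' ->]; exists [set s : seq T | {subset t ++ t' <= s}]%classic.
    by exists (t ++ t').
  by move=> s h; split=> x xt; apply: h; rewrite mem_cat xt ?orbT.
exists U => // x; apply: (ultraS uU (A := [set s : seq T | {subset [:: x] <= s}]%classic)).
  by move=> s; apply; rewrite inE.
by apply: BU; exists [:: x].
Qed.

(** An ultraproduct of splitting fields of finite lists of polynomials. A given p splits in almost
    every factor, always with the same number of roots, and these are assembled factor by factor. *)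
Lemma split_all (L : fieldType) : exists (W : fieldType) (i : {rmorphism L -> W}),
  forall p, splits (map_poly i p).
Proof.
have [U uU Ux] := seq_ultra {poly L}.
have /choice[Ls /dchoice[ls lsP]] := @split_ext_seq L.
pose dg0 (c : L) : uprod Ls := fun s => ls s c.
have d1 : dg0 1 = 1 by apply: functional_extensionality_dep => s; apply: rmorph1.
have dD : {morph dg0 : x y / x + y}.
  by move=> x y; apply: functional_extensionality_dep => s; apply: rmorphD.
have dM : {morph dg0 : x y / x * y}.
  by move=> x y; apply: functional_extensionality_dep => s; apply: rmorphM.
pose dg := mkrm d1 dD dM.
have [N [upi [upi_eq _]]] := ult_exists uU Ls.
exists N, (upi \o dg) => p.
have /dchoice[rs rsP] : forall s, exists rs : seq (Ls s), p \in s ->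
    map_poly (ls s) p = (ls s (lead_coef p)) *: \prod_(r <- rs) ('X - r%:P).
  move=> s; have [/lsP[rs rsE]|] := boolP (p \in s); last by exists [::].
  by exists rs => _; rewrite {1}rsE lead_coef_map.
have [->|p0] := eqVneq p 0.
  by exists [::]; rewrite map_poly0 lead_coef0 scale0r.
have szrs s : p \in s -> size (rs s) = (size p).-1.
  move=> /rsP /(congr1 (size \o @polyseq _)) /=; rewrite size_map_poly => ->.
  by rewrite size_scale ?size_prod_XsubC // fmorph_eq0 lead_coef_eq0.
pose rho (k : nat) : uprod Ls := fun s => nth 0 (rs s) k.
exists [seq upi (rho k) | k <- iota 0 (size p).-1].
rewrite big_map lead_coef_map.
(* The product ring has to be presented as a nonzero ring P before polynomials over it can be formed
   and mapped to the factors and to the ultraproduct. *)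
have nz : (1 : uprod Ls) != 0.
  by apply/eqP => /(congr1 (fun f : uprod Ls => f [::])) /eqP; rewrite oner_eq0.
have [P [f0 [g0 fg]]] := nz_exists nz.
pose up : {rmorphism P -> N} := upi \o g0.
pose dg' : {rmorphism L -> P} := f0 \o dg.
pose pr0 s : {rmorphism uprod Ls -> Ls s} :=
  @mkrm (uprod Ls) (Ls s) (fun a => a s) erefl (fun _ _ => erefl) (fun _ _ => erefl).
pose pr s : {rmorphism P -> Ls s} := pr0 s \o g0.
pose q : {poly P} := (dg' (lead_coef p))%:P *
  \prod_(k <- iota 0 (size p).-1) ('X - (f0 (rho k))%:P).
have mX (A : nzRingType) (f : {rmorphism P -> A}) : map_poly f q =
    f (dg' (lead_coef p)) *: \prod_(k <- iota 0 (size p).-1) ('X - (f (f0 (rho k)))%:P).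
  rewrite rmorphM /= map_polyC mul_polyC rmorph_prod; congr (_ *: _).
  by apply: eq_bigr => k _; rewrite rmorphB /= map_polyX map_polyC.
transitivity (map_poly up q).
  apply/polyP => k; rewrite !coef_map /=.
  apply/upi_eq; apply: (ultraS uU _ (Ux p)) => s /= ps.
  transitivity ((map_poly (pr s) q)`_k); last by rewrite coef_map.
  transitivity ((map_poly (ls s) p)`_k); first by rewrite coef_map.
  congr (_`_k); rewrite mX rsP // /pr /= fg /=.
  rewrite (big_nth 0) -(szrs s) // /index_iota subn0.
  by under [in RHS]eq_bigr do rewrite fg.
by rewrite mX /up /= fg; under eq_bigr do rewrite fg.
Qed.

Section AlgebraicClosure.
Context (K W : fieldType) (h : {rmorphism K -> W}).
Context (spl : forall p : {poly K}, p != 0 -> exists rs : seq W,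
  map_poly h p = (h (lead_coef p)) *: \prod_(r <- rs) ('X - r%:P)).

(** A root y of f in some extension of k is algebraic over K, because the coefficients of f are. Its
    polynomial over K splits in W with all roots in k, so y is already one of them. *)
Lemma algebraic_closure : exists (k : fieldType) (j : {rmorphism K -> k})
  (g : {rmorphism k -> W}), [/\ alg_closed k, forall c, g (j c) = h c &
    forall x, algebraicOver h x <-> exists y, g y = x].
Proof.
have [|B [i [iinj iE]]] := @subring_kalg K (fk h) (algebraicOver h).
  split=> [c|x y|x y]; first exact: algebraic_id.
    exact: algebraic_add.
  exact: algebraic_mul.
have fB : is_field B.
  split; first by apply/eqP => /(congr1 i) /eqP; rewrite rmorph1 rmorph0 oner_eq0.
  move=> x x0; have ax : algebraicOver h (i x : W) by apply/iE; exists x.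
  have /iE[y yE] := algebraic_inv ax; exists y.
  have ix0 : (i x : W) != 0.
    by apply: contra_neq x0 => e; apply: iinj; rewrite rmorph0.
  apply: iinj; rewrite rmorphM yE rmorph1; exact: mulfV.
pose k := fld_of fB; pose j : {rmorphism K -> k} := fld_in fB \o kstr B.
pose g : {rmorphism k -> W} := (i : {rmorphism B -> fk h}) \o fld_out (fA := fB).
have gj c : g (j c) = h c by apply: (khomP i).
exists k, j, g; split=> // n P n0.
pose f : {poly k} := 'X^n - \sum_(t < n) P t *: 'X^t.
have sz : (size (\sum_(t < n) P t *: 'X^t)%R <= n)%N.
  by rewrite -(poly_def n P) size_poly.
have sf : size f = n.+1.
  by rewrite size_polyDl ?size_polyXn // size_polyN ltnS.
have fm : f \is monic.
  rewrite monicE lead_coefDl ?lead_coefXn // size_polyN size_polyXn ltnS //.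
have [|L [l [y fy]]] := @root_ext k f; first by rewrite sf ltnS.
have [p p0 py] : algebraicOver (l \o j) y.
  apply/integral_algebraic; apply: (@integral_root_monic _ _ _ y (map_poly l f)).
  - exact: monic_map.
  - exact: fy.
  - apply/integral_poly => t; rewrite coef_map; apply/integral_algebraic.
    have [p p0 pr] : algebraicOver h (g f`_t) by apply/iE; exists f`_t.
    exists p => //; rewrite map_poly_comp fmorph_root.
    rewrite -(fmorph_root g) -map_poly_comp.
    by rewrite (eq_map_poly (g := h)).
have [rs rsE] := spl p0.
have rsA r : r \in rs -> exists z, g z = r.
  move=> rrs; apply/iE; exists p => //; rewrite rsE rootZ ?fmorph_eq0 ?lead_coef_eq0 //.
  by rewrite root_prod_XsubC.
have [zs zsE] : exists zs, [seq g z | z <- zs] = rs.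
  elim: rs rsA {rsE} => [|r rs IH] rsA; first by exists [::].
  have [|zs <-] := IH; first by move=> r' h'; apply: rsA; rewrite inE h' orbT.
  by have [|z <-] := rsA r; rewrite ?inE ?eqxx //; exists (z :: zs).
have pE : map_poly j p = j (lead_coef p) *: \prod_(z <- zs) ('X - z%:P).
  apply: (map_poly_inj g); rewrite -map_poly_comp (eq_map_poly (g := h)) //.
  rewrite rsE map_polyZ gj rmorph_prod -zsE big_map; congr (_ *: _).
  by apply: eq_bigr => z _; rewrite rmorphB /= map_polyX map_polyC.
have : root (map_poly l (map_poly j p)) y by rewrite -map_poly_comp.
rewrite pE map_polyZ rootZ ?fmorph_eq0 ?lead_coef_eq0 //.
rewrite rmorph_prod /root horner_prod prodf_seq_eq0 => /hasP[z _] /=.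
rewrite rmorphB /= map_polyX map_polyC hornerXsubC subr_eq0 => /eqP yz.
exists z; move: fy; rewrite yz fmorph_root /root /f !hornerE horner_sum subr_eq0.
by move=> /eqP ->; apply: eq_bigr => t _; rewrite hornerZ hornerXn.
Qed.

End AlgebraicClosure.

(** * Composita and specializations *)

Lemma alg_closed_ext (F : fieldType) : exists (W : fieldType)
  (i : {rmorphism F -> W}), alg_closed W.
Proof.
have [N [h hs]] := split_all F.
have [|W [i [_ [cW _ _]]]] := @algebraic_closure F N h; last by exists W, i.
by move=> p _; have [rs rsE] := hs p; exists rs; rewrite -lead_coef_map.
Qed.

Lemma closed_root (k : fieldType) (p : {poly k}) : alg_closed k ->
  (1 < size p)%N -> exists x, root p x.
Proof.
move=> ck sp; have lc0 : lead_coef p != 0.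
  by rewrite lead_coef_eq0 -size_poly_gt0 (ltn_trans _ sp).
have n0 : (0 < (size p).-1)%N by rewrite -ltnS prednK // ltnW.
have [x xE] := ck _ (fun i => - (p`_i / lead_coef p)) n0.
exists x; rewrite /root horner_coef -(prednK (ltnW sp)) big_ord_recr /=.
rewrite -lead_coefE xE mulr_sumr -big_split big1 //= => i _.
by rewrite mulNr mulrN mulrA [lead_coef p * _]mulrC divfK // addrN.
Qed.

Lemma closed_splits (k : fieldType) (p : {poly k}) : alg_closed k -> splits p.
Proof.
move=> ck; have [n] := ubnP (size p); elim: n p => // n IH p pn.
have [sp|sp] := leqP (size p) 1.
  exists [::]; rewrite big_nil (size1_polyC sp).
  by rewrite lead_coefC -mul_polyC mulr1.
have [x /factor_theorem[q qE]] := closed_root ck sp.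
have q0 : q != 0.
  by apply/eqP => q0; rewrite qE q0 mul0r size_poly0 in sp.
have [|rs rsE] := IH q.
  by move: pn; rewrite qE size_Mmonic ?monicXsubC // size_XsubC addn2.
exists (x :: rs); rewrite qE {1}rsE big_cons lead_coefM lead_coefXsubC mulr1.
by rewrite -scalerAl mulrC.
Qed.

Lemma closed_algebraic (K W : fieldType) (h : {rmorphism K -> W}) : alg_closed W ->
  exists (k : fieldType) (j : {rmorphism K -> k})
    (g : {rmorphism k -> W}), [/\ alg_closed k, forall c, g (j c) = h c &
    forall x, algebraicOver h x <-> exists y, g y = x].
Proof.
move=> cW; apply: algebraic_closure => p _.
have [rs rsE] := closed_splits (map_poly h p) cW.
by exists rs; rewrite -lead_coef_map.
Qed.

Lemma field_residue (K : fieldType) (A : kalg K) : (1 : A) != 0 ->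
  exists (F : fieldType) (f : {rmorphism A -> F}), True.
Proof.
move=> A1; have [|k [f [fk _]]] := @residue K A set0.
  by move=> [n [c [s [Ss e]]]]; move/eqP: A1; apply; rewrite -e big1 // => i; case: (Ss i).
by exists (fld_of fk), (fld_in fk \o f).
Qed.

Definition gen_set (K : fieldType) (A : kalg K) n (a : 'I_n -> A) : set A :=
  [set x | exists p, ev (kstr A) a p = x]%classic.

Lemma gen_subring (K : fieldType) (A : kalg K) n (a : 'I_n -> A) :
  is_subring (gen_set a).
Proof.
split=> [c|_ _ [p <-] [q <-]|_ _ [p <-] [q <-]].
- by exists (itC K n c); rewrite ev_itC.
- by exists (p + q); rewrite rmorphD.
- by exists (p * q); rewrite rmorphM.
Qed.

Lemma gen_set_mem (K : fieldType) (A : kalg K) n (a : 'I_n -> A) k : gen_set a (a k).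
Proof. by exists (itX K k); rewrite ev_itX. Qed.

Lemma gen_kalg (K : fieldType) (A : kalg K) n (a : 'I_n -> A) :
  exists (R : kalg K) (i : khom R A) (b : 'I_n -> R), [/\ injective i,
    generates b, forall k, i (b k) = a k & forall x, gen_set a x <-> exists r, i r = x].
Proof.
have [R [i [iinj iE]]] := subring_kalg (gen_subring a).
have /choice[b bE] : forall k, exists b, i b = a k.
  by move=> k; apply/iE/gen_set_mem.
exists R, i, b; split=> // S SC Sb Sop r.
have [p pE] : gen_set a (i r) by apply/iE; exists r.
have -> : r = ev (kstr R) b p.
  by apply: iinj; rewrite khom_ev -pE; apply: ev_ext => k; rewrite -bE.
elim/itpoly_ind: p {pE} => [c|k|x y Sx Sy|x y Sx Sy].
- by rewrite ev_itC.
- by rewrite ev_itX.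
- by rewrite rmorphD; have [] := Sop _ _ Sx Sy.
- by rewrite rmorphM; have [] := Sop _ _ Sx Sy.
Qed.

(** For R generated by finitely many elements of F, the base change of R to E is nonzero, so it has
    a residue field containing E and receiving R. The ultraproduct of these fields over all finite
    lists receives all of F. *)
Lemma compositum (K E F : fieldType) (jE : {rmorphism K -> E})
  (jF : {rmorphism K -> F}) : exists (W : fieldType) (gE : {rmorphism E -> W})
    (gF : {rmorphism F -> W}), forall c, gE (jE c) = gF (jF c).
Proof.
have [U uU Ux] := seq_ultra F.
(* The map Q.2 is defined on all of F but respects the operations only on the subalgebra generated
   by s; any two elements of F lie in almost every such subalgebra. *)
have H (s : seq F) : exists W : fieldType, exists Q : {rmorphism E -> W} * (F -> W),
  let S := @gen_set K (fk jF) _ (tnth (in_tuple s)) in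
  [/\ Q.2 1 = 1, forall x y, S x -> S y -> Q.2 (x + y) = Q.2 x + Q.2 y,
    forall x y, S x -> S y -> Q.2 (x * y) = Q.2 x * Q.2 y &
    forall c, Q.1 (jE c) = Q.2 (jF c)].
  have [R [i [b [iinj gb ib SE]]]] := @gen_kalg K (fk jF) _ (tnth (in_tuple s)).
  have [RE [l bl]] := base_ring_exists jE gb.
  have R1 : (1 : RE) != 0.
    apply/eqP => RE1; have : l 1 = 0 by rewrite rmorph1.
    move=> /(base_inj bl) /(congr1 i) /eqP; rewrite rmorph1 rmorph0.
    by rewrite (_ : (1 : fk jF) == 0 = false) //; apply: oner_eq0.
  have [W [f _]] := field_residue R1.
  pose f' : {rmorphism R -> W} := f \o l.
  have /choice[pr prE] : forall x : F, exists r, gen_set (A := fk jF) (tnth (in_tuple s)) x -> i r = x.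
    move=> x; have [/SE[r <-]|] := pselect (gen_set (A := fk jF) (tnth (in_tuple s)) x); first by exists r.
    by exists 0.
  have [SC SD SM] := @gen_subring K (fk jF) _ (tnth (in_tuple s)).
  exists W, (f \o kstr RE : {rmorphism E -> W}, fun x => f' (pr x)); split=> /=.
  - have -> : pr 1 = 1; last by rewrite !rmorph1.
    apply: iinj; rewrite rmorph1; apply: prE.
    by have := SC 1; rewrite rmorph1.
  - move=> x y Sx Sy; rewrite -!rmorphD; congr (f (l _)).
    by apply: iinj; rewrite rmorphD !prE //; apply: SD.
  - move=> x y Sx Sy; rewrite -!rmorphM; congr (f (l _)).
    by apply: iinj; rewrite rmorphM !prE //; apply: SM.
  - move=> c; transitivity (f (l (kstr R c))); first by rewrite (khomP l).
    congr (f (l _)); apply: iinj.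
    by rewrite khomP prE //; apply: SC.
have /choice[W /dchoice[Q QP]] := H.
pose gE0 (x : E) : uprod W := fun s => (Q s).1 x.
have e1 : gE0 1 = 1 by apply: functional_extensionality_dep => s; apply: rmorph1.
have eD : {morph gE0 : x y / x + y}.
  by move=> x y; apply: functional_extensionality_dep => s; apply: rmorphD.
have eM : {morph gE0 : x y / x * y}.
  by move=> x y; apply: functional_extensionality_dep => s; apply: rmorphM.
have [N [p [pE _]]] := ult_exists uU W.
pose gF0 (x : F) : uprod W := fun s => (Q s).2 x.
have inS (x : F) (s : seq F) : x \in s -> gen_set (A := fk jF) (tnth (in_tuple s)) x.
  move=> xs; have /tnthP[k ->] : x \in in_tuple s by [].
  exact: gen_set_mem.
have f1 : p (gF0 1) = 1.
  rewrite -(rmorph1 p); apply/pE; apply: (ultraS uU _ (ultraT uU)) => s _ /=.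
  by have [h _ _ _] := QP s; exact: h.
have fD : {morph (p \o gF0) : x y / x + y}.
  move=> x y /=; rewrite -rmorphD; apply/pE.
  apply: (ultraS uU _ (ultraI uU (Ux x) (Ux y))) => s [/= xs ys].
  by have [_ h _ _] := QP s; apply: h; apply: inS.
have fM : {morph (p \o gF0) : x y / x * y}.
  move=> x y /=; rewrite -rmorphM; apply/pE.
  apply: (ultraS uU _ (ultraI uU (Ux x) (Ux y))) => s [/= xs ys].
  by have [_ _ h _] := QP s; apply: h; apply: inS.
exists N, (p \o mkrm e1 eD eM), (mkrm f1 fD fM) => c /=.
by apply/pE; apply: (ultraS uU _ (ultraT uU)) => s _; have [_ _ _ h] := QP s; apply: h.
Qed.

Lemma size_drop_lead (R : nzRingType) (q : {poly R}) : q != 0 ->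
  (size (q - lead_coef q *: 'X^((size q).-1))%R < size q)%N.
Proof.
move=> q0; have [d sq] : exists d, size q = d.+1.
  by exists (size q).-1; rewrite prednK // size_poly_gt0.
rewrite sq ltnS; apply/leq_sizeP => i; rewrite leq_eqVlt => /orP[/eqP <-|h].
  by rewrite coefB coefZ coefXn eqxx mulr1 lead_coefE sq subrr.
by rewrite coefB coefZ coefXn gtn_eqF // mulr0 subr0 nth_default // sq.
Qed.

Section Specialization.
Context (k W : fieldType) (g : {rmorphism k -> W}) (ck : alg_closed k).

Lemma poly_nonroot (q : {poly k}) : q != 0 -> exists y, q.[y] != 0.
Proof.
move=> q0; have [sq|sq] := leqP (size q) 1.
  by exists 0; move: q0; rewrite (size1_polyC sq) hornerC polyC_eq0.
have [|y /rootP yE] := @closed_root k (q - 1) ck.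
  by rewrite size_polyDl // size_polyN size_poly1.
exists y; move: yE; rewrite !hornerE => /eqP; rewrite subr_eq0 => /eqP ->.
exact: oner_neq0.
Qed.

Section Step.
Context (P : idomainType) (e : {rmorphism P -> W}) (t : W).
Local Notation E := (evp e t).

(* A minimal polynomial m of t, up to scaling by coefficients not killed by e. *)
Lemma min_poly (q0 : {poly P}) i0 : E q0 = 0 -> e q0`_i0 != 0 ->
  exists m : {poly P}, [/\ E m = 0, e (lead_coef m) != 0, (1 < size m)%N &
    forall q : {poly P}, (size q < size m)%N -> E q = 0 -> forall i, e q`_i = 0].
Proof.
have [n] := ubnP (size q0); elim: n q0 i0 => // n IH q0 i0 q0n Eq0 eq0.
have [[q [sq [Eq [i eqi]]]]|nmin] := pselect (exists q : {poly P},
    (size q < size q0)%N /\ E q = 0 /\ exists i, e q`_i != 0).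
  by apply: (IH q i) => //; apply: leq_trans sq _.
have min (q : {poly P}) : (size q < size q0)%N -> E q = 0 -> forall i, e q`_i = 0.
  move=> sq Eq i; apply: contrapT => /eqP ei; apply: nmin.
  by exists q; split=> //; split=> //; exists i.
have q00 : q0 != 0 by apply: contraNneq eq0 => ->; rewrite coef0 rmorph0.
have lc : e (lead_coef q0) != 0.
  apply/eqP => lc; pose q1 := q0 - lead_coef q0 *: 'X^((size q0).-1).
  have sq1 : (size q1 < size q0)%N.
    exact: size_drop_lead.
  have Eq1 : E q1 = 0.
    by rewrite rmorphB -mul_polyC rmorphM evpC lc mul0r subr0.
  have := min _ sq1 Eq1 i0; rewrite /q1 coefB rmorphB coefZ rmorphM lc mul0r subr0.
  by move/eqP; rewrite (negPf eq0).
exists q0; split=> //; rewrite ltnNge; apply/negP => s1.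
by move: Eq0; rewrite (size1_polyC s1) evpC => /eqP;
   move: lc; rewrite {1}(size1_polyC s1) lead_coefC => /negPf ->.
Qed.

Context (m : {poly P}) (Em : E m = 0) (lm : e (lead_coef m) != 0)
  (sm : (1 < size m)%N)
  (mmin : forall q : {poly P}, (size q < size m)%N -> E q = 0 -> forall i, e q`_i = 0).

Lemma m_neq0 : m != 0.
Proof. by rewrite -size_poly_gt0 (ltn_trans _ sm). Qed.

Lemma min_div q : E q = 0 -> exists N A r, [/\ lead_coef m ^+ N *: q = A * m + r &
  forall i, e r`_i = 0].
Proof.
move=> Eq; exists (scalp q m), (q %/ m), (q %% m); split; first exact: Pdiv.Idomain.divp_eq.
apply: mmin; first by rewrite ltn_modp m_neq0.
have -> : q %% m = lead_coef m ^+ scalp q m *: q - q %/ m * m.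
  by rewrite Pdiv.Idomain.divp_eq addrAC subrr add0r.
by rewrite rmorphB rmorphM -mul_polyC rmorphM Eq Em !mulr0 subrr.
Qed.

Lemma evp_mod h1 h2 : h2 != 0 ->
  E (h1 %% h2) = e (lead_coef h2) ^+ scalp h1 h2 * E h1 - E (h1 %/ h2) * E h2.
Proof.
move=> h20; have -> : h1 %% h2 = lead_coef h2 ^+ scalp h1 h2 *: h1 - h1 %/ h2 * h2.
  by rewrite Pdiv.Idomain.divp_eq addrAC subrr add0r.
by rewrite rmorphB rmorphM -mul_polyC rmorphM evpC rmorphXn.
Qed.

(** Euclid's algorithm for p and m without denominators: h runs through polynomials of decreasing
    size whose value at t is a nonzero multiple of E p, until it is constant. The remainder of m by
    h cannot vanish at t: minimality of m would then make e kill all coefficients of quotient and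
    remainder, although it does not kill the leading coefficient of m. *)
Lemma min_inv p : E p != 0 -> exists B d, e d != 0 /\ E B * E p = e d.
Proof.
pose H (h : {poly P}) := exists B : {poly P}, E B * E p = E h /\ E h != 0.
suff main : forall h : {poly P}, H h -> exists B d, e d != 0 /\ E B * E p = e d.
  by move=> Ep; apply: (main p); exists 1; rewrite rmorph1 mul1r.
move=> h; have [n] := ubnP (size h); elim: n h => // n IH h hn [B [EB Eh]].
have [hm|mh] := ltnP (size h) (size m); last first.
  apply: (IH (h %% m)).
    have h1 : (size (h %% m)%R < size m)%N by rewrite ltn_modp m_neq0.
    by rewrite ltnS in hn; apply: leq_trans h1 (leq_trans mh hn).
  exists ((lead_coef m ^+ scalp h m)%:P * B).
  rewrite evp_mod ?m_neq0 // Em mulr0 subr0 /E rmorphM evpC rmorphXn -mulrA EB.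
  by split=> //; rewrite mulf_neq0 // expf_neq0.
have [h1|h1] := leqP (size h) 1.
  exists B, h`_0; move: Eh EB; rewrite (size1_polyC h1) coefC eqxx evpC.
  by [].
have h0 : h != 0 by rewrite -size_poly_gt0 (ltn_trans _ h1).
have [lh|lh] := eqVneq (e (lead_coef h)) 0.
  pose h' := h - lead_coef h *: 'X^((size h).-1).
  have Eh' : E h' = E h.
    by rewrite rmorphB -mul_polyC rmorphM evpC lh mul0r subr0.
  apply: (IH h'); last by exists B; rewrite Eh'.
  by rewrite ltnS in hn; apply: leq_trans hn; apply: size_drop_lead.
have Er := evp_mod m h0; rewrite Em mulr0 sub0r in Er.
have sr : (size (m %% h)%R < size h)%N by rewrite ltn_modp.
have [Er0|Er0] := eqVneq (E (m %% h)) 0; last first.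
  apply: (IH (m %% h)); first by rewrite ltnS in hn; apply: leq_trans sr hn.
  exists (- (m %/ h) * B); split=> //.
  by rewrite Er /E rmorphM rmorphN -mulrA EB mulNr.
have r0 := mmin (ltn_trans sr hm) Er0.
have EA : E (m %/ h) = 0.
  by move/eqP: Er; rewrite Er0 eq_sym oppr_eq0 mulf_eq0 (negPf Eh) orbF => /eqP.
have A0 : forall i, e (m %/ h)`_i = 0.
  apply: mmin EA; rewrite Pdiv.Idomain.size_divp //.
  by rewrite ltn_subrL -subn1 subn_gt0 h1 (ltn_trans _ sm).
have := congr1 (fun q : {poly P} => e q`_((size m).-1)) (Pdiv.Idomain.divp_eq m h).
rewrite coefZ rmorphM coefD rmorphD r0 addr0 coefM rmorph_sum big1 => [|i _]; last first.
  by rewrite rmorphM A0 mul0r.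
move/eqP; rewrite mulf_eq0 rmorphXn -lead_coefE (negPf lm) orbF.
by rewrite expf_eq0 (negPf lh) andbF.
Qed.

End Step.

(** A form of the Nullstellensatz, by specializing the coordinates other than a 0 first. If a 0 is
    algebraic over them, its new value is a root of the specialized minimal polynomial m; the
    leading coefficient of m is kept nonzero, as well as an element d which modulo relations is a
    multiple of p. If a 0 is transcendental, any value that is not a root of the specialized p will
    do. *)
Lemma specialize n (a : 'I_n -> W) (p : itpoly k n) : ev g a p != 0 ->
  exists c : 'I_n -> k, ev (idfun : {rmorphism k -> k}) c p != 0 /\
    forall q, ev g a q = 0 -> ev (idfun : {rmorphism k -> k}) c q = 0.
Proof.
elim: n a p => [|n IH] a p ap.
  exists (fun _ => 0); split=> /= [|q]; first by rewrite -(fmorph_eq0 g).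
  by move/eqP; rewrite fmorph_eq0 => /eqP.
pose a' := a \o lift ord0; pose t := a ord0; pose e := ev g a'.
pose ext (c : 'I_n -> k) y := scons y c.
have extE c y (q : {poly itpoly k n}) :
    ev (idfun : {rmorphism k -> k}) (ext c y) q =
    (map_poly (ev (idfun : {rmorphism k -> k}) c) q).[y].
  rewrite /= evp_horner /ext {2}/scons; case: unliftP => // _.
  congr (_.[_]); apply: eq_map_poly => z; apply: ev_ext => i /=.
  by rewrite /scons liftK.
have [alg|trans] := pselect (exists q : {poly itpoly k n}, evp e t q = 0 /\
    exists i, e q`_i != 0).
  have [q0 [Eq0 [i0 eq0]]] := alg.
  have [m [Em lm sm mmin]] := min_poly Eq0 eq0.
  have [B [d [ed EB]]] := min_inv Em lm sm mmin (p := p) ap.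
  have [|c [cP cZ]] := IH a' (d * lead_coef m).
    by rewrite rmorphM mulf_neq0.
  move: cP; rewrite rmorphM mulf_eq0 negb_or => /andP[cd cl].
  have [|y ym] := @closed_root k (map_poly (ev (idfun : {rmorphism k -> k}) c) m) ck.
    by rewrite size_map_poly_id0.
  have Z q : evp e t q = 0 -> ev (idfun : {rmorphism k -> k}) (ext c y) q = 0.
    move=> /(min_div Em sm mmin)[N [A [r [qE r0]]]].
    have := congr1 (ev (idfun : {rmorphism k -> k}) (ext c y)) qE.
    rewrite -mul_polyC rmorphD !rmorphM [X in _ = _ * X + _]extE (rootP ym) mulr0 add0r.
    have -> : ev (idfun : {rmorphism k -> k}) (ext c y) r = 0.
      rewrite extE (_ : map_poly _ r = 0) ?horner0 //.
      by apply/polyP => i; rewrite coef_map coef0 /=; apply: cZ.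
    move/eqP; rewrite mulf_eq0 extE map_polyC hornerC /= rmorphXn.
    by rewrite expf_eq0 (negPf cl) andbF /= => /eqP.
  exists (ext c y); split; last exact: Z.
  have /Z : evp e t (B * p - d%:P) = 0.
    by rewrite rmorphB rmorphM EB evpC subrr.
  rewrite rmorphB rmorphM => /eqP; rewrite subr_eq0 => /eqP h.
  apply/eqP => p0; move: h; rewrite p0 mulr0 extE map_polyC hornerC => /esym/eqP.
  by rewrite (negPf cd).
have Z0 q : evp e t q = 0 -> forall i, e q`_i = 0.
  move=> Eq i; apply: contrapT => /eqP h; apply: trans; exists q; split=> //.
  by exists i.
have [i ei] : exists i, e (p : {poly _})`_i != 0.
  apply: contrapT => h; move/eqP: ap; apply.
  rewrite /= evpE /evp_fun big1 // => i _.
  suff -> : ev g (a \o lift ord0) (p : {poly _})`_i = 0 by rewrite mul0r.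
  by apply: contrapT => /eqP h'; apply: h; exists i.
have [c [cP cZ]] := IH a' _ ei.
have [|y yP] := @poly_nonroot (map_poly (ev (idfun : {rmorphism k -> k}) c) p).
  apply/eqP => /(congr1 (fun q : {poly k} => q`_i)); rewrite coef_map coef0 /=.
  by move/eqP; rewrite (negPf cP).
exists (ext c y); split; first by rewrite extE.
move=> q /Z0 q0; rewrite extE (_ : map_poly _ q = 0) ?horner0 //.
by apply/polyP => i'; rewrite coef_map coef0 /=; apply: cZ.
Qed.

End Specialization.

(** * Regular extensions *)

Lemma dom_exists (A : comPzRingType) : domain A ->
  exists (D : idomainType) (f : {rmorphism A -> D}) (g : {rmorphism D -> A}),
    cancel f g /\ cancel g f.
Proof.
move=> dA; exists (dom_of dA).
exists (@mkrm A (dom_of dA) id erefl (fun _ _ => erefl) (fun _ _ => erefl)).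
by exists (@mkrm (dom_of dA) A id erefl (fun _ _ => erefl) (fun _ _ => erefl)).
Qed.

(** The coefficient of lowest degree not killed by i is, after cancelling a power of z, a multiple
    of z. *)
Lemma norm_of_root (R : nzRingType) (S : idomainType) (i : {rmorphism R -> S})
  (z : S) (p : {poly R}) : z != 0 -> map_poly i p != 0 ->
  (map_poly i p).[z] = 0 -> exists r w, i r = z * w /\ i r != 0.
Proof.
move=> z0; elim/poly_ind: p => [|p c IH]; first by rewrite map_poly0 eqxx.
rewrite rmorphD rmorphM /= map_polyX map_polyC /= !hornerE.
have [ic|ic] := eqVneq (i c) 0; last first.
  move=> _ /eqP; rewrite addrC addr_eq0 => /eqP icE.
  by exists c, (- (map_poly i p).[z]); rewrite mulrN mulrC.
rewrite ic rmorph0 !addr0 mulf_eq0 negb_or => /andP[p0 _] /eqP.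
by rewrite mulf_eq0 (negPf z0) orbF => /eqP; apply: IH.
Qed.

Section BaseNorm.
Context (K E : fieldType) (j : {rmorphism K -> E}) (R : kalg K) (RE : kalg E)
  (i : khom R (kres j RE)) (dR : domain R)
  (dRE : domain RE).

(* An element of R_E with algebraic coefficients is integral over R, hence
   divides a nonzero element of R. *)
Lemma base_norm m (e : 'I_m -> E) (x : 'I_m -> R) z :
  (forall k, algebraicOver j (e k)) -> z = \sum_k kstr RE (e k) * i (x k) ->
  z <> 0 -> exists r w, r <> 0 /\ i r = z * w.
Proof.
move=> ae zE z0.
have [D [f [f' [fK _]]]] := dom_exists dR.
have [G [g [g' [gK g'K]]]] := dom_exists dRE.
pose h : {rmorphism D -> G} := g \o (i : {rmorphism R -> RE}) \o f'.
have [p mp pz] : integralOver h (g z).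
  rewrite zE rmorph_sum.
  apply: (big_ind (integralOver h)) => [|u v|k _]; first exact: integral0.
    exact: integral_add.
  rewrite rmorphM; apply: integral_mul; last first.
    have -> : g (i (x k)) = h (f (x k)) by rewrite /h /= fK.
    exact: integral_id.
  have /integral_algebraic[p mp pe] := ae k.
  exists (map_poly (f \o kstr R) p); first exact: monic_map.
  rewrite -map_poly_comp.
  rewrite (eq_map_poly (g := (g \o kstr RE : {rmorphism E -> G}) \o j)); last first.
    by move=> c /=; rewrite fK khomP.
  by rewrite map_poly_comp rmorph_root.
have gz : g z != 0.
  by apply/eqP => /(congr1 g'); rewrite gK rmorph0.
have [||r [w [rw r0]]] := norm_of_root (i := h) (p := p) gz.
- by rewrite monic_neq0 // monic_map.
- exact/rootP.
exists (f' r), (g' w); split.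
  by apply: contra_neq_not r0 => e0; rewrite /h /= e0 !rmorph0.
by rewrite -[LHS]gK [g _]rw rmorphM gK.
Qed.

End BaseNorm.

Section Regular.
Context (K F : fieldType) (j : {rmorphism K -> F}).

(** Let k be the algebraic closure of K in a field W containing both E and F. The E-coefficients of
    a nonzero element of R_E are expanded over k in a k-independent family of W; by regularity some
    k-component is nonzero at the point of R given by F. For two nonzero elements, both such
    components survive at a common k-point. There R_E maps to W and kills neither element, by
    k-independence, so the product is nonzero. *)
Lemma regular_domain (R : kalg K) n (a : 'I_n -> R) (io : khom R (fk j))
  (E : fieldType) (jE : {rmorphism K -> E}) (RE : kalg E)
  (i : khom R (kres jE RE)) :
  regular j -> generates a -> injective io -> is_base_ring i -> domain RE.
Proof.
move=> rj ga ioinj bi; split.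
  apply/eqP => RE1; have : i 1 = 0 by rewrite rmorph1.
  move=> /(base_inj bi) /(congr1 io) /eqP; rewrite rmorph1 rmorph0.
  by rewrite (_ : (1 : fk j) == 0 = false) //; apply: oner_eq0.
have [W0 [gE0 [gF0 g0]]] := compositum jE j.
have [W [w cW]] := alg_closed_ext W0.
have [gE [gF gEF]] : exists (gE : {rmorphism E -> W}) (gF : {rmorphism F -> W}),
    forall c, gE (jE c) = gF (j c).
  by exists (w \o gE0), (w \o gF0) => c; rewrite /= g0.
have [k [l [ka [ck lE kaE]]]] := closed_algebraic (gF \o j) cW.
pose aW : 'I_n -> W := fun t => gF (io (a t)).
have evW q : ev (gF \o j) aW q = gF (io (ev (kstr R) a q)).
  by apply/esym/(ev_comp (g := (gF \o (io : {rmorphism R -> F})))) => // c; rewrite /= khomP.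
have evk q : ev ka aW (imap l n q) = ev (gF \o j) aW q.
  by apply: ev_imap => c; rewrite lE.
have key z : z <> 0 -> exists m (e : 'I_m -> E) (x : 'I_m -> itpoly K n),
    z = \sum_s kstr RE (e s) * i (ev (kstr R) a (x s)) /\
    exists p (eps : 'I_p -> W) (q : 'I_m -> 'I_p -> k) t,
      [/\ @indep k (fk ka) p eps,
      forall s, gE (e s) = \sum_t ka (q s t) * eps t &
      ev ka aW (\sum_s itC k n (q s t) * imap l n (x s)) != 0].
  move=> z0; have [m [e [x [ix zE]]]] := base_repr bi ga z.
  have /choice[X XE] s := gen_surj ga (x s).
  exists m, e, X; split; first by rewrite zE; apply: eq_bigr => s _; rewrite XE.
  have [p [eps [q [ieps qE0]]]] := @fin_basis k (fk ka) m (gE \o e).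
  have qE s : gE (e s) = \sum_t ka (q s t) * eps t := qE0 s.
  have [s [t qst]] : exists s t, q s t != 0.
    apply: contrapT => h; apply: z0; rewrite zE big1 // => s _.
    suff -> : e s = 0 by rewrite rmorph0 mul0r.
    apply: (fmorph_inj gE); rewrite rmorph0 qE big1 // => t _.
    have -> : q s t = 0 by apply: contrapT => /eqP qst; apply: h; exists s, t.
    by rewrite rmorph0 mul0r.
  exists p, eps, q, t; split=> //.
  have -> : ev ka aW (\sum_s itC k n (q s t) * imap l n (X s)) =
      \sum_s ka (q s t) * gF (io (x s)).
    rewrite rmorph_sum; apply: eq_bigr => s' _.
    by rewrite rmorphM ev_itC evk evW XE.
  apply/eqP => e0; have := rj W gF cW m (fun s => io (x s)) _ (fun s => ka (q s t)) _ e0 s.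
  have ii c : \sum_k0 j (c k0) * io (x k0) = 0 -> forall k0, c k0 = 0.
    move=> h; apply: ix; apply: ioinj; rewrite rmorph0 -[RHS]h rmorph_sum.
    by apply: eq_bigr => s' _; rewrite rmorphM khomP.
  move=> /(_ ii) h; move/eqP: qst; apply; apply: (fmorph_inj ka).
  by rewrite rmorph0 h // => s'; apply/kaE; exists (q s' t).
move=> x y xy; apply: contrapT => /not_orP[/key kx /key ky].
have [m [e [X [xE [p [eps [q [t [ieps qE Px]]]]]]]]] := kx.
have [m' [e' [Y [yE [p' [eps' [q' [t' [ieps' qE' Py]]]]]]]]] := ky.
set PX := \sum_s _ in Px; set PY := \sum_s _ in Py.
(* The values of R in F need not be linearly disjoint from E inside W; the point is therefore moved
   to one with coordinates in k. *)
have [|c [cP cZ]] := @specialize k W ka ck n aW (PX * PY).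
  by rewrite rmorphM mulf_neq0.
move: cP; rewrite rmorphM mulf_eq0 negb_or => /andP[cX cY].
pose evc := ev (idfun : {rmorphism k -> k}) c.
have [|phi phiE] := @gen_hom K R n a (fk (gF \o j)) (fun t => ka (c t)) ga.
  move=> r r0; have := cZ (imap l n r); rewrite evk evW r0 !rmorph0 => /(_ erefl).
  move=> /(congr1 ka); rewrite rmorph0 => <-.
  rewrite (ev_comp (h' := ka) (w := ka \o c)) //; apply/esym/ev_imap => d.
  exact/esym/lE.
have phik r : phi (ev (kstr R) a r) = ka (evc (imap l n r)).
  rewrite phiE [RHS](ev_comp (h' := ka) (w := ka \o c)) //.
  by apply/esym/ev_imap => d; apply/esym/lE.
have [iL _ _ _] := bi.
(* The k-point together with the inclusion of E in W defines the homomorphism Phi from R_E to W. *)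
pose phi' : khom R (kres jE (fk gE)) := @KHom K R (kres jE (fk gE))
  (phi : {rmorphism R -> W}) (fun d => etrans (khomP phi d) (esym (gEF d))).
have [Phi PhiE] := iL (fk gE) phi'.
have val m1 (e1 : 'I_m1 -> E) (X1 : 'I_m1 -> itpoly K n) p1 (eps1 : 'I_p1 -> W)
    (q1 : 'I_m1 -> 'I_p1 -> k) t1 : @indep k (fk ka) p1 eps1 ->
    (forall s, gE (e1 s) = \sum_t ka (q1 s t) * eps1 t) ->
    evc (\sum_s itC k n (q1 s t1) * imap l n (X1 s)) != 0 ->
    Phi (\sum_s kstr RE (e1 s) * i (ev (kstr R) a (X1 s))) <> 0.
  move=> ie qE1 /eqP nz h; apply: nz.
  rewrite rmorph_sum; under eq_bigr do rewrite rmorphM [evc (itC _ _ _)]ev_itC.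
  move: t1; apply: ie; rewrite -[RHS]h rmorph_sum.
  under [RHS]eq_bigr => s _.
    rewrite rmorphM khomP PhiE.
    rewrite (_ : kstr (fk gE) (e1 s) * phi' (ev (kstr R) a (X1 s)) =
      \sum_t1 ka (q1 s t1) * eps1 t1 * ka (evc (imap l n (X1 s)))); last first.
      rewrite -mulr_suml -qE1 -phik; by [].
  over.
  rewrite exchange_big; apply: eq_bigr => t1 _.
  rewrite [kstr _ _]rmorph_sum mulr_suml; apply: eq_bigr => s _ /=.
  by rewrite rmorphM mulrAC.
have := congr1 Phi xy; rewrite rmorphM rmorph0 => /eqP.
rewrite (_ : (Phi x * Phi y == 0) = ((Phi x : W) == 0) || ((Phi y : W) == 0)); last exact: mulf_eq0.
case/orP => /eqP.
  by rewrite xE; apply: val ieps qE cX.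
by rewrite yE; apply: val ieps' qE' cY.
Qed.

(** Let e give a relation with algebraic coefficients between K-independent b k. After clearing
    denominators it is an element z of the base change of R to W, killed by the map to W. If z were
    nonzero it would divide a nonzero element of R by [base_norm], and that element would die in W
    as well. So z is zero, and the coefficients vanish. *)
Lemma regular_frac (R : kalg K) n (a : 'I_n -> R) (io : khom R (fk j)) :
  generates a -> injective io ->
  (forall x : F, exists r s, s <> 0 /\ x * io s = io r) ->
  (forall (E : fieldType) (jE : {rmorphism K -> E}) (RE : kalg E)
     (i : khom R (kres jE RE)), is_base_ring i -> domain RE) ->
  domain R -> regular j.
Proof.
move=> ga ioinj frac dom dR W g cW m b ib e ae eb.
have io0 s : s <> 0 -> (io s : F) != 0.
  by move=> s0; apply/eqP => h; apply: s0; apply: ioinj; rewrite rmorph0.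
have [s [s0 [x xE]]] : exists s, s <> 0 /\ exists x : 'I_m -> R,
    forall k, b k * io s = io (x k).
  have /choice[r /choice[s rs]] := fun k => frac (b k).
  exists (\prod_k s k); split.
    have [D [f [f' [fK f'K]]]] := dom_exists dR.
    move=> h; have : \prod_k f (s k) = 0 by rewrite -rmorph_prod h rmorph0.
    move=> /eqP; apply/negP/prodf_neq0 => k _; apply/eqP => fs.
    by have [+ _] := rs k; apply; rewrite -(fK (s k)) fs rmorph0.
  exists (fun k => r k * \prod_(k' | k' != k) s k') => k.
  have [_ h] := rs k; rewrite rmorphM -h (bigD1 k) //= rmorphM mulrA //.
have [RE [i bi]] := base_ring_exists (g \o j) ga.
have dRE := dom _ _ _ _ bi.
have [iL _ _ _] := bi.
pose f : khom R (kres (g \o j) (kself W)) :=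
  @KHom K R (kres (g \o j) (kself W)) (g \o (io : {rmorphism R -> F}))
  (fun c => congr1 g (khomP io c)).
have [Phi PhiE] := iL (kself W) f.
pose z := \sum_k kstr RE (e k) * i (x k).
have Phiz : Phi z = 0.
  rewrite /z rmorph_sum; transitivity ((\sum_k e k * g (b k)) * g (io s)); last first.
    by rewrite eb mul0r.
  rewrite mulr_suml; apply: eq_bigr => k _; rewrite rmorphM khomP PhiE /=.
  by rewrite -mulrA -rmorphM xE.
have ix : indep x.
  move=> c cx; apply: ib; apply: (mulIf (io0 s s0)); rewrite mul0r mulr_suml.
  transitivity (io (\sum_k kstr R (c k) * x k) : F); last by rewrite cx rmorph0.
  rewrite rmorph_sum; apply: eq_bigr => k _.
  by rewrite rmorphM khomP -mulrA xE.
apply: (base_indep bi ix); apply: contrapT => z0.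
have [r [w [r0 rw]]] := base_norm dR dRE ae erefl z0.
have /eqP := congr1 Phi rw; rewrite rmorphM Phiz mul0r PhiE.
rewrite (_ : (f r == 0) = (g (io r) == 0)) // fmorph_eq0.
by apply/negP/io0.
Qed.

End Regular.

(** * Smooth algebras and separable generation *)

Definition formally_smooth_alg (K : fieldType) (R : kalg K) :=
  forall (B C : kalg K) (pi : khom B C), (forall c, exists b, pi b = c) ->
    (forall a b, pi a = 0 -> pi b = 0 -> a * b = 0) ->
    forall y : khom R C, exists z : khom R B, forall r, pi (z r) = y r.

Lemma spec_smooth_point (K : fieldType) (R A : kalg K) (x : spec R A) :
  formally_smooth_alg R -> smooth_point x.
Proof.
move=> fR; exists (fun _ _ => True); split=> // [B y|B C pi pis pi0 y _].
  exists [set 1]%classic => C f; split=> // _.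
  by apply: (@unit_ideal1 _ _ _ 1 1); rewrite ?mulr1 //; exists 1; rewrite ?rmorph1.
have [z zE] := fR B C pi pis pi0 y; exists z => //; exact: khom_eq.
Qed.

Lemma evp_taylor (R : idomainType) (A : comPzRingType) (f : {rmorphism R -> A})
  (x d : A) (p : {poly R}) :
  exists w, evp f (x + d) p = evp f x p + d * evp f x p^`() + d * d * w.
Proof.
elim/poly_ind: p => [|p c [w IH]].
  by exists 0; rewrite deriv0 !rmorph0 !mulr0 !addr0.
exists (evp f x p^`() + w * (x + d)).
rewrite derivD derivC addr0 derivM derivX mulr1.
rewrite !(rmorphD (evp f _)) !(rmorphM (evp f _)) !evpC !evpX IH.
ring.
Qed.

Lemma unit_lift (K : fieldType) (B C : kalg K) (pi : khom B C) x u :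
  (forall c, exists b, pi b = c) ->
  (forall a b, pi a = 0 -> pi b = 0 -> a * b = 0) ->
  pi x * u = 1 -> exists v, x * v = 1.
Proof.
move=> pis pi0 xu; have [v vu] := pis u.
have h : pi (x * v - 1) = 0 by rewrite rmorphB rmorphM vu xu rmorph1 subrr.
(* One Newton step: (x v - 1)^2 = 0 means that v (2 - x v) is an inverse of x. *)
have h2 := pi0 _ _ h h; exists (v * (1 + 1 - x * v)).
apply/eqP; rewrite -subr_eq0 -oppr_eq0; apply/eqP; rewrite -h2; ring.
Qed.

Section Good.
Context (K F : fieldType) (j : {rmorphism K -> F}).

Definition good (D : idomainType) (s : {rmorphism K -> D})
  (io : {rmorphism D -> F}) :=
  [/\ injective io, forall c, io (s c) = j c,
    exists n (a : 'I_n -> D), @generates K (KAlg s) n a &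
    formally_smooth_alg (KAlg s)].

(** D' is D[t, 1/h] inside F. The hypothesis reduces formal smoothness of D' to lifting t: once D is
    lifted by z0 and t by tb satisfying all relations of t over D, the assignment of q(tb) / h(tb)^N
    to q(t) / h^N is well defined. *)
Lemma good_step (D : idomainType) (s : {rmorphism K -> D})
  (io : {rmorphism D -> F}) (t : F) (hq : {poly D}) :
  good s io -> evp io t hq != 0 ->
  (forall (B C : kalg K) (pi : khom B C) (z0 : khom (KAlg s) B) (tc : C) u,
     (forall c, exists b, pi b = c) ->
     (forall a b, pi a = 0 -> pi b = 0 -> a * b = 0) ->
     (forall q, evp io t q = 0 -> evp (pi \o (z0 : {rmorphism D -> B})) tc q = 0) ->
     evp (pi \o (z0 : {rmorphism D -> B})) tc hq * u = 1 ->
     exists tb : B, pi tb = tc /\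
       forall q, evp io t q = 0 -> evp (z0 : {rmorphism D -> B}) tb q = 0) ->
  exists (D' : idomainType) (s' : {rmorphism K -> D'}) (io' : {rmorphism D' -> F}),
    [/\ good s' io', forall d, exists d', io' d' = io d & exists d', io' d' = t].
Proof.
move=> [ioinj ios [n [a ga]] fs]; set h := evp io t hq => h0 hlift.
pose S := [set x : F | exists q N, x * h ^+ N = evp io t q]%classic.
have SS : @is_subring K (fk j) S.
  split.
  - by move=> c; exists (s c)%:P, 0%N; rewrite evpC ios expr0 mulr1.
  - move=> x y [q [N xE]] [q' [N' yE]].
    exists (q * hq ^+ N' + q' * hq ^+ N), (N + N')%N.
    change ((x + y : F) * h ^+ (N + N') = evp io t (q * hq ^+ N' + q' * hq ^+ N)).
    by rewrite rmorphD !rmorphM !rmorphXn -/h -xE -yE exprD; ring.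
  - move=> x y [q [N xE]] [q' [N' yE]]; exists (q * q'), (N + N')%N.
    change ((x * y : F) * h ^+ (N + N') = evp io t (q * q')).
    by rewrite rmorphM -xE -yE exprD; ring.
have [R' [i [iinj iS]]] := subring_kalg SS.
have dR' : domain R'.
  split.
    apply/eqP => /(congr1 i) /eqP; rewrite rmorph1 rmorph0.
    by rewrite (_ : (1 : fk j) == 0 = false) //; apply: oner_eq0.
  move=> x y /(congr1 i) /eqP; rewrite rmorphM rmorph0.
  rewrite (_ : (i x * i y == 0) = ((i x : F) == 0) || ((i y : F) == 0)); last exact: mulf_eq0.
  by case/orP => /eqP e; [left|right]; apply: iinj; rewrite rmorph0.
have [D' [f [g [fK gK]]]] := dom_exists dR'.
pose s' : {rmorphism K -> D'} := f \o kstr R'.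
pose io' : {rmorphism D' -> F} := (i : {rmorphism R' -> F}) \o g.
have io'inj : injective io' by move=> x y /iinj /(congr1 f); rewrite !gK.
have io'S x : S x -> exists d', io' d' = x.
  by move=> /iS[r <-]; exists (f r); rewrite /io' /= fK.
have io'P d : exists q N, io' d * h ^+ N = evp io t q.
  by apply/iS; exists (g d).
have io's c : io' (s' c) = j c by rewrite /io' /s' /= fK khomP.
have /choice[inc incE] : forall d, exists d', io' d' = io d.
  by move=> d; apply: io'S; exists d%:P, 0%N; rewrite evpC mulr1.
have [t' t'E] : exists t', io' t' = t.
  by apply: io'S; exists 'X, 0%N; rewrite evpX mulr1.
have [h' h'E] : exists h', io' h' = h^-1.
  by apply: io'S; exists 1, 1%N; rewrite rmorph1 mulVf.
have incD : {morph inc : x y / x + y}.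
  by move=> x y; apply: io'inj; rewrite rmorphD !incE rmorphD.
have incM : {morph inc : x y / x * y}.
  by move=> x y; apply: io'inj; rewrite rmorphM !incE rmorphM.
have inc1 : inc 1 = 1 by apply: io'inj; rewrite incE !rmorph1.
pose incr : {rmorphism D -> D'} := mkrm inc1 incD incM.
have incEr d : io' (incr d) = io d := incE d.
have evinc q : io' (evp incr t' q) = evp io t q.
  by rewrite -t'E; apply: evp_comp => c; rewrite incEr.
exists D', s', io'; split; [split=> //| |].
- pose b (k : 'I_n.+2) : D' := scons t' (scons h' (fun k => incr (a k))) k.
  have b0 : b ord0 = t' by rewrite /b /scons; case: unliftP.
  have b1 : b (lift ord0 ord0) = h' by rewrite /b /scons liftK; case: unliftP.
  have b2 k : b (lift ord0 (lift ord0 k)) = incr (a k) by rewrite /b /scons !liftK.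
  exists n.+2, b => V VC Vb Vop.
  have Vop1 x y : V x -> V y -> V (x + y) by move=> Vx Vy; have [] := Vop x y Vx Vy.
  have Vop2 x y : V x -> V y -> V (x * y) by move=> Vx Vy; have [] := Vop x y Vx Vy.
  have Vinc d : V (incr d).
    move: d; apply: (ga (fun d => V (incr d))) => [c|k|x y Vx Vy].
    - by rewrite (_ : incr _ = s' c) //; apply: io'inj; rewrite incEr io's ios.
    - by rewrite -b2.
    - by rewrite rmorphD rmorphM; split; [apply: (Vop1)|apply: (Vop2)].
  have Vq q : V (evp incr t' q).
    elim/poly_ind: q => [|q c Vq]; first by rewrite rmorph0 -(rmorph0 s'); apply: VC.
    rewrite rmorphD rmorphM evpX evpC; apply: (Vop1) (Vinc c); apply: (Vop2) => //.
    by rewrite -b0.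
  move=> x; have [q [N xE]] := io'P x.
  have -> : x = evp incr t' q * h' ^+ N.
    apply: io'inj; rewrite rmorphM rmorphXn evinc h'E -xE -mulrA -exprMn mulfV //.
    by rewrite expr1n mulr1.
  apply: (Vop2) => //; elim: N {xE} => [|N IH].
    by rewrite expr0 -(rmorph1 s'); apply: VC.
  by rewrite exprS; apply: (Vop2) => //; rewrite -b1.
- move=> B C pi pis pi0 y.
  pose y' : {rmorphism D' -> C} := y.
  have yc c : y' (incr (s c)) = kstr C c.
    rewrite -(khomP y c); congr (y _); apply: io'inj.
    by rewrite incEr io's ios.
  pose y0 : khom (KAlg s) C := @KHom K (KAlg s) C (y' \o incr) yc.
  have [z0 z0E] := fs B C pi pis pi0 y0.
  pose zr : {rmorphism D -> B} := z0.
  have evy q : evp (pi \o zr) (y' t') q = y' (evp incr t' q).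
    by apply/esym/evp_comp => c; apply: z0E.
  have yh : y' (evp incr t' hq) * y' h' = 1.
    rewrite -rmorphM -(rmorph1 y'); congr (y' _); apply: io'inj.
    by rewrite rmorphM evinc h'E rmorph1 mulfV.
  have [||tb [pitb tbP]] := hlift B C pi z0 (y' t') (y' h') pis pi0.
    move=> q q0; rewrite evy (_ : evp incr t' q = 0) ?rmorph0 //.
    by apply: io'inj; rewrite evinc q0 rmorph0.
    by rewrite evy yh.
  have pie q : pi (evp zr tb q) = y' (evp incr t' q).
    by rewrite -evy -pitb; apply: evp_comp.
  have [|v hv] := @unit_lift K B C pi (evp zr tb hq) (y' h') pis pi0.
    by rewrite pie yh.
  have hvn N : evp zr tb hq ^+ N * v ^+ N = 1 by rewrite -exprMn hv expr1n.
  pose Rl (x : D') (b : B) := exists q N,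
    io' x * h ^+ N = evp io t q /\ b = evp zr tb q * v ^+ N.
  have Rlf x b b' : Rl x b -> Rl x b' -> b = b'.
    move=> [q [N [e ->]]] [q' [N' [e' ->]]].
    have : evp zr tb (q * hq ^+ N' - q' * hq ^+ N) = 0.
      by apply: tbP; rewrite rmorphB !rmorphM !rmorphXn -/h -e -e'; ring.
    rewrite rmorphB !rmorphM !rmorphXn => /eqP; rewrite subr_eq0 => /eqP E.
    rewrite -[LHS]mulr1 -(hvn N') -[RHS]mulr1 -(hvn N).
    transitivity (evp zr tb q * evp zr tb hq ^+ N' * (v ^+ N * v ^+ N')); first by ring.
    by rewrite E; ring.
  have RlD x b x' b' : Rl x b -> Rl x' b' -> Rl (x + x') (b + b').
    move=> [q [N [e ->]]] [q' [N' [e' ->]]].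
    exists (q * hq ^+ N' + q' * hq ^+ N), (N + N')%N; split.
      by rewrite !rmorphD !rmorphM !rmorphXn -/h -e -e' exprD; ring.
    rewrite rmorphD !rmorphM !rmorphXn exprD.
    rewrite -[evp zr tb q * _]mulr1 -(hvn N') -[evp zr tb q' * _]mulr1 -{1}(hvn N).
    by ring.
  have RlM x b x' b' : Rl x b -> Rl x' b' -> Rl (x * x') (b * b').
    move=> [q [N [e ->]]] [q' [N' [e' ->]]]; exists (q * q'), (N + N')%N.
    by rewrite !rmorphM -e -e' !exprD; split; ring.
  have /choice[z zR] : forall x, exists b, Rl x b.
    move=> x; have [q [N xE]] := io'P x; exists (evp zr tb q * v ^+ N).
    by exists q, N.
  have zD : {morph z : x y / x + y}.
    by move=> x x'; apply: Rlf (zR _) (RlD _ _ _ _ _ _).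
  have zM : {morph z : x y / x * y}.
    by move=> x x'; apply: Rlf (zR _) (RlM _ _ _ _ _ _).
  have z1 : z 1 = 1.
    by apply: Rlf (zR _) _; exists 1, 0%N; rewrite !rmorph1 !mulr1.
  have zc c : mkrm z1 zD zM (s' c) = kstr B c.
    apply: Rlf (zR _) _; exists (s c)%:P, 0%N; rewrite !evpC io's ios !mulr1.
    by split=> //; rewrite -(khomP z0).
  exists (@KHom K (KAlg s') B (mkrm z1 zD zM) zc) => x.
  change (pi (z x) = y' x); have [q [N [e ->]]] := zR x.
  rewrite rmorphM rmorphXn pie.
  have piv : y' (evp incr t' hq) * pi v = 1 by rewrite -pie -rmorphM hv rmorph1.
  have pivN : y' (evp incr t' hq) ^+ N * pi v ^+ N = 1 by rewrite -exprMn piv expr1n.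
  have -> : evp incr t' q = x * evp incr t' hq ^+ N.
    by apply: io'inj; rewrite rmorphM rmorphXn !evinc -e.
  by rewrite rmorphM rmorphXn -mulrA pivN mulr1.
- by move=> d; exists (incr d).
- by exists t'.
Qed.

(** Two elements are inverted: the leading coefficient of the minimal polynomial m, so that the
    relations of t become multiples of m, and the derivative of m at t, so that a root of m lifts
    along a square-zero ideal by the Newton step t0 - m(t0) / m'(t0). *)
Lemma good_sep (D : idomainType) (s : {rmorphism K -> D})
  (io : {rmorphism D -> F}) (t : F) (q : {poly D}) :
  good s io -> evp io t q = 0 -> evp io t q^`() != 0 ->
  exists (D' : idomainType) (s' : {rmorphism K -> D'}) (io' : {rmorphism D' -> F}),
    [/\ good s' io', forall d, exists d', io' d' = io d & exists d', io' d' = t].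
Proof.
move=> gD qt q't; have [ioinj ios _ _] := gD.
have io0 x : (io x == 0) = (x == 0) by rewrite -(inj_eq ioinj) rmorph0.
have [i0 qi0] : exists i, io q`_i != 0.
  exists (size q).-1; rewrite io0 -/(lead_coef q) lead_coef_eq0.
  by apply: contraNneq q't => ->; rewrite deriv0 rmorph0.
have [m [Em lm sm mmin]] := min_poly qt qi0.
have div p : evp io t p = 0 -> exists N A, lead_coef m ^+ N *: p = A * m.
  move=> /(min_div Em sm mmin)[N [A [r [pE r0]]]]; exists N, A.
  rewrite pE (_ : r = 0) ?addr0 //; apply/polyP => i; rewrite coef0.
  by apply/eqP; rewrite -io0 r0.
have m't : evp io t m^`() != 0.
  (* A power of the leading coefficient times q is A m; differentiating at t, the term with m(t)
     drops out, so m'(t) = 0 would force q'(t) = 0. *)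
  have [N [A /(congr1 (fun p => evp io t p^`()))]] := div q qt.
  rewrite derivZ derivM rmorphD !rmorphM Em mulr0 add0r -mul_polyC rmorphM evpC rmorphXn.
  move=> e; apply/eqP => m0; move: e; rewrite m0 mulr0 => /eqP.
  by rewrite mulf_eq0 (negPf q't) orbF expf_eq0 (negPf lm) andbF.
apply: (good_step (t := t) (hq := (lead_coef m)%:P * m^`()) gD).
  by rewrite rmorphM evpC mulf_neq0.
move=> B C pi z0 tc u pis pi0 rel.
set zr : {rmorphism D -> B} := z0; rewrite rmorphM evpC /= => hu.
have [t0 t0E] := pis tc.
have pie p : pi (evp zr t0 p) = evp (pi \o zr) tc p.
  by rewrite -t0E; apply: evp_comp.
pose f0 := evp zr t0 m; pose f1 := evp zr t0 m^`().
have pif0 : pi f0 = 0 by rewrite pie rel.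
have [|v hv] := @unit_lift K B C pi f1 (pi (zr (lead_coef m)) * u) pis pi0.
  by rewrite pie mulrA [_ * pi _]mulrC.
have [|lv hlv] := @unit_lift K B C pi (zr (lead_coef m)) (evp (pi \o zr) tc m^`() * u) pis pi0.
  by rewrite mulrA.
exists (t0 + - (f0 * v)); split.
  by rewrite rmorphD rmorphN rmorphM pif0 mul0r oppr0 addr0.
have mz : evp zr (t0 + - (f0 * v)) m = 0.
  have [w ->] := evp_taylor zr t0 (- (f0 * v)) m.
  rewrite -/f0 -/f1.
  have -> : f0 + - (f0 * v) * f1 + - (f0 * v) * - (f0 * v) * w =
    f0 * (1 - f1 * v) + (f0 * f0) * (v * v * w) by ring.
  by rewrite hv subrr mulr0 (pi0 _ _ pif0 pif0) mul0r addr0.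
move=> p /div[N [A /(congr1 (evp zr (t0 + - (f0 * v))))]].
rewrite -mul_polyC !rmorphM mz mulr0 evpC rmorphXn => e.
by rewrite -[LHS]mul1r -(expr1n _ N) -hlv exprMn mulrAC e mul0r.
Qed.

End Good.

(** * Separable elements and MacLane's criterion *)

Section Separable.
Context (K F : fieldType) (j : {rmorphism K -> F}).

Definition is_subfield (S : set F) := [/\ forall c, S (j c),
  forall x y, S x -> S y -> S (x + y), forall x y, S x -> S y -> S (x * y) &
  forall x, S x -> S x^-1].

Definition fgen (A : set F) : set F :=
  [set x | forall S, is_subfield S -> (A `<=` S)%classic -> S x]%classic.

(** Being a simple root of some polynomial over S: for a subfield S this is separable algebraicity,
    without reference to minimal polynomials. *)
Definition sep_over (S : set F) (x : F) := exists q : {poly F},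
  [/\ forall i, S q`_i, q.[x] = 0 & q^`().[x] != 0].

Definition alg_over (S : set F) (x : F) := exists q : {poly F},
  [/\ forall i, S q`_i, q != 0 & q.[x] = 0].

Lemma fgen_subfield A : is_subfield (fgen A).
Proof.
split=> [c|x y Ax Ay|x y Ax Ay|x Ax] S SS AS.
- by case: SS.
- by case: (SS) => _ SD _ _; apply: SD; [apply: Ax|apply: Ay].
- by case: (SS) => _ _ SM _; apply: SM; [apply: Ax|apply: Ay].
- by case: (SS) => _ _ _ SV; apply: SV; apply: Ax.
Qed.

Lemma sub_fgen A x : A x -> fgen A x.
Proof. by move=> Ax S _; apply. Qed.

Lemma fgen_min A S : is_subfield S -> (A `<=` S)%classic -> (fgen A `<=` S)%classic.
Proof. by move=> SS AS x; apply. Qed.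

Lemma fgen_mono A B : (A `<=` fgen B)%classic -> (fgen A `<=` fgen B)%classic.
Proof. by apply: fgen_min; apply: fgen_subfield. Qed.

Lemma sep_mono (S S' : set F) x : (S `<=` S')%classic -> sep_over S x -> sep_over S' x.
Proof. by move=> SS' [q [qS q0 q1]]; exists q; split=> // i; apply: SS'. Qed.

Section SubfieldOps.
Context (S : set F) (SS : is_subfield S).

Lemma subfield0 : S 0. Proof. by case: SS => SC _ _ _; rewrite -(rmorph0 j). Qed.
Lemma subfield1 : S 1. Proof. by case: SS => SC _ _ _; rewrite -(rmorph1 j). Qed.

Lemma subfield_sum (I : Type) (r : seq I) (P : pred I) (G : I -> F) :
  (forall i, P i -> S (G i)) -> S (\sum_(i <- r | P i) G i).
Proof.
case: SS => _ SD _ _ h; apply: (big_ind S) => //; exact: subfield0.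
Qed.

Lemma subfield_prod (I : Type) (r : seq I) (P : pred I) (G : I -> F) :
  (forall i, P i -> S (G i)) -> S (\prod_(i <- r | P i) G i).
Proof.
case: SS => _ _ SM _ h; apply: (big_ind S) => //; exact: subfield1.
Qed.

Lemma subfield_exp x n : S x -> S (x ^+ n).
Proof.
move=> Sx; elim: n => [|n IH]; first exact: subfield1.
by rewrite exprS; case: SS => _ _ SM _; apply: SM.
Qed.

End SubfieldOps.

Section MacLane.
Context (n : nat) (v : 'I_n -> F).

Let others (i : 'I_n) := [set x | exists2 l, l != i & x = v l]%classic.
Let evm (f : {mpoly K[n]}) : F := mmap j v f.

Let evmZX c m : evm (c *: 'X_[m]) = j c * \prod_l v l ^+ m l.
Proof. by rewrite /evm -mul_mpolyC rmorphM /= mmapC mmapX. Qed.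

Lemma deriv_sep i f : evm f = 0 -> evm (mderiv i f) != 0 ->
  sep_over (fgen (others i)) (v i).
Proof.
move=> f0 df; have SS := fgen_subfield (others i).
pose C (m : 'X_{1..n}) := j f@_m * \prod_(l | l != i) v l ^+ m l.
have SC m : fgen (others i) (C m).
  have [Sj _ SM _] := SS; apply: SM; first exact: Sj.
  apply: (subfield_prod SS) => l li; apply: (subfield_exp SS); apply: sub_fgen.
  by exists l.
exists (\sum_(m <- msupp f) C m *: 'X^(m i)); split.
- move=> k; rewrite coef_sum; apply: (subfield_sum SS) => m _.
  rewrite coefZ coefXn; have [_ _ SM _] := SS; apply: SM => //.
  by case: eqP => _; [exact: (subfield1 SS)|exact: (subfield0 SS)].
- rewrite horner_sum -[RHS]f0; apply: eq_bigr => m _.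
  rewrite hornerZ hornerXn /mmap1 [X in _ = _ * X](bigD1 i) //= /C -mulrA.
  congr (_ * _).
  exact: mulrC.
- apply: contraNneq df => <-; apply/eqP.
  rewrite /evm /mderiv (raddf_sum (mmap j v)) (raddf_sum deriv) horner_sum.
  apply: eq_bigr => m _ /=; rewrite [LHS]evmZX derivZ derivXn hornerZ hornerMn hornerXn.
  rewrite (bigD1 i) //= mnmBE mnm1E eqxx subn1 rmorphM rmorph_nat /C.
  rewrite (eq_bigr (fun l => v l ^+ m l)) => [|l li]; last first.
    by rewrite mnmBE mnm1E eq_sym (negPf li) subn0.
  by rewrite -[_ *+ m i]mulr_natl; ring.
Qed.

(** By descent on the degree of f. A partial derivative not vanishing at v gives separability at
    once, and a nonzero one vanishing at v is a smaller relation. If all are zero, the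
    characteristic is some p and f is a polynomial in p-th powers; its p-th root is a relation with
    coefficients algebraic over K, which regularity replaces by one over K. *)
Lemma maclane f : regular j -> f != 0 -> evm f = 0 ->
  exists i, sep_over (fgen (others i)) (v i).
Proof.
move=> rj; have [d] := ubnP (msize f); elim: d f => // d IH f fd f0 ef.
have [[i di]|nd] := pselect (exists i, evm (mderiv i f) != 0).
  by exists i; apply: deriv_sep di.
have {}nd i : evm (mderiv i f) = 0.
  by apply: contrapT => /eqP h; apply: nd; exists i.
have coefd i m : m \in msupp f -> (0 < m i)%N ->
    (mderiv i f)@_(m - U_(i)) = f@_m *+ m i.
  move=> mf mi; rewrite mcoeff_deriv submK.
    by rewrite mnmBE mnm1E eqxx subn1 prednK.
  by apply/mnm_lepP => l; rewrite mnm1E; case: eqP => // <-.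
have [[i di]|nz] := pselect (exists i, mderiv i f != 0).
  apply: (IH (mderiv i f)) => //; apply: leq_trans (_ : msize f <= d)%N => //.
  rewrite msizeE big_seq; apply: (big_ind (fun k => (k < msize f)%N)).
  - rewrite lt0n; apply: contra_neq f0 => /eqP.
    by rewrite mmeasure_poly_eq0 => /eqP.
  - by move=> a b ha hb; rewrite gtn_max ha.
  - move=> m; rewrite mcoeff_msupp mcoeff_deriv => h.
    have : (m + U_(i))%MM \in msupp f.
      by rewrite mcoeff_msupp; apply: contraNneq h => ->; rewrite mul0rn.
    by move=> /msize_mdeg_lt; rewrite mdegD mdeg1 addn1.
have {}nz i m : m \in msupp f -> (0 < m i)%N -> (m i)%:R = 0 :> K.
  move=> mf mi; have := coefd i m mf mi.
  have -> : mderiv i f = 0 by apply: contrapT => /eqP h; apply: nz; exists i.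
  rewrite mcoeff0 => /esym/eqP; rewrite -[_ *+ m i]mulr_natr mulf_eq0.
  by move: mf; rewrite mcoeff_msupp => /negPf -> /eqP.
have [[m0 m0f [i0 mi0]]|const] := pselect (exists2 m, m \in msupp f &
    exists i, (0 < m i)%N); last first.
  exfalso; have fC : f = (f@_0)%:MP.
    apply: msize1_polyC; rewrite msizeE big_seq.
    apply: (big_ind (fun k => (k <= 1)%N)) => // [a b ha hb|m mf].
      by rewrite geq_max ha.
    suff -> : m = 0%MM by rewrite mdeg0.
    apply/mnmP => i; rewrite mnm0E; apply/eqP; rewrite -leqn0 leqNgt; apply/negP => mi.
    by apply: const; exists m => //; exists i.
  move: ef f0; rewrite fC /evm mmapC => /eqP; rewrite fmorph_eq0 => /eqP ->.
  by rewrite mpolyC0 eqxx.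
have [p pK] := natf0_pchar mi0 (introT eqP (nz _ _ m0f mi0)).
have pp := pcharf_prime pK.
have pdvd m i : m \in msupp f -> (p %| m i)%N.
  move=> mf; have [->//|] := posnP (m i) => mi.
  by rewrite (dvdn_pcharf pK); apply/eqP/nz.
have [W [g cW]] := alg_closed_ext F.
have pW : p \in [pchar W] by rewrite (fmorph_pchar g) (fmorph_pchar j).
pose nu (m : 'X_{1..n}) : 'X_{1..n} := [multinom (m i %/ p)%N | i < n].
(* The p-th roots of the coefficients of f. They lie in W, are algebraic over K, and by injectivity
   of Frobenius give a relation between the monomials w m. *)
have /choice[gam gamE] : forall m : 'X_{1..n}, exists c : W, c ^+ p = g (j f@_m).
  move=> m; have [|c] := @closed_root W ('X^p - (g (j f@_m))%:P) cW.
    by rewrite size_XnsubC ?prime_gt0 // ltnS prime_gt0.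
  by rewrite /root !hornerE subr_eq0 => /eqP; exists c.
pose w m := \prod_l v l ^+ nu m l.
have wE m : m \in msupp f -> w m ^+ p = \prod_l v l ^+ m l.
  move=> mf; rewrite -prodrXl; apply: eq_bigr => l _.
  by rewrite -exprM /nu mnmE divnK // pdvd.
have sum0 : \sum_(m <- msupp f) gam m * g (w m) = 0.
  have e : (\sum_(m <- msupp f) gam m * g (w m)) ^+ p = 0.
    rewrite -(pFrobenius_autE pW) raddf_sum.
    transitivity (g (evm f)); last by rewrite ef rmorph0.
    rewrite /evm /mmap rmorph_sum.
    rewrite big_seq [RHS]big_seq.
    apply: eq_bigr => m mf.
    by rewrite /= pFrobenius_autE exprMn gamE -rmorphXn wE // -rmorphM.
  by apply/eqP; move/eqP: e; rewrite expf_eq0 => /andP[].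
pose s := in_tuple (msupp f).
have gk0 m : m \in msupp f -> gam m <> 0.
  move=> mf g0; have := gamE m; rewrite g0 expr0n gtn_eqF ?prime_gt0 //= => /esym/eqP.
  by rewrite !fmorph_eq0; move: mf; rewrite mcoeff_msupp => /negPf ->.
(* Were the w m independent over K, regularity would force all the algebraic coefficients gam m to
   vanish. So they satisfy a relation over K. *)
have [c [cs [k ck]]] : exists c : 'I_(size (msupp f)) -> K,
    \sum_k j (c k) * w (tnth s k) = 0 /\ exists k, c k != 0.
  apply: contrapT => nc.
  have ind c : \sum_k j (c k) * w (tnth s k) = 0 -> forall k, c k = 0.
    move=> cs k; apply: contrapT => /eqP ck; apply: nc; exists c; split=> //.
    by exists k.
  have /tnthP[k0 _] : m0 \in s by [].
  apply: (gk0 (tnth s k0)); first exact: mem_tnth.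
  apply: (rj W g cW _ (fun k => w (tnth s k)) ind (fun k => gam (tnth s k))).
    move=> k; exists ('X^p - (f@_(tnth s k))%:P).
      by rewrite -size_poly_eq0 size_XnsubC ?prime_gt0.
    rewrite rmorphB /= map_polyXn map_polyC /root !hornerE gamE subr_eq0.
    by [].
  by rewrite -[RHS]sum0 [RHS]big_tnth.
pose f' : {mpoly K[n]} := \sum_k c k *: 'X_[nu (tnth s k)].
have nuinj m m' : m \in msupp f -> m' \in msupp f -> nu m = nu m' -> m = m'.
  move=> mf mf' /mnmP e; apply/mnmP => i; have := e i; rewrite !mnmE => h.
  by rewrite -(divnK (pdvd m i mf)) -(divnK (pdvd m' i mf')) h.
have sE k1 k2 : (nu (tnth s k1) == nu (tnth s k2)) = (k1 == k2).
  apply/eqP/eqP => [/nuinj h|-> //]; have {}h := h (mem_tnth _ _) (mem_tnth _ _).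
  apply/val_inj => /=; move: h; rewrite !(tnth_nth 0%MM) => /eqP.
  by rewrite nth_uniq ?msupp_uniq // => /eqP.
apply: (IH f').
- pose dd := (msize f).-1.
  have sf : msize f = dd.+1.
    by rewrite /dd prednK // (leq_ltn_trans _ (msize_mdeg_lt m0f)).
  have mdnu m : m \in msupp f -> (mdeg (nu m) * p = mdeg m)%N.
    move=> mf; rewrite !mdegE big_distrl; apply: eq_bigr => i _.
    by rewrite /= /nu mnmE divnK // pdvd.
  have dd0 : (0 < dd)%N.
    have := msize_mdeg_lt m0f; rewrite sf ltnS; apply: leq_trans.
    by rewrite mdegE (bigD1 i0) //= addn_gt0 mi0.
  (* The degree of m is p times that of nu m and is at most dd > 0, with p at least 2. *)
  have lt m : m \in msupp f -> (mdeg (nu m) < dd)%N.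
    move=> mf; have := msize_mdeg_lt mf; rewrite sf ltnS -mdnu // => h.
    rewrite ltnNge; apply/negP => h'.
    have := leq_trans (leq_mul h' (prime_gt1 pp)) h.
    by rewrite leqNgt muln2 -addnn -{1}[dd]addn0 ltn_add2l dd0.
  rewrite ltnS in fd; apply: leq_trans fd; rewrite sf ltnS.
  rewrite msizeE big_seq; apply: (big_ind (fun k => (k <= dd)%N)) => // [a b ha hb|m].
    by rewrite geq_max ha.
  rewrite mcoeff_msupp /f' raddf_sum /= => h.
  have [k1 mk1] : exists k1, nu (tnth s k1) = m.
    apply: contrapT => nk; move/eqP: h; apply; rewrite big1 // => k1 _.
    rewrite mcoeffZ mcoeffX; case: eqP => [e|]; last by rewrite mulr0.
    by case: nk; exists k1.
  by rewrite -mk1; apply: lt; apply: mem_tnth.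
- apply: contra_neq ck => /(congr1 (mcoeff (nu (tnth s k)))).
  rewrite /f' raddf_sum mcoeff0 (bigD1 k) //= mcoeffZ mcoeffX eqxx mulr1.
  rewrite big1 ?addr0 // => k1 k1k; rewrite mcoeffZ mcoeffX sE (negPf k1k).
  by rewrite mulr0.
- rewrite /evm /f' (raddf_sum (mmap j v)) -[RHS]cs; apply: eq_bigr => k1 _.
  exact: evmZX.
Qed.

End MacLane.
End Separable.

(** * Separating transcendence bases and smooth models of finitely generated subfields *)

Section Towers.
Context (K F : fieldType) (j : {rmorphism K -> F}).
Local Notation is_subfield := (is_subfield j).
Local Notation fgen := (fgen j).

Lemma subfield_field S : is_subfield S -> exists (k : fieldType)
  (g : {rmorphism k -> F}), forall x, S x <-> exists y, g y = x.
Proof.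
move=> SS; have [SC SD SM SV] := SS.
have [B [i [iinj iS]]] := @subring_kalg K (fk j) S (And3 SC SD SM).
have fB : is_field B.
  split; first by apply/eqP => /(congr1 i) /eqP; rewrite rmorph1 rmorph0 oner_eq0.
  move=> x x0; have /SV/iS[y yE] : S (i x) by apply/iS; exists x.
  exists y; have ix0 : (i x : F) != 0.
    by apply: contra_neq x0 => e; apply: iinj; rewrite rmorph0.
  apply: iinj; rewrite rmorphM yE rmorph1; exact: mulfV.
by exists (fld_of fB), ((i : {rmorphism B -> F}) \o fld_out (fA := fB)).
Qed.

Lemma map_poly_preim (A : nzRingType) (g : {rmorphism A -> F}) (q : {poly F}) :
  (forall i, exists y, g y = q`_i) -> exists p, map_poly g p = q.
Proof.
move=> /choice[y yE]; exists (\poly_(i < size q) y i); apply/polyP => i.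
rewrite coef_map coef_poly; case: ltnP => h; first exact: yE.
by rewrite raddf0 nth_default.
Qed.

Lemma alg_overE S (k : fieldType) (g : {rmorphism k -> F}) x :
  (forall x, S x <-> exists y, g y = x) -> alg_over S x <-> algebraicOver g x.
Proof.
move=> SE; split=> [[q [qS q0 qx]]|[p p0 px]].
  have [p pE] := map_poly_preim (fun i => (SE _).1 (qS i)).
  exists p; last by rewrite pE; apply/rootP.
  by apply: contra_neq q0 => p0; rewrite -pE p0 map_poly0.
exists (map_poly g p); split; last exact/rootP.
  by move=> i; rewrite coef_map; apply/SE; exists p`_i.
by rewrite map_poly_eq0.
Qed.

Lemma alg_subfield S : is_subfield S -> is_subfield [set x | alg_over S x]%classic.
Proof.
move=> SS; have [SC _ _ _] := SS; have [k [g gS]] := subfield_field SS.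
split=> [c|x y /(alg_overE _ gS) ax /(alg_overE _ gS) ay|x y /(alg_overE _ gS) ax /(alg_overE _ gS) ay|x /(alg_overE _ gS) ax]; apply/(alg_overE _ gS).
- by have /gS[y <-] := SC c; apply: algebraic_id.
- exact: algebraic_add.
- exact: algebraic_mul.
- exact: algebraic_inv.
Qed.

Lemma alg_self (S : set F) x : S 0 -> S 1 -> S x -> is_subfield S -> alg_over S x.
Proof.
move=> _ _ Sx SS; have [k [g gS]] := subfield_field SS; apply/(alg_overE _ gS).
by have /gS[y <-] := Sx; apply: algebraic_id.
Qed.

Lemma alg_trans S t : is_subfield S -> alg_over [set x | alg_over S x]%classic t ->
  alg_over S t.
Proof.
move=> SS [q [qS q0 qt]]; have [k [g gS]] := subfield_field SS.
apply/(alg_overE _ gS)/integral_algebraic.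
apply: (integral_root q0 (introT rootP qt)); apply/integral_poly => i.
exact/integral_algebraic/(alg_overE _ gS)/qS.
Qed.

Definition frac_set (D : nzRingType) (io : D -> F) : set F :=
  [set x | exists p r, io r != 0 /\ x * io r = io p]%classic.

Lemma frac_subfield (D : comNzRingType) (s : {rmorphism K -> D})
  (io : {rmorphism D -> F}) : (forall c, io (s c) = j c) ->
  is_subfield (frac_set io).
Proof.
move=> ios; split.
- by move=> c; exists (s c), 1; rewrite rmorph1 oner_neq0 ios mulr1.
- move=> x y [p [r [r0 xE]]] [p' [r' [r'0 yE]]].
  exists (p * r' + p' * r), (r * r'); rewrite !(rmorphD, rmorphM) -xE -yE.
  by split; [rewrite mulf_neq0|ring].
- move=> x y [p [r [r0 xE]]] [p' [r' [r'0 yE]]].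
  exists (p * p'), (r * r'); rewrite !rmorphM -xE -yE.
  by split; [rewrite mulf_neq0|ring].
- move=> x [p [r [r0 xE]]]; have [->|x0] := eqVneq x 0.
    by exists 0, 1; rewrite rmorph1 rmorph0 oner_neq0 invr0 mul0r.
  by exists r, p; rewrite -xE mulf_neq0 // mulKf.
Qed.

Lemma clear_denoms (D : comNzRingType) (io : {rmorphism D -> F}) (q : {poly F}) :
  (forall i, frac_set io q`_i) ->
  exists d f, io d != 0 /\ map_poly io f = io d *: q.
Proof.
move=> /choice[p /choice[r prE]].
pose d := \prod_(i < size q) r i.
have d0 : io d != 0.
  by rewrite rmorph_prod; apply/prodf_neq0 => i _; have [] := prE i.
exists d; have [f fE] : exists f, map_poly io f = io d *: q; last by exists f.
apply: (map_poly_preim (g := io)) => i; rewrite coefZ.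
have [h|h] := ltnP i (size q); last by exists 0; rewrite rmorph0 nth_default ?mulr0.
exists (p i * \prod_(k < size q | k != Ordinal h) r k).
have -> : d = r i * \prod_(k < size q | k != Ordinal h) r k.
  by rewrite /d (bigD1 (Ordinal h)).
by have [_ e] := prE i; rewrite !(rmorphM io) -e; ring.
Qed.

Definition indep_pol n (T : 'I_n -> F) :=
  forall f : itpoly K n, ev j T f = 0 -> f = 0.

Lemma scons0 (A : Type) n (x : A) (v : 'I_n -> A) : scons x v ord0 = x.
Proof. by rewrite /scons; case: unliftP. Qed.

Lemma scons_lift (A : Type) n (x : A) (v : 'I_n -> A) k :
  scons x v (lift ord0 k) = v k.
Proof. by rewrite /scons liftK. Qed.

Lemma ev_scons n (T : 'I_n -> F) x (f : {poly itpoly K n}) :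
  ev j (scons x T) (f : itpoly K n.+1) = (map_poly (ev j T) f).[x].
Proof.
rewrite /= evp_horner scons0; congr (_.[_]); apply: eq_map_poly => c.
by apply: ev_ext => k /=; rewrite scons_lift.
Qed.

Lemma ev_fgen n (T : 'I_n -> F) f : fgen (range T) (ev j T f).
Proof.
have [SC SD SM _] := fgen_subfield j (range T).
elim/itpoly_ind: f => [c|k|x y Sx Sy|x y Sx Sy].
- by rewrite ev_itC; apply: SC.
- by rewrite ev_itX; apply: sub_fgen; exists k.
- by rewrite rmorphD; apply: SD.
- by rewrite rmorphM; apply: SM.
Qed.

Lemma fgen_frac n (T : 'I_n -> F) : (fgen (range T) `<=` frac_set (ev j T))%classic.
Proof.
apply: fgen_min; first by apply: (frac_subfield (s := itC K n)) => c; apply: ev_itC.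
by move=> _ [k _ <-]; exists (itX K k), 1; rewrite rmorph1 oner_neq0 ev_itX mulr1.
Qed.

Lemma alg_relation n (T : 'I_n -> F) x : alg_over (fgen (range T)) x ->
  exists f : itpoly K n.+1, f != 0 /\ ev j (scons x T) f = 0.
Proof.
move=> [q [qS q0 qx]]; have [|d [f [d0 fE]]] := @clear_denoms _ (ev j T) q.
  by move=> i; apply: fgen_frac.
exists f; split; last by rewrite ev_scons fE hornerZ qx mulr0.
apply: contra_neq q0 => f0; move: fE; rewrite f0 map_poly0 => /esym/eqP.
by rewrite scaler_eq0 (negPf d0) => /eqP.
Qed.

Lemma indep_scons n (T : 'I_n -> F) x : indep_pol T ->
  ~ alg_over (fgen (range T)) x -> indep_pol (scons x T).
Proof.
move=> iT nx f; rewrite ev_scons => fx; apply/polyP => i; rewrite coef0.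
apply: iT; apply: contrapT => /eqP fi; apply: nx.
exists (map_poly (ev j T) f); split=> //.
  by move=> k; rewrite coef_map; apply: ev_fgen.
apply/eqP => h; move/eqP: fi; apply.
by have := congr1 (coefp i) h; rewrite /= coef_map coef0.
Qed.

Lemma indep_sconsE n (T : 'I_n -> F) x : indep_pol (scons x T) ->
  indep_pol T /\ ~ alg_over (fgen (range T)) x.
Proof.
move=> iT; split.
  move=> f f0; have := iT (f%:P : {poly itpoly K n}).
  rewrite ev_scons map_polyC hornerC /= f0 => /(_ erefl) /eqP.
  by rewrite polyC_eq0 => /eqP.
by move=> /alg_relation[f [/eqP f0 /iT]].
Qed.

Lemma indep_perm n (T : 'I_n -> F) (s : 'I_n -> 'I_n) : injective s ->
  indep_pol T -> indep_pol (T \o s).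
Proof.
move=> sinj iT f fT; have [r sK rK] := injF_bij sinj.
pose f' := ev (itC K n) (fun k => itX K (s k)) f.
have f'0 : f' = 0.
  apply: iT; rewrite -fT; apply: ev_comp => [c|k]; first by rewrite ev_itC.
  by rewrite ev_itX.
rewrite -(ev_univ f).
have -> : ev (itC K n) (itX K (n:=n)) f = ev (itC K n) (fun k => itX K (r k)) f'.
  apply/esym/ev_comp => [c|k]; first by rewrite ev_itC.
  by rewrite ev_itX sK.
by rewrite f'0 rmorph0.
Qed.

Lemma indep_lift n (T : 'I_n.+1 -> F) i : indep_pol T ->
  indep_pol (scons (T i) (T \o lift i)).
Proof.
move=> iT; have -> : scons (T i) (T \o lift i) = T \o scons i (lift i).
  apply/funext => k; rewrite /= /scons; by case: unlift.
apply: indep_perm => // k l; rewrite /scons.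
case: unliftP => [k' ->|->]; case: unliftP => [l' ->|->] //.
- by move=> /lift_inj ->.
- by move=> /eqP; rewrite eq_sym (negPf (neq_lift _ _)).
- by move=> /eqP; rewrite (negPf (neq_lift _ _)).
Qed.

Lemma it_maclane n (v : 'I_n -> F) (f : itpoly K n) : regular j -> f != 0 ->
  ev j v f = 0 ->
  exists i, sep_over (fgen [set x | exists2 l, l != i & x = v l]%classic) (v i).
Proof.
move=> rj f0 fv.
pose phi := ev (@mpolyC n K : {rmorphism K -> {mpoly K[n]}}) (fun i => 'X_i).
apply: (@maclane _ _ j n v (phi f) rj); last first.
  rewrite -fv; apply: (ev_comp (g := mmap j v)) => [c|k].
    by rewrite /= mmapC.
  by rewrite /= mmapX mmap1U.
apply: contra_neq f0 => pf.
have -> : f = mmap (itC K n) (itX K (n:=n)) (phi f).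
  rewrite -{1}(ev_univ f); apply/esym/(ev_comp (g := mmap (itC K n) (itX K (n:=n)))).
    by move=> c; rewrite /= mmapC.
  by move=> k; rewrite /= mmapX mmap1U.
by rewrite pf raddf0.
Qed.

(** Read from the end: each element is separable over A and the elements that follow it, so the last
    one is the bottom of the tower. *)
Fixpoint tower (A : set F) (S : seq F) : Prop :=
  if S is x :: S' then
    sep_over (fgen (A `|` [set y | y \in S'])%classic) x /\ tower A S'
  else True.

Lemma tower_mono (A B : set F) S : (A `<=` fgen B)%classic -> tower A S -> tower B S.
Proof.
move=> AB; elim: S => //= x S IH [sx /IH tS]; split=> //.
apply: sep_mono sx; apply: fgen_mono => y [/AB|yS].
  by apply: fgen_mono => z Bz; apply: sub_fgen; left.
by apply: sub_fgen; right.
Qed.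

Lemma tower_rcons A S x : sep_over (fgen A) x -> tower (A `|` [set x])%classic S ->
  tower A (rcons S x).
Proof.
move=> sx; elim: S => /= [_|y S IH [sy /IH tS]].
  by split=> //; apply: sep_mono sx; apply: fgen_mono => z Az; apply: sub_fgen; left.
split=> //; apply: sep_mono sy; apply: fgen_mono => z [[Az|->]|zS]; apply: sub_fgen.
- by left.
- by right; rewrite /= mem_rcons inE eqxx.
- by right; rewrite /= mem_rcons inE zS orbT.
Qed.

Lemma sep_alg (S : set F) x : sep_over S x -> alg_over S x.
Proof.
move=> [q [qS qx q'x]]; exists q; split=> //.
by apply: contraNneq q'x => ->; rewrite deriv0 horner0.
Qed.

(** One element a is added at a time. If a is transcendental over T it joins the basis. Otherwise
    MacLane's criterion for a and T names an element separable over the others: if it is a, the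
    tower grows at its top; if it is some T i', then a takes its place in the basis and T i' becomes
    the bottom of the tower. *)
Lemma separable_tower (l : seq F) : regular j ->
  exists n (T : 'I_n -> F) (S : seq F), [/\ indep_pol T, tower (range T) S &
    forall x, x \in l -> range T x \/ x \in S].
Proof.
move=> rj; elim: l => [|a l [n [T [S [iT tS lTS]]]]].
  exists 0%N, (fun=> 0), [::]; split=> // f /= /eqP.
  by rewrite fmorph_eq0 => /eqP.
have [aa|na] := pselect (alg_over (fgen (range T)) a); last first.
  exists n.+1, (scons a T), S; split.
  - exact: indep_scons.
  - apply: tower_mono tS => _ [k _ <-]; apply: sub_fgen.
    by exists (lift ord0 k) => //; apply: scons_lift.
  - move=> x; rewrite inE => /orP[/eqP ->|/lTS[[k _ <-]|]]; last by right.
      by left; exists ord0 => //; apply: scons0.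
    by left; exists (lift ord0 k) => //; apply: scons_lift.
have [f [f0 fa]] := alg_relation aa.
have [i] := it_maclane rj f0 fa; case: (unliftP ord0 i) => [i' ->|->]; last first.
  rewrite scons0 => sa; exists n, T, (a :: S); split=> //=.
    split=> //; apply: sep_mono sa; apply: fgen_mono => _ [k k0 ->]; apply: sub_fgen; left.
    case: (unliftP ord0 k) k0 => [k' -> _|->]; last by rewrite eqxx.
    by exists k' => //; rewrite scons_lift.
  move=> x; rewrite !inE => /orP[->|/lTS[?|->]]; [by right|by left|].
  by right; rewrite orbT.
rewrite scons_lift => st.
case: n T iT tS lTS aa f f0 fa i i' st => [|n] T iT tS lTS aa f f0 fa i i' st; first by case: (i').
have [iT0 nT0] := indep_sconsE (@indep_lift n T i' iT).
set T0 := T \o lift i' in iT0 nT0; set t := T i' in st nT0.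
have sT' : sep_over (fgen (range (scons a T0))) t.
  apply: sep_mono st; apply: fgen_mono => _ [k ki ->]; apply: sub_fgen.
  case: (unliftP ord0 k) ki => [k' ->|-> _]; last by exists ord0 => //; rewrite !scons0.
  rewrite scons_lift (inj_eq lift_inj) => ki.
  case: (unliftP i' k') ki => [k'' -> _|->]; last by rewrite eqxx.
  by exists (lift ord0 k'') => //; rewrite scons_lift.
have SS0 := fgen_subfield j (range T0).
(* If a were algebraic over the remaining T0, then t, being algebraic over a and T0, would be
   algebraic over T0, against independence of T. *)
have na : ~ alg_over (fgen (range T0)) a.
  move=> aT0; apply: nT0; apply: (alg_trans SS0).
  have [q [qS q0 qt]] := sep_alg sT'; exists q; split=> // k.
  have := qS k; apply: fgen_min; first exact: alg_subfield.
  move=> _ [m _ <-]; case: (unliftP ord0 m) => [m' ->|->]; last by rewrite scons0.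
  rewrite scons_lift /=; apply: alg_self => //.
  - exact: (subfield0 SS0).
  - exact: (subfield1 SS0).
  - by apply: sub_fgen; exists m'.
exists n.+1, (scons a T0), (rcons S t); split.
- exact: indep_scons.
- apply: tower_rcons => //; apply: tower_mono tS => _ [k _ <-]; apply: sub_fgen.
  case: (unliftP i' k) => [k' ->|->]; last by right.
  by left; exists (lift ord0 k') => //; rewrite scons_lift.
- move=> x; rewrite inE mem_rcons => /orP[/eqP ->|/lTS[[k _ <-]|xS]].
  + by left; exists ord0 => //; rewrite scons0.
  + case: (unliftP i' k) => [k' ->|->]; last by right; rewrite inE eqxx.
    by left; exists (lift ord0 k') => //; rewrite scons_lift.
  + by right; rewrite inE xS orbT.
Qed.

Lemma indep_good n (T : 'I_n -> F) : indep_pol T ->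
  good j (itC K n) (ev j T).
Proof.
move=> iT; split.
- move=> p q /eqP; rewrite -subr_eq0 -rmorphB => /eqP /iT /eqP.
  by rewrite subr_eq0 => /eqP.
- by move=> c; rewrite ev_itC.
- exists n, (itX K (n:=n)) => S SC SX Sop.
  by apply: itpoly_ind => // x y Sx Sy; have [] := Sop x y Sx Sy.
- move=> B C pi pis pi0 y.
  have /choice[t tE] : forall k, exists b, pi b = y (itX K k) by move=> k; apply: pis.
  have zc c : ev (kstr B) t (itC K n c) = kstr B c by rewrite ev_itC.
  exists (@KHom K (KAlg (itC K n)) B (ev (kstr B) t) zc) => r /=.
  rewrite -[in RHS](ev_univ r) (khom_ev y) (khom_ev pi).
  exact: ev_ext.
Qed.

(** Starts from the polynomial ring on the transcendence basis and climbs the tower with [good_sep].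
    Each stage also inverts an element of F, so D is in general larger than the algebra generated by
    l. *)
Lemma smooth_model (l : seq F) : regular j ->
  exists (D : idomainType) (s : {rmorphism K -> D}) (io : {rmorphism D -> F}),
    good j s io /\ forall x, x \in l -> exists d, io d = x.
Proof.
move=> rj; have [n [T [S [iT tS lTS]]]] := separable_tower l rj.
suff [D [s [io [gD im]]]] : exists (D : idomainType) (s : {rmorphism K -> D})
    (io : {rmorphism D -> F}), good j s io /\
    forall x, range T x \/ x \in S -> exists d, io d = x.
  by exists D, s, io; split=> // x /lTS/im.
elim: S tS {lTS} => [_|x S IH /= [sx /IH[D [s [io [gD im]]]]]].
  exists (itpoly K n), (itC K n), (ev j T); split; first exact: indep_good.
  by move=> x [[k _ <-]|//]; exists (itX K k); rewrite ev_itX.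
have [ioinj ios _ _] := gD; have [q [qS qx q'x]] := sx.
have [|d [f [d0 fE]]] := @clear_denoms D io q.
  move=> i; move: (qS i); apply: fgen_min; first exact: frac_subfield ios.
  by move=> y /im[d <-]; exists d, 1; rewrite rmorph1 oner_neq0 mulr1.
have [||D' [s' [io' [gD' inc [t' t'E]]]]] := good_sep (t := x) (q := f) gD.
- by rewrite evp_horner fE hornerZ qx mulr0.
- rewrite evp_horner -deriv_map fE derivZ hornerZ mulf_neq0 //.
exists D', s', io'; split=> // y; rewrite inE.
case=> [Ty|/orP[/eqP ->|yS]]; last 2 first.
- by exists t'.
- by have [|e <-] := im y; [right|apply: inc].
- by have [|e <-] := im y; [left|apply: inc].
Qed.

End Towers.

(** * Embeddings, languages and formulas *)

Section Embeddings.
Implicit Types L : lang.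

Lemma embedding_eval L (A B : structure L) (h : A -> B) n (v : 'I_n -> A) (t : term L n) :
  embedding h -> h (eval v t) = eval (fun k => h (v k)) t.
Proof.
move=> [_ [h0 h1] [hN hAM] hf _]; elim: t => //= [s IHs t IHt|s IHs|s IHs t IHt|f a IH].
- by rewrite (hAM _ _).1 IHs IHt.
- by rewrite hN IHs.
- by rewrite (hAM _ _).2 IHs IHt.
- by rewrite hf; congr fint; apply/funext => k.
Qed.

Lemma embedding_qfree L (A B : structure L) (h : A -> B) n (phi : formula L n) (v : 'I_n -> A) :
  embedding h -> qfree phi -> sat A phi v <-> sat B phi (fun k => h (v k)).
Proof.
move=> eh; elim: phi v => {n} [n|n s t|n r a|n p IHp q IHq|n p IH] v //=.
- move=> _; rewrite -!(embedding_eval _ _ eh).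
  by have [hi _ _ _ _] := eh; split=> [->|/hi].
- move=> _; have [_ _ _ _ hr] := eh; rewrite hr.
  rewrite (_ : (fun k => h (eval v (a k))) =
    (fun k => eval (fun k0 => h (v k0)) (a k))) //.
  by apply/funext => k; rewrite embedding_eval.
- by move=> /andP[qp qq]; rewrite IHp // IHq.
Qed.

Lemma comp_scons (A B : Type) (h : A -> B) n x (v : 'I_n -> A) :
  (fun k => h (scons x v k)) = scons (h x) (fun k => h (v k)).
Proof. by apply/funext => k; rewrite /scons; case: unlift. Qed.

Lemma embedding_universal L (A B : structure L) (h : A -> B) n (phi : formula L n) (v : 'I_n -> A) :
  embedding h -> universal phi -> sat B phi (fun k => h (v k)) -> sat A phi v.
Proof.
move=> eh; elim: phi v => {n} [n|n s t|n r a|n p IHp q IHq|n p IH] v.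
- by [].
- by move=> _; apply: (embedding_qfree (phi := Eqn s t) v eh _).2.
- by move=> _; apply: (embedding_qfree (phi := Rel a) v eh _).2.
- by move=> u; apply: (embedding_qfree (phi := Imp p q) v eh u).2.
- by move=> /= u hB x; apply: IH => //; rewrite comp_scons.
Qed.

Lemma embedding_comp L (A B C : structure L) (g : B -> C) (h : A -> B) :
  embedding g -> embedding h -> embedding (g \o h).
Proof.
move=> [gi [g0 g1] [gN gAM] gf gr] [hi [h0 h1] [hN hAM] hf hr]; split.
- exact: inj_comp.
- by rewrite /= h0 h1.
- split=> [x|x y] /=; first by rewrite hN gN.
  by rewrite (hAM x y).1 (hAM x y).2 (gAM _ _).1 (gAM _ _).2.
- by move=> f a /=; rewrite hf gf.
- by move=> r a; rewrite hr gr.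
Qed.

Lemma sparams_embedding L (C : Type) (A B : structure L) (c : C -> A) (h : A -> B) :
  embedding h ->
  embedding (A := sparams c) (B := sparams (M := B) (fun x => h (c x))) h.
Proof. by move=> [hi h01 hNAM hf hr]; split=> // [[f|x] a|[r|[]] a] //=. Qed.

Lemma ksat_embedding L (C : Type) (A B : structure L) (c : C -> A) (h : A -> B) n
  (phi : kformula L C n) v : embedding h -> qfree phi ->
  ksat c phi v <-> ksat (M := B) (fun x => h (c x)) phi (fun k => h (v k)).
Proof.
move=> eh qf; have eh' := sparams_embedding c eh.
exact: (@embedding_qfree _ (sparams c) (sparams (M := B) (fun x => h (c x))) h _ phi v eh' qf).
Qed.

Lemma elementary_embedding L (A B : structure L) (h : A -> B) : elementary h -> embedding h.
Proof.
move=> eh.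
pose v2 (x y : A) : 'I_2 -> A := scons x (fun=> y).
pose v3 (x y z : A) : 'I_3 -> A := scons x (v2 y z).
pose o0 : 'I_3 := ord0. pose o1 : 'I_3 := lift ord0 ord0.
pose o2 : 'I_3 := lift ord0 (lift ord0 ord0).
have e0 x y z : v3 x y z o0 = x by apply: scons0.
have e1 x y z : v3 x y z o1 = y by rewrite /v3 /o1 scons_lift; apply: scons0.
have e2 x y z : v3 x y z o2 = z by rewrite /v3 /o2 scons_lift /v2 scons_lift.
split.
- move=> x y hxy; have := eh 3%N (Eqn (Var L o0) (Var L o1)) (v3 x y y).
  by rewrite /= e0 e1 => -[_]; apply.
- split.
    have := eh 3%N (Eqn (Var L o0) (Zero L 3)) (v3 (rzero A) (rzero A) (rzero A)).
    by rewrite /= e0 => -[h1 _]; apply: h1.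
  have := eh 3%N (Eqn (Var L o0) (One L 3)) (v3 (rone A) (rone A) (rone A)).
  by rewrite /= e0 => -[h1 _]; apply: h1.
- split=> [x|x y].
    have := eh 3%N (Eqn (Var L o0) (Opp (Var L o1))) (v3 (ropp x) x x).
    by rewrite /= e0 e1 => -[h1 _]; apply: h1.
  split.
    have := eh 3%N (Eqn (Var L o0) (Add (Var L o1) (Var L o2))) (v3 (radd x y) x y).
    by rewrite /= e0 e1 e2 => -[h1 _]; apply: h1.
  have := eh 3%N (Eqn (Var L o0) (Mul (Var L o1) (Var L o2))) (v3 (rmul x y) x y).
  by rewrite /= e0 e1 e2 => -[h1 _]; apply: h1.
- move=> f a; pose v : 'I_(far f).+1 -> A := scons (fint (itp A) a) a.
  have := eh _ (Eqn (Var L ord0) (App (fun k => Var L (lift ord0 k)))) v.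
  rewrite /= /v scons0.
  rewrite (_ : (fun k => scons (fint (itp A) a) a (lift ord0 k)) = a); last first.
    by apply/funext => k; rewrite scons_lift.
  rewrite (_ : (fun k => h (scons (fint (itp A) a) a (lift ord0 k))) = fun k => h (a k)).
    by case=> h1 _; apply: h1.
  by apply/funext => k; rewrite scons_lift.
- by move=> r a; have := eh _ (Rel (fun k => Var L k)) a.
Qed.

Lemma elementary_models L (T : theory L) (A B : structure L) (h : A -> B) : elementary h ->
  models A T -> models B T.
Proof.
move=> eh mA phi Tphi v; pose v0 : 'I_0 -> A := fun k => match k with Ordinal m l => False_rect A (notF l) end.
have -> : v = fun k => h (v0 k) by apply/funext => -[].
by apply/eh/mA.
Qed.

End Embeddings.

Record lmor (L1 L2 : lang) := LMor {
  fmor : fsym L1 -> fsym L2; fmorP : forall f, far (fmor f) = far f;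
  rmor : rsym L1 -> rsym L2; rmorP : forall r, rar (rmor r) = rar r }.

Section Translation.
Context (L1 L2 : lang) (mu : lmor L1 L2).

Fixpoint ttrans n m (s : 'I_n -> term L2 m) (t : term L1 n) : term L2 m :=
  match t with
  | Var k => s k
  | Zero => Zero L2 m
  | One => One L2 m
  | Add t u => Add (ttrans s t) (ttrans s u)
  | Opp t => Opp (ttrans s t)
  | Mul t u => Mul (ttrans s t) (ttrans s u)
  | App f a => App (f := fmor mu f)
      (fun k => ttrans s (a (cast_ord (fmorP mu f) k)))
  end.

(* Junk on formulas with quantifiers. *)
Fixpoint qtrans n (phi : formula L1 n) : forall m, ('I_n -> term L2 m) -> formula L2 m :=
  match phi with
  | Bot n => fun m _ => Bot L2 m
  | Eqn n t u => fun m s => Eqn (ttrans s t) (ttrans s u)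
  | Rel n r a => fun m s => Rel (r := rmor mu r)
      (fun k => ttrans s (a (cast_ord (rmorP mu r) k)))
  | Imp n p q => fun m s => Imp (qtrans p s) (qtrans q s)
  | All n p => fun m _ => Bot L2 m
  end.

Lemma qtrans_qfree n (phi : formula L1 n) m (s : 'I_n -> term L2 m) :
  qfree phi -> qfree (qtrans phi s).
Proof.
elim: phi s => {n} //= n p IHp q IHq s /andP[qp qq].
by rewrite IHp ?IHq.
Qed.

Definition reduct (A : ringstr) (e1 : interp L1 A) (e2 : interp L2 A) :=
  (forall f a, fint e1 a = @fint _ _ e2 (fmor mu f) (fun k => a (cast_ord (fmorP mu f) k))) /\
  (forall r a, rint e1 a <-> @rint _ _ e2 (rmor mu r) (fun k => a (cast_ord (rmorP mu r) k))).

Context (A : ringstr) (e1 : interp L1 A) (e2 : interp L2 A) (red : reduct e1 e2).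

Lemma ttrans_eval n m (s : 'I_n -> term L2 m) (t : term L1 n) (v : 'I_m -> A) :
  eval (M := Structure e2) v (ttrans s t) =
  eval (M := Structure e1) (fun k => eval (M := Structure e2) v (s k)) t.
Proof.
elim: t => //= [t -> u ->|t ->|t -> u ->|f a IH] //.
by rewrite red.1; congr fint; apply/funext => k.
Qed.

Lemma qtrans_sat n (phi : formula L1 n) m (s : 'I_n -> term L2 m) (v : 'I_m -> A) :
  qfree phi -> sat (Structure e2) (qtrans phi s) v <->
  sat (Structure e1) phi (fun k => eval (M := Structure e2) v (s k)).
Proof.
elim: phi s => {n} [n|n t u|n r a|n p IHp q IHq|n p IH] s //=.
- by rewrite !ttrans_eval.
- move=> _; rewrite red.2.
  rewrite (_ : (fun k => eval (M := Structure e2) v _) = (fun k =>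
    eval (M := Structure e1) (fun k0 => eval (M := Structure e2) v (s k0))
      (a (cast_ord (rmorP mu r) k)))) //.
  by apply/funext => k; rewrite ttrans_eval.
- by move=> /andP[qp qq]; rewrite IHp // IHq.
Qed.

End Translation.

(** Along the identity, [qtrans] is substitution of terms for variables. *)
Definition lid (L : lang) : lmor L L :=
  @LMor L L id (fun=> erefl) id (fun=> erefl).

Lemma reduct_id (L : lang) (A : ringstr) (e : interp L A) : reduct (lid L) e e.
Proof.
split=> [f a|r a]; first by congr fint; apply/funext => k; rewrite cast_ord_id.
by rewrite (_ : (fun k => _) = a) //; apply/funext => k; rewrite cast_ord_id.
Qed.

Definition lparams (L : lang) (C : Type) : lmor L (params L C) :=
  @LMor L (params L C) inl (fun=> erefl) inl (fun=> erefl).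

Lemma reduct_params (L : lang) (C : Type) (A : ringstr) (e : interp L A)
  (h : C -> A) : reduct (lparams L C) e (iparams e h).
Proof.
split=> [f a|r a] /=; first by congr fint; apply/funext => k; rewrite cast_ord_id.
by rewrite (_ : (fun k => _) = a) //; apply/funext => k; rewrite cast_ord_id.
Qed.

Definition lmpar (L1 L2 : lang) (mu : lmor L1 L2) (C : Type) :
    lmor (params L1 C) (params L2 C) :=
  @LMor (params L1 C) (params L2 C)
    (fun f => match f with inl f => inl (fmor mu f) | inr c => inr c end)
    (fun f => match f with inl f => fmorP mu f | inr c => erefl end)
    (fun r => match r with inl r => inl (rmor mu r) | inr r => inr r end)
    (fun r => match r with inl r => rmorP mu r | inr r => erefl end).

Lemma ksat_trans (L1 L2 : lang) (mu : lmor L1 L2) (C : Type) (A : ringstr)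
  (e1 : interp L1 A) (e2 : interp L2 A) (h : C -> A) n (phi : kformula L1 C n) m
  (s : 'I_n -> term (params L2 C) m) v : reduct mu e1 e2 -> qfree phi ->
  ksat (M := Structure e2) h (qtrans (lmpar mu C) phi s) v <->
  ksat (M := Structure e1) h phi
    (fun k => eval (M := sparams (M := Structure e2) h) v (s k)).
Proof.
move=> red qf; apply: (qtrans_sat (e1 := iparams e1 h) (e2 := iparams e2 h)) => //.
by split=> [[f|c] a|[r|[]] a] //=; [apply: red.1|apply: red.2].
Qed.

Section Inclusions.
Context (L : lang) (I : Type) (LI : I -> lang) (A : ringstr).

Definition lsub i : lmor (LI i) (lunion LI) :=
  @LMor _ (lunion LI) (fun f => existT _ i f) (fun=> erefl)
    (fun r => existT _ i r) (fun=> erefl).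

Lemma reduct_sub i (e : interp (lunion LI) A) : reduct (lsub i) (ired e i) e.
Proof.
split=> [f a|r a] /=; first by congr fint; apply/funext => k; rewrite cast_ord_id.
by rewrite (_ : (fun k => _) = a) //; apply/funext => k; rewrite cast_ord_id.
Qed.

Definition lbig i : lmor (LI i) (lsum L (lunion LI)) :=
  @LMor _ (lsum L (lunion LI)) (fun f => inr (existT _ i f)) (fun=> erefl)
    (fun r => inr (existT _ i r)) (fun=> erefl).

Lemma reduct_big i (e : interp (lsum L (lunion LI)) A) :
  reduct (lbig i) (ired (isumr e) i) e.
Proof.
split=> [f a|r a] /=; first by congr fint; apply/funext => k; rewrite cast_ord_id.
by rewrite (_ : (fun k => _) = a) //; apply/funext => k; rewrite cast_ord_id.
Qed.

Definition linr : lmor (lunion LI) (lsum L (lunion LI)) :=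
  @LMor _ (lsum L (lunion LI)) inr (fun=> erefl) inr (fun=> erefl).

Lemma reduct_inr (e : interp (lsum L (lunion LI)) A) : reduct linr (isumr e) e.
Proof.
split=> [f a|r a] /=; first by congr fint; apply/funext => k; rewrite cast_ord_id.
by rewrite (_ : (fun k => _) = a) //; apply/funext => k; rewrite cast_ord_id.
Qed.

End Inclusions.

Lemma ired_iunion (I : Type) (LI : I -> lang) (A : Type) (e : forall i, interp (LI i) A) i :
  ired (iunion e) i = e i.
Proof. by rewrite /ired /=; case: (e i). Qed.

Lemma isumr_isum (L1 L2 : lang) (A : Type) (e1 : interp L1 A) (e2 : interp L2 A) :
  isumr (isum e1 e2) = e2.
Proof. by rewrite /isumr /=; case: e2. Qed.

Section Connectives.
Context (L : lang).

Definition Conj n (p q : formula L n) : formula L n := Not (Imp p (Not q)).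

Lemma sat_Conj (M : structure L) n (p q : formula L n) v :
  sat M (Conj p q) v <-> sat M p v /\ sat M q v.
Proof.
split=> /= [h|[hp hq] h]; last exact: h.
by split; apply: contrapT => h'; apply: h => hp hq; apply: h'.
Qed.

Lemma qfree_Conj n (p q : formula L n) : qfree (Conj p q) = qfree p && qfree q.
Proof. by rewrite /= !andbT. Qed.

Definition Conjs n (s : seq (formula L n)) : formula L n :=
  foldr (@Conj n) (Not (Bot L n)) s.

Fixpoint closeall n : formula L n -> formula L 0 :=
  match n with
  | 0 => id
  | m.+1 => fun p => closeall (All p)
  end.

Lemma scons_eta (A : Type) n (v : 'I_n.+1 -> A) :
  scons (v ord0) (fun k => v (lift ord0 k)) = v.
Proof. by apply/funext => k; rewrite /scons; case: unliftP => [i ->|->]. Qed.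

Lemma sat_closeall (M : structure L) n (p : formula L n) v0 :
  sat M (closeall p) v0 <-> forall v, sat M p v.
Proof.
elim: n p => [|n IH] p /=.
  split=> [h v|h]; last exact: h.
  by rewrite (_ : v = v0) //; apply/funext => -[].
rewrite IH; split=> [h v|h v x]; last exact: h.
by rewrite -(scons_eta v); apply: h.
Qed.

Lemma universal_closeall n (p : formula L n) : universal (closeall p) = universal p.
Proof. by elim: n p => //= n IH p; rewrite IH. Qed.

Definition vcat (A : Type) n m (v : 'I_n -> A) (w : 'I_m -> A) : 'I_(n + m) -> A :=
  fun k => match split k with inl i => v i | inr i => w i end.

Lemma vcatl (A : Type) n m (v : 'I_n -> A) (w : 'I_m -> A) k :
  vcat v w (lshift m k) = v k.
Proof. by rewrite /vcat (unsplitK (inl k : 'I_n + 'I_m)%type). Qed.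

Lemma vcatr (A : Type) n m (v : 'I_n -> A) (w : 'I_m -> A) k :
  vcat v w (rshift n k) = w k.
Proof. by rewrite /vcat (unsplitK (inr k : 'I_n + 'I_m)%type). Qed.

Lemma comp_vcat (A B : Type) (h : A -> B) n m (v : 'I_n -> A) (w : 'I_m -> A) :
  (fun k => h (vcat v w k)) = vcat (fun k => h (v k)) (fun k => h (w k)).
Proof. by apply/funext => k; rewrite /vcat; case: (split k). Qed.

Lemma vcat_eta (A : Type) n m (v : 'I_(n + m) -> A) :
  vcat (fun k => v (lshift m k)) (fun k => v (rshift n k)) = v.
Proof. by apply/funext => k; rewrite /vcat; case: splitP => i e; congr v; apply/val_inj. Qed.

Lemma scons_vcat (A : Type) n m x (v : 'I_n -> A) (w : 'I_m -> A) :
  (scons x (vcat v w) : 'I_(n.+1 + m) -> A) = vcat (scons x v) w.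
Proof.
apply/funext => k; case: (unliftP ord0 k) => [k' ->|->]; last first.
  rewrite scons0 /vcat; case: splitP => i.
    by case: (unliftP ord0 i) => [i' -> //|->]; rewrite scons0.
  by [].
rewrite scons_lift /vcat; case: splitP => i ei; case: splitP => i0 ei0.
- rewrite (_ : i0 = lift ord0 i) ?scons_lift //.
  by apply/val_inj; move: ei0; rewrite /= /bump /= !add1n ei => <-.
- by move: ei0 (ltn_ord i); rewrite /= /bump /= !add1n ei addSn => -[->]; rewrite ltnNge leq_addr.
- by move: (ltn_ord i0); rewrite -ei0 /= /bump /= !add1n ltnS ei ltnNge leq_addr.
- by congr w; apply/val_inj; move: ei0; rewrite /= /bump /= !add1n ei addSn => -[] /addnI.
Qed.

Fixpoint alln n m : formula L (n + m) -> formula L m :=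
  match n return formula L (n + m) -> formula L m with
  | 0 => id
  | k.+1 => fun p => alln (n := k) (All p)
  end.

Lemma sat_alln (M : structure L) n m (p : formula L (n + m)) (w : 'I_m -> M) :
  sat M (alln p) w <-> forall v : 'I_n -> M, sat M p (vcat v w).
Proof.
elim: n p => [|n IH] p /=.
  have e (v : 'I_0 -> M) : vcat v w = w.
    apply/funext => k; rewrite /vcat; case: splitP => [[]//|i ki].
    by congr w; apply/val_inj.
  by split=> [h v|h]; [rewrite e|rewrite -(e (fun k => rzero M))].
rewrite IH; split=> [h v|h v x].
  by rewrite -(scons_eta v) -scons_vcat; apply: h.
by have := h (scons x v); rewrite -scons_vcat.
Qed.

End Connectives.

(** * Quantifier elimination with parameters *)

Section Constants.
Context (L : lang) (C : eqType) (x0 : C).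

Fixpoint tconsts n (t : term (params L C) n) : seq C :=
  match t with
  | Add t u | Mul t u => tconsts t ++ tconsts u
  | Opp t => tconsts t
  | App f a => (if f is inr c then [:: c] else [::]) ++
               flatten [seq tconsts (a k) | k <- enum 'I_(far f)]
  | _ => [::]
  end.

Fixpoint fconsts n (phi : kformula L C n) : seq C :=
  match phi with
  | Eqn n t u => tconsts t ++ tconsts u
  | Rel n r a => flatten [seq tconsts (a k) | k <- enum 'I_(rar r)]
  | Imp n p q => fconsts p ++ fconsts q
  | All n p => fconsts p
  | Bot _ => [::]
  end.

Section Abstraction.
Context (m : nat) (idx : C -> 'I_m).

Fixpoint tabs n (t : term (params L C) n) : term L (n + m) :=
  match t with
  | Var k => Var L (lshift m k)
  | Zero => Zero L _
  | One => One L _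
  | Add t u => Add (tabs t) (tabs u)
  | Opp t => Opp (tabs t)
  | Mul t u => Mul (tabs t) (tabs u)
  | App f a =>
      match f return ('I_(@far (params L C) f) -> term L (n + m)) -> term L (n + m) with
      | inl g => fun a' => @App L (n + m) g a'
      | inr c => fun _ => Var L (rshift n (idx c))
      end (fun k => tabs (a k))
  end.

Fixpoint fabs n (phi : kformula L C n) : formula L (n + m) :=
  match phi with
  | Bot n => Bot L (n + m)
  | Eqn n t u => Eqn (tabs t) (tabs u)
  | Rel n r a =>
      match r return ('I_(@rar (params L C) r) -> term L (n + m)) -> formula L (n + m) with
      | inl g => fun a' => @Rel L (n + m) g a'
      | inr c => fun _ => Bot L (n + m)
      end (fun k => tabs (a k))
  | Imp n p q => Imp (fabs p) (fabs q)
  | All n p => All (fabs p : formula L (n + m).+1)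
  end.

Context (M : structure L) (h : C -> M) (w : 'I_m -> M).

Lemma tabs_eval n (t : term (params L C) n) (v : 'I_n -> M) :
  {in tconsts t, forall c, w (idx c) = h c} ->
  eval (M := sparams h) v t = eval (vcat v w) (tabs t).
Proof.
elim: t => //= [k|t IHt u IHu hw|t IHt|t IHt u IHu hw|f a IH hw].
- by rewrite vcatl.
- by rewrite IHt ?IHu // => c hc; apply: hw; rewrite mem_cat hc ?orbT.
- by move=> hw; rewrite IHt.
- by rewrite IHt ?IHu // => c hc; apply: hw; rewrite mem_cat hc ?orbT.
- have {}IH k : eval (M := sparams h) v (a k) = eval (vcat v w) (tabs (a k)).
    apply: IH => c hc; apply: hw; rewrite mem_cat; apply/orP; right.
    by apply/flatten_mapP; exists k; rewrite ?mem_enum.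
  case: f a IH hw => [f|c] a IH hw /=; first by congr fint; apply/funext.
  by rewrite vcatr hw // mem_cat inE eqxx.
Qed.

Lemma fabs_sat n (phi : kformula L C n) (v : 'I_n -> M) :
  {in fconsts phi, forall c, w (idx c) = h c} ->
  ksat h phi v <-> sat M (fabs phi) (vcat v w).
Proof.
rewrite /ksat; elim: phi v => {n} [n|n t u|n r a|n p IHp q IHq|n p IH] v //= hw.
- by rewrite -!tabs_eval // => c hc; apply: hw; rewrite mem_cat hc ?orbT.
- have e k : eval (M := sparams h) v (a k) = eval (vcat v w) (tabs (a k)).
    apply: tabs_eval => c hc; apply: hw.
    by apply/flatten_mapP; exists k; rewrite ?mem_enum.
  case: r a e hw => [r|[]] a e hw /=.
  by rewrite (_ : (fun k => _) = fun k => eval (vcat v w) (tabs (a k))) //; apply/funext.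
- by rewrite IHp ?IHq // => c hc; apply: hw; rewrite mem_cat hc ?orbT.
- by split=> H x; have := H x; rewrite IH // -scons_vcat.
Qed.

End Abstraction.

Lemma fabs_qfree m (idx : C -> 'I_m) n (phi : kformula L C n) :
  qfree (fabs idx phi) = qfree phi.
Proof.
by elim: phi => {n} //= [n [r|[]] a|n p -> q ->].
Qed.

(** Replacing the finitely many constants of a formula by variables brings elementarity and
    quantifier elimination, which concern formulas without parameters, to bear on formulas with
    parameters. *)
Lemma params_abs n (phi : kformula L C n) : exists m (c : 'I_m -> C)
    (psi : formula L (n + m)), qfree psi = qfree phi /\
  forall (M : structure L) (h : C -> M) v,
    ksat h phi v <-> sat M psi (vcat v (fun k => h (c k))).
Proof.
pose l := fconsts phi.
(* The extra variable, of value x0, keeps the index type nonempty and leaves room for [index c l]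
   when c does not occur in l. *)
exists (size l).+1, (fun k => nth x0 l k), (fabs (fun c => inord (index c l)) phi).
split=> [|M h v]; first exact: fabs_qfree.
apply: fabs_sat => c hc; rewrite inordK ?nth_index //.
by rewrite ltnS index_size.
Qed.

Lemma elementary_ksat (A B : structure L) (c : C -> A) (h : A -> B) n
  (phi : kformula L C n) v : elementary h ->
  ksat c phi v <-> ksat (M := B) (fun x => h (c x)) phi (fun k => h (v k)).
Proof.
move=> eh; have [m [d [psi [_ hpsi]]]] := params_abs phi.
by rewrite !hpsi (eh _ psi) comp_vcat.
Qed.

Lemma qelim_params (T : theory L) n (phi : kformula L C n) : qelim T ->
  exists2 psi : kformula L C n, qfree psi &
    forall (M : structure L) (h : C -> M) v, models M T ->
      ksat h phi v <-> ksat h psi v.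
Proof.
move=> qe; have [m [c [phi' [_ hphi]]]] := params_abs phi.
have [psi qf hpsi] := qe _ phi'.
pose s : 'I_(n + m) -> term (params L C) n :=
  vcat (@Var _ n) (fun k => @App (params L C) n (inr (c k)) (fun=> Zero _ _)).
exists (qtrans (lparams L C) psi s); first exact: qtrans_qfree.
move=> M h v mM; rewrite hphi hpsi // /ksat.
rewrite (qtrans_sat (e1 := itp M) (reduct_params _ _)) //.
case: M h v mM {hphi hpsi} => M e h v mM /=.
rewrite /s (_ : (fun k => _) = vcat v (fun k => h (c k))) //.
by apply/funext => k; rewrite /vcat; case: (split k).
Qed.

End Constants.

(* Quantifier elimination turns "theta is satisfiable over K" into a
   quantifier-free condition on the constants, which K inherits from F. *)
Lemma transfer (L : lang) (T : theory L) (K : lfield L) (F : structure L)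
  (j : K -> F) (M : kmodel T K) n (theta : kformula L K n) a :
  qelim T -> embedding (A := K) j -> models F (univ_part T) -> qfree theta ->
  ksat j theta a -> exists y, ksat (M := M) (mstr M) theta y.
Proof.
move=> qe ej mF qf hF; have [m [c [th [qth hth]]]] := params_abs 0 theta.
have [chi qchi hchi] := qe _ (Not (alln (Not th))).
have ex (B : structure L) w : models B T ->
    sat B chi w <-> exists v, sat B th (vcat v w).
  move=> mB; rewrite -hchi //=; split.
    by move=> h; apply: contrapT => hn; apply: h; apply/sat_alln => v hv; apply: hn; exists v.
  by move=> [v hv] /sat_alln /(_ v) /=; apply.
pose chi' := qtrans (lid L) chi (fun k => Var L (rshift n k)).
have hchi' (B : structure L) u w : sat B chi' (vcat (n := n) u w) <-> sat B chi w.
  case: B u w => B e u w; rewrite (qtrans_sat (reduct_id e)) //=.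
  by rewrite (_ : (fun k => _) = w) //; apply/funext => k; rewrite vcatr.
(* That th implies its eliminated form is a universal consequence of T, so it holds in F; from F the
   quantifier-free chi passes down to K and then up to the model. *)
have U : univ_part T (closeall (Imp th chi')).
  split; first by rewrite universal_closeall /= qtrans_qfree // qth qf.
  move=> B mB v; apply/sat_closeall => {}v; rewrite -(vcat_eta v) => hv.
  by apply/hchi'/ex => //; exists (fun k => v (lshift m k)).
have v0 : 'I_0 -> F by case.
have /sat_closeall := mF _ U v0; move/(_ (vcat a (fun k => j (c k)))) => /= H.
have {H} hc : sat F chi (fun k => j (c k)) by apply/hchi'/H/hth.
case: M => N h eN mN /=; have /ex : sat N chi (fun k => h (c k)).
  by apply/(embedding_qfree (A := K) _ eN) => //; apply/(embedding_qfree (A := K) _ ej).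
by move=> /(_ mN) [y hy]; exists y; apply/hth.
Qed.

(** * Formulas over algebras, ultrapowers *)

Section RingFormulas.
Context (L : lang) (K : fieldType).

Lemma poly_term n (p : itpoly K n) : exists t : term (params L K) n,
  forall (N : lfield L) (h : {rmorphism K -> N}) v,
    eval (M := sparams (M := N) h) v t = ev h v p.
Proof.
elim/itpoly_ind: p => [c|k|p q [t tE] [u uE]|p q [t tE] [u uE]].
- exists (@App (params L K) n (inr c) (fun=> Zero _ _)) => N h v.
  by rewrite ev_itC.
- by exists (Var _ k) => N h v; rewrite ev_itX.
- by exists (Add t u) => N h v /=; rewrite tE uE rmorphD.
- by exists (Mul t u) => N h v /=; rewrite tE uE rmorphM.
Qed.

Lemma ev_fk (N : fieldType) (h : {rmorphism K -> N}) n (v : 'I_n -> fk h) p :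
  ev (kstr (fk h)) v p = ev h v p.
Proof. by apply: (ev_comp (g := idfun : {rmorphism N -> N})). Qed.

Context (R : kalg K) (n : nat) (a : 'I_n -> R) (ga : generates a).

Lemma elem_term (d : R) : exists t : term (params L K) n,
  forall (N : lfield L) (h : {rmorphism K -> N}) (f : khom R (fk h)),
    eval (M := sparams (M := N) h) (fun k => f (a k)) t = f d.
Proof.
have [p <-] := gen_surj ga d; have [t tE] := poly_term p.
by exists t => N h f; rewrite tE khom_ev ev_fk.
Qed.

(** A finite conjunction of polynomial equations over K, by [fin_pres]. It serves to make existence
    of points of Spec R a first-order property. *)
Lemma hom_formula : exists2 chi : kformula L K n, qfree chi &
  forall (N : lfield L) (h : {rmorphism K -> N}) v,
    ksat (M := N) h chi v <-> exists f : khom R (fk h), forall k, f (a k) = v k.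
Proof.
have [E [Ea Ef]] := fin_pres ga.
have [chi qc chiE] : exists2 chi : kformula L K n, qfree chi &
    forall (N : lfield L) (h : {rmorphism K -> N}) v,
    ksat (M := N) h chi v <-> forall q, q \in E -> ev h v q = 0.
  elim: E {Ea Ef} => [|q E [chi qc chiE]]; first by exists (Not (Bot _ _)) => // N h v; split=> // _ [].
  have [t tE] := poly_term q.
  exists (Conj (Eqn t (Zero _ _)) chi); first by rewrite qfree_Conj.
  move=> N h v; rewrite /ksat sat_Conj [X in _ /\ X](chiE N h v) /= tE.
  split=> [[e0 eE] q'|eE]; first by rewrite inE => /orP[/eqP ->|/eE].
  split=> [|q' q'E]; first exact: (eE _ (mem_head _ _)).
  by apply: (eE); rewrite inE q'E orbT.
exists chi => // N h v; rewrite chiE; split=> [h0|[f fE] q qE].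
  have [|f fE] := Ef (fk h) v; first by move=> q qE; rewrite ev_fk; apply: h0.
  exists f => k.
    by have := fE (itX K k); rewrite !ev_itX.
have := khom_ev f a q; rewrite Ea // rmorph0 ev_fk => /esym <-.
by apply: ev_ext => k; rewrite /= fE.
Qed.

Lemma pull_formula (L1 : lang) (mu : lmor L1 L) m (theta : kformula L1 K m)
    (d : 'I_m -> R) : qfree theta ->
  exists2 th : kformula L K n, qfree th &
  forall (N : lfield L) (h : {rmorphism K -> N}) (e1 : interp L1 (ring_of N))
    (f : khom R (fk h)), reduct mu e1 (litp N) ->
    ksat (M := N) h th (fun k => f (a k)) <->
    ksat (M := Structure e1) h theta (fun k => f (d k)).
Proof.
move=> qt; have /choice[t tE] := fun k => elem_term (d k).
exists (qtrans (lmpar mu K) theta t); first exact: qtrans_qfree.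
move=> N h e1 f red; have := @ksat_trans L1 L mu K (ring_of N) e1 (litp N) h m theta n t
  (fun k => f (a k)) red qt.
have -> // : (fun k => eval (M := sparams (M := N) h) (fun k => f (a k)) (t k)) =
  (fun k => f (d k) : N).
by apply/funext => k; apply: tE.
Qed.

End RingFormulas.

Section Ultrapower.
Context (L : lang) (A : lfield L) (J : Type) (U : set (set J)) (uU : ultra U).

Lemma los : exists (N : lfield L) (p : {rmorphism uprod (fun _ : J => A : fieldType) -> N}),
  [/\ forall x, exists a, p a = x,
      forall a b, p a = p b <-> U [set s | a s = b s]%classic &
      forall n (phi : formula L n) (w : 'I_n -> uprod (fun _ : J => A : fieldType)),
        sat N phi (fun k => p (w k)) <-> U [set s | sat A phi (fun k => w k s)]%classic].
Proof.
have [N [p [pE pS]]] := ult_exists uU (fun _ : J => A : fieldType).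
have /choice[rep repK] := pS.
pose e : interp L N := @Interp L N
  (fun f x => p (fun s => fint (litp A) (fun k => rep (x k) s)))
  (fun r x => U [set s | rint (litp A) (fun k => rep (x k) s)]%classic).
(* The chosen representatives agree with w on a set of U for all entries at once, because tuples are
   finite. *)
have repE n (w : 'I_n -> uprod (fun _ : J => A : fieldType)) :
    U [set s | forall k, rep (p (w k)) s = w k s]%classic.
  have h k : U [set s | rep (p (w k)) s = w k s]%classic by apply/pE; rewrite repK.
  elim: n w h => [|n IH] w h; first by apply: (ultraS uU _ (ultraT uU)) => s _ [].
  apply: (ultraS uU _ (ultraI uU (h ord0) (IH (fun k => w (lift ord0 k)) (fun k => h _)))).
  by move=> s [/= h0 h1] k; case: (unliftP ord0 k) => [k' ->|->].
pose M := LField e.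
have tE n (t : term L n) (w : 'I_n -> uprod (fun _ : J => A : fieldType)) :
    eval (M := M) (fun k => p (w k)) t =
    p (fun s => eval (M := A) (fun k => w k s) t).
  elim: t => //= [|||||f a IH].
  - by rewrite -(rmorph0 p).
  - by rewrite -(rmorph1 p).
  - by move=> t -> u ->; rewrite -rmorphD.
  - by move=> t ->; rewrite -rmorphN.
  - by move=> t -> u ->; rewrite -rmorphM.
  apply/pE.
  apply: (ultraS uU _ (repE _ (fun k s => eval (M := A) (fun k0 => w k0 s) (a k)))).
  by move=> s /= h; congr fint; apply/funext => k; rewrite IH h.
exists M, p; split=> // n phi; elim: phi => {n} [n|n t u|n r a|n phi IHp psi IHq|n phi IH] w.
- by split=> // /(ultra0 uU).
- rewrite /= !tE; exact: pE.
- have hr := repE _ (fun k s => eval (M := A) (fun k0 => w k0 s) (a k)).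
  split=> h; apply: (ultraS uU _ (ultraI uU h hr)) => s [/= + h2];
    rewrite (_ : (fun k => rep _ s) = fun k => eval (M := A) (fun k0 => w k0 s) (a k)) //;
    by apply/funext => k; rewrite tE h2.
- rewrite /= IHp IHq; split=> [h|h hp].
    have [hp|hp] := ultraVC uU [set s | sat A phi (fun k => w k s)]%classic.
      by apply: (ultraS uU _ (h hp)) => s /= hq _.
    by apply: (ultraS uU _ hp) => s /= hn /hn.
  by apply: (ultraS uU _ (ultraI uU h hp)) => s [/= h1 h2]; apply: h1.
- rewrite /=; split=> [h|h x].
    have [//|hn] := ultraVC uU [set s | forall x, sat A phi (scons x (fun k => w k s))]%classic.
    have /choice[y yP] : forall s, exists y : A,
        ~ (forall x, sat A phi (scons x (fun k => w k s))) ->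
        ~ sat A phi (scons y (fun k => w k s)).
      move=> s; have [hs|/existsNP[y hy]] :=
        pselect (forall x, sat A phi (scons x (fun k => w k s))).
        by exists (rzero A) => /(_ hs).
      by exists y.
    have := h (p y).
    rewrite (_ : scons (p y) _ = fun k => p (scons y w k)); last by rewrite comp_scons.
    move=> /IH hU; case: (ultra0 uU).
    apply: (ultraS uU _ (ultraI uU hU hn)) => s [/= h1 h2]; apply: (yP s h2).
    by rewrite -(comp_scons (fun x : uprod (fun _ : J => A : fieldType) => x s) y w).
  have [y <-] := pS x.
  rewrite (_ : scons (p y) _ = fun k => p (scons y w k)); last by rewrite comp_scons.
  apply/IH; apply: (ultraS uU _ h) => s /= h1.
  by rewrite (comp_scons (fun x : uprod (fun _ : J => A : fieldType) => x s) y w).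
Qed.

Lemma ultrapower : exists (N : lfield L) (p : {rmorphism uprod (fun _ : J => A : fieldType) -> N})
    (delta : {rmorphism A -> N}),
  [/\ elementary (A := A) (B := N) delta, forall x, delta x = p (fun=> x),
      forall x, exists a, p a = x,
      forall a b, p a = p b <-> U [set s | a s = b s]%classic &
      forall (C : fieldType) (c : {rmorphism C -> A}) n (theta : kformula L C n)
        (w : 'I_n -> uprod (fun _ : J => A : fieldType)),
        ksat (M := N) (delta \o c) theta (fun k => p (w k)) <->
        U [set s | ksat (M := A) c theta (fun k => w k s)]%classic].
Proof.
have [N [p [pS pE pL]]] := los.
have cst (P : Prop) : U [set s | P]%classic <-> P.
  split=> [h|h]; last by apply: (ultraS uU _ (ultraT uU)).
  by apply: contrapT => nP; apply: (ultra0 uU); apply: (ultraS uU _ h).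
pose d (x : A) : N := p (fun=> x).
have d1 : d 1 = 1 := rmorph1 p.
have dD : {morph d : x y / x + y}.
  by move=> x y; rewrite /d -rmorphD.
have dM : {morph d : x y / x * y}.
  by move=> x y; rewrite /d -rmorphM.
exists N, p, (mkrm d1 dD dM); split=> // [n phi v|C c n theta w].
  by rewrite -[sat A phi v]cst -(pL n phi (fun k _ => v k)).
have [m [cs [psi [_ hpsi]]]] := params_abs (0 : C) theta.
have := pL _ psi (vcat w (fun k => (fun=> c (cs k)))).
rewrite comp_vcat hpsi => ->.
by split=> h; apply: (ultraS uU _ h) => s /=; rewrite hpsi;
  rewrite (comp_vcat (fun x : uprod (fun _ : J => A : fieldType) => x s)).
Qed.

End Ultrapower.

(** * Dense sets of points *)

Section Density.
Context (K : fieldType) (X : kfunctor K).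
Implicit Types (A B R : kalg K).

Lemma closed_map (Z : subfunctor X) A B (f : khom A B) x :
  closed_subfunctor Z -> Z A x -> Z B (pmap X f x).
Proof.
move=> cZ; have [S SP] := cZ A x; rewrite -{1}(pmap_kid x) => /SP h.
by apply/SP => s /h /= ->; rewrite rmorph0.
Qed.

Lemma open_map (V : subfunctor X) A B (f : khom A B) x :
  open_subfunctor V -> V A x -> V B (pmap X f x).
Proof.
move=> oV; have [S SP] := oV A x; rewrite -{1}(pmap_kid x) => /SP h.
apply/SP; have := unit_ideal_img f h; congr unit_ideal.
by rewrite image_comp.
Qed.

Lemma chart_exists : variety X -> exists c : chart X, (1 : cring c) != 0.
Proof.
move=> [_ [r [R [u [[ou cu] ft]]]] _ [[A [A1 [x]]] _]].
have [k [f _]] := field_residue A1.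
pose f' : khom A (fk (f \o kstr A : {rmorphism K -> k})) :=
  @KHom K A (fk (f \o kstr A : {rmorphism K -> k})) f (fun=> erefl).
have [i [g gE]] := cu _ (is_field_fk _) (pmap X f' x).
have [n [a ga]] := ft i; exists (Chart (ou i) ga) => /=.
apply/eqP => /(khom_zero_ring g) /eqP; apply/negP; exact: (is_field_fk _).1.
Qed.

Context (sX : scheme X) (iX : integral X).

(** If r vanished at all points of S in the chart, it would vanish on the part of the closure of S
    there. So the closure would be a proper closed subfunctor containing S. *)
Lemma zdense_chart A (S : set (X A)) R (u : X R) r : is_field A -> zdense S ->
  open_immersion u -> r <> 0 ->
  exists g : khom R A, S (pmap X g u) /\ g r <> 0.
Proof.
move=> fA dS ou r0; apply: contrapT => H.
(* The least family of points of X containing S; describing it by cases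
   would require comparing points over unequal algebras. *)
pose Q B (y : X B) := forall P : (forall B, X B -> Prop),
  (forall x, S x -> P A x) -> P B y.
apply: dS; exists (clos Q); split; last first.
  by move=> x Sx; apply: closP => // P; apply.
split; first exact: clos_closed.
exists R, u => cu; apply: r0; apply: (clos_van ou cu) => B g fB.
move=> /(_ (fun B y => forall g : khom R B, pmap X g u = y -> g r = 0)); apply=> //.
move=> x Sx {}g gE; apply: contrapT => gr; apply: H; exists g; split=> //.
by rewrite gE.
Qed.

(** A generic point is dense as a singleton. So it lies in every nonempty affine open, and no
    nonzero function vanishes at it. *)
Lemma generic_open A (x : X A) R (u : X R) : is_field A -> open_immersion u ->
  (1 : R) != 0 -> (forall Z : subfunctor X, proper_closed Z -> ~ Z A x) ->
  exists2 f : khom R A, pmap X f u = x & forall r, f r = 0 -> r = 0.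
Proof.
move=> fA ou R1 gx.
have dx : zdense [set x]%classic.
  by move=> [Z [pZ h]]; apply: (gx Z pZ); apply: h.
have [|f [fE _]] := zdense_chart fA dx ou (r := 1); first exact/eqP.
exists f => // r fr; apply: contrapT => r0.
have [g [gE]] := zdense_chart fA dx ou r0.
by rewrite (ou.1 A g f) // gE fE.
Qed.

End Density.

Section BaseDensity.
Context (K E : fieldType) (j : {rmorphism K -> E}) (X : kfunctor K).

Lemma base_proper (Z : subfunctor X) : variety X -> proper_closed Z ->
  proper_closed (X := base_change j X) (fun A x => Z (kres j A) x).
Proof.
move=> vX pZ; have [sX _ _ iX] := vX; have cZ := pZ.1; split.
  move=> A x; have [S SP] := cZ (kres j A) x; exists S => B f.
  exact: (SP (kres j B) (kres_hom j f)).
have [c c1] := chart_exists vX; case: c c1 => R u n a ou ga /= R1.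
have [RE [i bi]] := base_ring_exists j ga.
exists RE, (pmap X i u) => Zi; apply: (proper_open sX iX pZ ou R1).
have [S SP] := cZ R u; rewrite -(pmap_kid u); apply/SP => s Ss /=.
by apply: (base_inj bi); apply: (iffLR (SP _ i)).
Qed.

Lemma zdense_base (S : set (X (fk j))) : variety X ->
  zdense (X := base_change j X) (A := kself E) S -> zdense S.
Proof.
move=> vX dS [Z [pZ SZ]]; apply: dS; exists (fun A x => Z (kres j A) x).
by split=> //; apply: base_proper.
Qed.

Lemma smooth_base (A : kalg K) (B : kalg E) (f : khom A (kres j B)) (x : X A) :
  smooth_point x -> smooth_point (X := base_change j X) (A := B) (pmap X f x).
Proof.
move=> [V [oV sV Vx]]; exists (fun C y => V (kres j C) y); split.
- move=> C y; have [S SP] := oV (kres j C) y; exists S => D g.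
  exact: (SP (kres j D) (kres_hom j g)).
- move=> C D pi pis pi0 y Vy.
  by have [z Vz zE] := sV (kres j C) (kres j D) (kres_hom j pi) pis pi0 y Vy; exists z.
- exact: open_map.
Qed.

End BaseDensity.

(** The hypothesis on T gives a large field isomorphic to the model. The smooth point is carried
    there, largeness is applied to the base change of V, and density is carried back. *)
Lemma large_dense (L : lang) (T : theory L) (K : lfield L) (V : kfunctor K)
  (M : kmodel T K) : theory_of_large_fields T -> variety V -> geom_integral V ->
  totally_variety T V -> zdense (X := V) (A := fk (mstr M)) setT.
Proof.
move=> hl vV gV tV; have [x sx] := tV M.
case: M x sx => N s eN mN /= x sx.
have [F [h [[[h' hK h'K] [h0 h1] _ hD hM] lF]]] := hl N mN.
pose g : {rmorphism N -> F} := @mkrm N F h h1 hD hM.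
pose gh : khom (fk s) (fk (g \o s)) := @KHom K (fk s) (fk (g \o s)) g (fun=> erefl).
have g'M : {morph h' : x y / (x * y : F) >-> (x * y : N)}.
  by move=> y z; apply: (can_inj hK); rewrite h'K hM !h'K.
have g'D : {morph h' : x y / (x + y : F) >-> (x + y : N)}.
  by move=> y z; apply: (can_inj hK); rewrite h'K hD !h'K.
have g'1 : h' (1 : F) = (1 : N) by apply: (can_inj hK); rewrite h'K h1.
pose g' : {rmorphism F -> N} := @mkrm F N h' g'1 g'D g'M.
have g'P c : g' (kstr (fk (g \o s)) c) = kstr (fk s) c by apply: hK.
pose gh' : khom (fk (g \o s)) (fk s) := @KHom K (fk (g \o s)) (fk s) g' g'P.
have vF := base_variety (g \o s) vV gV.
have sF : smooth_point (X := base_change (g \o s) V) (A := kself F) (pmap V gh x).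
  exact: (smooth_base (B := kself F) gh sx).
have dF := zdense_base vV (lF _ vF (ex_intro _ _ sF)).
move=> [Z [pZ allZ]]; apply: dF; exists Z; split=> // y _.
have -> : y = pmap V gh (pmap V gh' y).
  by rewrite -pmap_kcomp -[LHS]pmap_kid; apply: pmap_ext => z; apply/esym/h'K.
by apply: closed_map => //; [case: pZ|apply: allZ].
Qed.

Section Charts.
Context (K : fieldType) (V : kfunctor K) (c : chart V).

Lemma chart_open : open_immersion (cmap c).
Proof. by case: c. Qed.

Lemma chart_gen : generates (cgen (c := c)).
Proof. by case: c. Qed.

Lemma coords_uniq (A : kalg K) (x : V A) v w :
  coords (c := c) x v -> coords (c := c) x w -> v = w.
Proof.
move=> [f [fE vE]] [g [gE wE]]; apply/funext => k; rewrite vE wE.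
by apply: (chart_open.1 A f g); rewrite fE gE.
Qed.

Lemma chart_denoms (R A : kalg K) (u : V R) (f0 : khom R A) : is_field A ->
  yoneda (cmap c) (pmap V f0 u) ->
  exists (s : R) (N : nat) (al : 'I_(cdim c) -> R), f0 s <> 0 /\
  forall B (h : khom R B), (exists b, h s * b = 1) ->
  exists2 v, coords (c := c) (pmap V h u) v & forall k, h s ^+ N * v k = h (al k).
Proof.
move=> fA; have [S SP] := chart_open.2 R u.
move=> /SP; move=> /(unit_ideal_nz fA.1)[_ [s Ss <-] f0s].
have [B [l loc]] := loc_exists s; have [ls lfrac _] := loc.
have [a aE] : yoneda (cmap c) (pmap V l u).
  by have [b sb] := ls; apply/SP; apply: unit_ideal1 sb; exists s.
have /choice[x /choice[n xE]] := fun k => lfrac (a (cgen (c := c) k)).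
pose N := (\sum_k n k)%N.
exists s, N, (fun k => s ^+ (N - n k) * x k); split=> // C h [b0 uh].
have [h' h'E] := loc_lift loc uh.
exists (fun k => h' (a (cgen (c := c) k))).
  exists (kcomp h' a); split=> //; rewrite pmap_kcomp aE -pmap_kcomp.
  exact: pmap_ext.
move=> k; rewrite rmorphM rmorphXn -!h'E -xE !rmorphM !rmorphXn mulrA -exprD.
by rewrite subnK // /N (bigD1 k) //= leq_addr.
Qed.

End Charts.

(** The tautological point, sending r to the class of the family (g r) indexed by the A-points g of
    u. It is injective by the choice of U, and Los's theorem gives the formulas it satisfies. *)
Lemma ultra_point (L : lang) (K : fieldType) (A : lfield L) (j : {rmorphism K -> A})
  (V : kfunctor K) (R : kalg K) (u : V R) (U : set (set (khom R (fk j)))) :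
  ultra U -> (forall r, r <> 0 -> U [set g | g r <> 0]%classic) ->
  exists (N : lfield L) (d : {rmorphism A -> N}) (f : khom R (fk (d \o j))),
  [/\ elementary (A := A) (B := N) d, forall r, f r = 0 -> r = 0 &
      forall (c : chart V) (theta : kformula L K (cdim c)),
        U [set g : khom R (fk j) | exists2 v, coords (c := c) (pmap V g u) v &
             ksat (M := A) j theta v]%classic ->
        exists2 v, coords (c := c) (pmap V f u) v & ksat (M := N) (d \o j) theta v].
Proof.
move=> uU U0; have [N [p [d [ed dE pS pE pL]]]] := ultrapower A uU.
pose F r : N := p (fun g : khom R (fk j) => g r).
have F1 : F 1 = 1.
  by rewrite -(rmorph1 p); apply/pE; apply: (ultraS uU _ (ultraT uU)) => g _ /=; rewrite rmorph1.
have FD : {morph F : x y / x + y}.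
  move=> x y; rewrite -rmorphD; apply/pE.
  by apply: (ultraS uU _ (ultraT uU)) => g _ /=; rewrite rmorphD.
have FM : {morph F : x y / x * y}.
  move=> x y; rewrite -rmorphM; apply/pE.
  by apply: (ultraS uU _ (ultraT uU)) => g _ /=; rewrite rmorphM.
have FK a : mkrm F1 FD FM (kstr R a) = kstr (fk (d \o j)) a.
  rewrite /= dE; apply/pE.
  by apply: (ultraS uU _ (ultraT uU)) => g _ /=; rewrite khomP.
pose f : khom R (fk (d \o j)) := @KHom K R (fk (d \o j)) (mkrm F1 FD FM) FK.
have fE r : f r = p (fun g : khom R (fk j) => g r) by [].
have f0 r : f r = 0 -> r = 0.
  move=> fr; apply: contrapT => r0; have Ur := U0 r r0; apply: (ultra0 uU).
  have /pE U1 : p (fun g : khom R (fk j) => g r) = p 0 by rewrite rmorph0.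
  by apply: (ultraS uU _ (ultraI uU U1 Ur)) => g [].
exists N, d, f; split=> // c theta UW.
have [g0 [v0 [h0 [h0E _]] _]] : exists g : khom R (fk j),
    exists2 v, coords (c := c) (pmap V g u) v & ksat (M := A) j theta v.
  apply: contrapT => /forallNP hn; apply: (ultra0 uU).
  by apply: (ultraS uU _ UW) => g /hn.
have yg0 : yoneda (cmap c) (pmap V g0 u) by exists h0.
(* A single factor g0 whose point lies in the chart provides a denominator s valid for almost every
   g. Hence the coordinates of the new point are the classes of the coordinates w g. *)
have [s [m [al [s0 hv]]]] := chart_denoms (is_field_fk j) yg0.
have sn0 : s <> 0 by move=> e; apply: s0; rewrite e rmorph0.
have unit_fk (E : fieldType) (jE : {rmorphism K -> E}) (x : fk jE) :
    x <> 0 -> exists b, x * b = 1 by move=> /eqP; apply: (is_field_fk jE).2.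
have [|v cv vE] := hv _ f; first by apply: unit_fk => /f0.
have /choice[w wE] : forall g : khom R (fk j), exists w, g s <> 0 ->
    coords (c := c) (pmap V g u) w /\ forall k, g s ^+ m * w k = g (al k).
  move=> g; have [g0'|gs] := pselect (g s = 0); first by exists v0.
  by have [|w cw wE] := hv _ g; [exact: unit_fk|exists w].
have vw : v = fun k => p (fun g => w g k).
  apply/funext => k; apply: (mulfI (x := (f s : N) ^+ m)).
    by rewrite expf_neq0 //; apply/eqP => /f0.
  rewrite [LHS]vE !fE -rmorphXn -rmorphM; apply/pE.
  apply: (ultraS uU _ (U0 s sn0)) => g gs /=.
  have [_ <-] := wE g gs; congr (_ * _).
  by elim: (m) => // i IH; rewrite !exprS; congr (_ * _).
exists v => //; rewrite vw; apply/pL.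
apply: (ultraS uU _ (ultraI uU UW (U0 s sn0))) => g [/= [v' cv' hv'] gs].
have [cw _] := wE g gs.
by rewrite (coords_uniq cv' cw) in hv'.
Qed.

Section Fractions.
Import FracField.

Lemma frac_decomp (D : idomainType) (x : {fraction D}) :
  exists r s : D, s != 0 /\ x * tofrac s = tofrac r.
Proof.
elim/generic_quotient.quotW: x => x.
exists (\n_x), (\d_x); split; first exact: denom_ratioP.
unlock tofrac; rewrite -[LHS]pi_mul; apply/generic_quotient.eqmodP.
rewrite /= equivfE /mulf !numden_Ratio ?mulr1 ?mulf_neq0 ?oner_eq0 ?denom_ratioP //.
by rewrite mulrC.
Qed.

Lemma frac_field (R : comPzRingType) : domain R ->
  exists (F : fieldType) (io : {rmorphism R -> F}),
    (forall r, io r = 0 -> r = 0) /\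
    forall x : F, exists r s, s <> 0 /\ x * io s = io r.
Proof.
move=> dR; have [D [f [f' [fK f'K]]]] := dom_exists dR.
exists {fraction D}, (@tofrac D \o f); split=> [r /= /eqP|x].
  by rewrite tofrac_eq0 => /eqP h; rewrite -(fK r) h rmorph0.
have [r [s [s0 e]]] := frac_decomp x; exists (f' r), (f' s).
rewrite /= !f'K; split=> // /(congr1 f); rewrite f'K rmorph0 => /eqP.
exact/negP.
Qed.

End Fractions.

Lemma frac_ext (R : comPzRingType) (F N : fieldType) (io : {rmorphism R -> F})
  (f : {rmorphism R -> N}) : (forall r, io r = 0 -> r = 0) ->
  (forall x : F, exists r s, s <> 0 /\ x * io s = io r) ->
  (forall r, f r = 0 -> r = 0) ->
  exists g : {rmorphism F -> N}, forall r, g (io r) = f r.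
Proof.
move=> io0 frac f0; have /choice[r /choice[s rs]] := frac.
have io_inj x y : io x = io y -> x = y.
  by move=> e; apply/eqP; rewrite -subr_eq0; apply/eqP/io0; rewrite rmorphB e subrr.
have fs x : x <> 0 -> f x != 0 by move=> x0; apply/eqP => /f0.
pose g x : N := f (r x) / f (s x).
have gP x a b : b <> 0 -> x * io b = io a -> g x * f b = f a.
  move=> b0 e; have [sx0 ex] := rs x.
  have : r x * b = a * s x.
    by apply: io_inj; rewrite !rmorphM -ex -e; ring.
  move/(congr1 f); rewrite !rmorphM => h.
  by rewrite /g mulrAC h mulfK // fs.
have gE x y a b : b <> 0 -> x * io b = io a -> y * f b = f a -> g x = y.
  move=> b0 e e'; apply: (mulIf (fs b b0)); rewrite e'; exact: gP.
have one0 : (1 : R) <> 0.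
  by move=> /(congr1 f); rewrite rmorph1 rmorph0; apply/eqP/oner_neq0.
have mul0 x y : x <> 0 -> y <> 0 -> x * y <> 0 :> R.
  move=> /fs x0 /fs y0 /(congr1 f) /eqP; rewrite rmorphM rmorph0.
  by apply/negP; rewrite mulf_neq0.
have gg x : g x * f (s x) = f (r x) by apply: gP; have [] := rs x.
have g1 : g 1 = 1 by apply: (gE _ _ 1 1) => //; rewrite !rmorph1 mulr1.
have gM : {morph g : x y / x * y}.
  move=> x y; have [sx ex] := rs x; have [sy ey] := rs y.
  apply: (gE _ _ (r x * r y) (s x * s y)); first exact: mul0.
    by rewrite !rmorphM -ex -ey; ring.
  by rewrite !rmorphM -!gg; ring.
have gD : {morph g : x y / x + y}.
  move=> x y; have [sx ex] := rs x; have [sy ey] := rs y.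
  apply: (gE _ _ (r x * s y + r y * s x) (s x * s y)); first exact: mul0.
    by rewrite rmorphD !rmorphM -ex -ey; ring.
  by rewrite rmorphD !rmorphM -!gg; ring.
exists (mkrm g1 gD gM) => x; apply: (gE _ _ x 1) => //; rewrite rmorph1 ?mulr1 //.
Qed.

Lemma khom_factor (K : fieldType) (R D A : kalg K) (i : khom D A) (f : khom R A) :
  injective i -> (forall r, exists d, i d = f r) ->
  exists g : khom R D, forall r, i (g r) = f r.
Proof.
move=> ii /choice[g gE].
have g1 : g 1 = 1 by apply: ii; rewrite gE !rmorph1.
have gD : {morph g : x y / x + y} by move=> x y; apply: ii; rewrite rmorphD !gE rmorphD.
have gM : {morph g : x y / x * y} by move=> x y; apply: ii; rewrite rmorphM !gE rmorphM.
have gK c : mkrm g1 gD gM (kstr R c) = kstr D c.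
  by apply: ii; rewrite /= gE !khomP.
by exists (@KHom K R D (mkrm g1 gD gM) gK).
Qed.

Lemma sat_Conjs_map (L : lang) (M : structure L) n (T : eqType) (s : seq T)
  (th : T -> formula L n) v :
  sat M (Conjs [seq th k | k <- s]) v <-> forall k, k \in s -> sat M (th k) v.
Proof.
elim: s => [|k s IH]; first by split=> // _ [].
rewrite [Conjs _]/(Conj (th k) (Conjs [seq th k | k <- s])) sat_Conj IH.
split=> [[h0 h] k'|h]; first by rewrite inE => /orP[/eqP ->|/h].
by split=> [|k' k's]; apply: h; rewrite inE ?eqxx ?k's ?orbT.
Qed.

Lemma qfree_Conjs_map (L : lang) n (T : eqType) (s : seq T) (th : T -> formula L n) :
  (forall k, qfree (th k)) -> qfree (Conjs [seq th k | k <- s]).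
Proof. by move=> h; elim: s => //= k s ->; rewrite h. Qed.

(** A point of D over K is a tuple satisfying the formula of [hom_formula]; io shows that this
    formula and the th k are jointly satisfiable in F. *)
Lemma ec_point (L : lang) (K F : lfield L) (j : {rmorphism K -> F})
  (D : kalg K) n (a : 'I_n -> D) (io : khom D (fk j)) (Q : finType)
  (th : Q -> kformula L K n) :
  exist_closed (K := K) (F := F) j -> generates a -> (forall k, qfree (th k)) ->
  (forall k, ksat (M := F) j (th k) (fun l => io (a l))) ->
  exists g : khom D (fk (idfun : {rmorphism K -> K})),
    forall k, ksat (M := K) idfun (th k) (fun l => g (a l)).
Proof.
move=> ec ga qth hth; have [chi qchi chiE] := hom_formula L ga.
have [||v] := ec n (Conj chi (Conjs [seq th k | k <- enum Q])).
- by rewrite qfree_Conj qchi qfree_Conjs_map.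
- exists (fun l => io (a l)); apply/sat_Conj; split; first by apply/chiE; exists io.
  by apply/sat_Conjs_map => k _; apply: hth.
rewrite /ksat sat_Conj => -[hc /sat_Conjs_map h].
have [g gE] := iffLR (chiE K idfun v) hc.
exists g => k; rewrite (_ : (fun l => g (a l)) = v); last exact/funext.
by apply: h; rewrite mem_enum.
Qed.

(** * Generic points over several models *)

Section Fusion.
Context (L : lang) (T : theory L) (I : Type) (LI : I -> lang)
  (TI : forall i, theory (LI i)) (hrel : forall i, relational (LI i)).
Context (K : fieldType) (eL : interp L K) (eI : forall i, interp (LI i) K).
Context (hlarge : theory_of_large_fields T).

Definition pull_interp (L1 : lang) (rL : relational L1) (A B : Type) (g : A -> B)
    (e : interp L1 B) : interp L1 A :=
  @Interp L1 A (fun f _ => False_rect A (rL f)) (fun r a => rint e (fun k => g (a k))).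

Lemma pull_embedding (L1 : lang) (rL : relational L1) (A : fieldType) (N : lfield L1)
  (g : {rmorphism A -> N}) :
  embedding (A := LField (pull_interp rL g (litp N))) (B := N) g.
Proof.
split; first exact: fmorph_inj.
- by rewrite /= rmorph0 rmorph1.
- split=> [x|x y] /=; first by rewrite rmorphN.
  by rewrite rmorphD rmorphM.
- by move=> f; case: (rL f).
- by [].
Qed.

(* The function field F of V embeds in every N i, and the structures of the N i
   pull back to F; condition (i) applies to F. *)
Lemma fusion (V : kfunctor K) (c0 : chart V)
  (N : forall i, kmodel (@TI i) (LField (eI i)))
  (f : forall i, khom (cring c0) (fk (mstr (N i)))) (r0 : cring c0)
  (Q : finType) (ix : Q -> I) (c : Q -> chart V)
  (th : forall k, kformula (LI (ix k)) K (cdim (c k))) :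
  cond_i T TI eL eI -> variety V -> geom_integral V ->
  totally_variety T (K := LField eL) V -> (1 : cring c0) != 0 ->
  (forall i r, f i r = 0 -> r = 0) -> r0 <> 0 -> (forall k, qfree (th k)) ->
  (forall k, exists2 v, coords (c := c k) (pmap V (f (ix k)) (cmap c0)) v &
     ksat (M := N (ix k)) (mstr (N (ix k))) (th k) v) ->
  exists g : khom (cring c0) (fk (idfun : {rmorphism K -> K})), g r0 <> 0 /\
    forall k, exists2 v, coords (c := c k) (pmap V g (cmap c0)) v &
     ksat (M := LField (eI (ix k))) idfun (th k) v.
Proof.
move=> ci vV gV tV R1 f0 r00 qth hth.
have [sV _ _ iV] := vV; have ou := chart_open c0; have ga := @chart_gen _ _ c0.
case: c0 f r0 R1 f0 r00 hth ou ga => R u n a ou' ga' /= f r0 R1 f0 r00 hth ou ga.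
have dR : domain R by split=> // x y; apply: (iV.2 R u ou).
have [F [io0 [io00 frac]]] := frac_field dR.
pose j : {rmorphism K -> F} := io0 \o kstr R.
pose io : khom R (fk j) := @KHom K R (fk j) io0 (fun=> erefl).
have ioinj : injective io.
  by move=> x y e; apply/eqP; rewrite -subr_eq0; apply/eqP/io00; rewrite rmorphB -[X in X - _]/(io x) e subrr.
have /dchoice[g gE] : forall i, exists g : {rmorphism F -> N i}, forall r, g (io r) = f i r.
  by move=> i; apply: (frac_ext io00 frac (f0 i)).
have gj i c' : g i (j c') = mstr (N i) c' by rewrite [LHS]gE khomP.
pose e i : interp (LI i) F := pull_interp (@hrel i) (g i) (litp (N i)).
pose FF := LField (iunion e).
have eg i : embedding (A := LField (e i)) (B := N i) (g i) by apply: pull_embedding.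
have ec : exist_closed (K := LField (iunion eI)) (F := FF) j.
  apply: ci.
  - split; first exact: fmorph_inj.
    + by split; [apply: (rmorph0 j)|apply: (rmorph1 j)].
    + split=> [x|x y]; first exact: (rmorphN j).
      by split; [apply: (rmorphD j)|apply: (rmorphM j)].
    + by move=> [i s]; case: (hrel s).
    + move=> [i s] x /=.
      have eN : embedding (A := LField (eI i)) (B := N i) (mstr (N i)) by case: (N i).
      have [_ _ _ _ hr] := eN; rewrite [rint (eI i) _]hr.
      by rewrite (_ : (fun k => mstr (N i) (x k)) = fun k => g i (j (x k))) //;
        apply/funext => k; rewrite gj.
  - move=> i phi [uphi hphi] v; have red := ired_iunion e i.
    rewrite [litp FF]/(iunion e) red.
    apply: (@embedding_universal _ (LField (e i)) (N i) (g i) 0 phi v (eg i) uphi).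
    apply: hphi.
    by case: (N i).
  - apply: (regular_frac ga ioinj frac) => // E jE RE i bi.
    have RE1 : (1 : RE) != 0.
      apply: contraNneq R1 => e1; apply/eqP; apply: (base_inj bi).
      by rewrite rmorph1.
    by split=> // x y; apply: (gV E jE).2 _ _ (base_open bi ou) RE1 x y.
  - move=> M; have dM := large_dense hlarge vV gV tV (M := M).
    have [||B|U uU BU] := @ultra_exists (khom R (fk (mstr M)))
        [set B | exists2 r : R, r <> 0 & B = [set h : khom R (fk (mstr M)) | h r <> 0]]%classic.
    + by exists [set h : khom R (fk (mstr M)) | h 1 <> 0]%classic; exists 1 => //; apply/eqP.
    + move=> _ [r rn0 ->].
      by have [h [_ hr]] := zdense_chart sV (is_field_fk _) dM ou rn0; exists h.
    + move=> _ [r rn0 ->] [r' rn0' ->].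
      exists [set h : khom R (fk (mstr M)) | h (r * r') <> 0]%classic.
        by exists (r * r') => //; move=> /(dR.2)[].
      move=> h /= hrr; split=> /= hr; apply: hrr; rewrite rmorphM hr ?mul0r ?mulr0 //.
    have [|N' [d [f' [ed f'0 _]]]] := @ultra_point L K M (mstr M) V R u U uU.
      by move=> r rn0; apply: BU; exists r.
    have [g' g'E] := frac_ext io00 frac f'0.
    exists N', d, g'; split=> // c'.
    by rewrite [LHS]g'E khomP.
(* The formula th k uses coordinates in its own chart c k; s k is a function on u that is nonzero at
   the given point and off whose zeros these coordinates exist. *)
have /choice[s sP] : forall k, exists s : R, s <> 0 /\ forall B (h : khom R B),
    (exists b, h s * b = 1) -> exists v, coords (c := c k) (pmap V h u) v.
  move=> k; have [v cv _] := hth k.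
  have yv : yoneda (cmap (c k)) (pmap V (f (ix k)) u) by have [h [hE _]] := cv; exists h.
  have [s [q [al [s0 hs]]]] := chart_denoms (is_field_fk _) yv.
  exists s; split; first by move=> s0'; apply: s0; rewrite s0' rmorph0.
  by move=> B h /hs[w cw _]; exists w.
(* D is R with r0 and all s k inverted: a K-point of D is a point of u where r0 does not vanish and
   which lies in every chart c k. *)
pose l : seq F := [seq io (a k) | k <- enum 'I_n] ++
  (io r0)^-1 :: [seq (io (s k) : F)^-1 | k <- enum Q].
have [D [i [b [ii gb ib iE]]]] := gen_kalg (A := fk j) (fun k : 'I_(size l) => l`_k : fk j).
have rl x : x \in l -> exists d, i d = x.
  move=> xl; have hx : (index x l < size l)%N by rewrite index_mem.
  by exists (b (Ordinal hx)); rewrite ib /= nth_index.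
have [rd rdE] : exists rd : khom R D, forall r, i (rd r) = io r.
  apply: khom_factor => //; apply: ga => [c'|k|x y [dx xE] [dy yE]].
  - by exists (kstr D c'); rewrite !khomP.
  - by apply: rl; rewrite mem_cat; apply/orP; left; apply/mapP; exists k; rewrite ?mem_enum.
  - by split; [exists (dx + dy); rewrite !rmorphD xE yE|
      exists (dx * dy); rewrite !rmorphM xE yE].
have unitD r : r <> 0 -> (io r : F)^-1 \in l -> exists d, rd r * d = 1.
  move=> rn0 /rl[d dE]; exists d; apply: ii.
  rewrite rmorphM rdE dE rmorph1; apply: mulfV.
  by apply/eqP => /io00.
have /dchoice[w wP] : forall k, exists w, coords (c := c k) (pmap V rd u) w.
  move=> k; have [s0 hs] := sP k; apply: hs; apply: unitD => //.
  rewrite mem_cat inE; apply/orP; right; apply/orP; right.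
  by apply/mapP; exists k; rewrite ?mem_enum.
have /dchoice[th' /dchoice[qth' thE]] : forall k, exists th' : kformula (lunion LI) K (size l),
    exists _ : qfree th', forall (N : lfield (lunion LI)) (h : {rmorphism K -> N})
      (e1 : interp (LI (ix k)) (ring_of N)) (f : khom D (fk h)),
      reduct (lsub LI (ix k)) e1 (litp N) ->
      ksat (M := N) h th' (fun l => f (b l)) <->
      ksat (M := Structure e1) h (th k) (fun l => f (w k l)).
  move=> k; have [th' q' h] := pull_formula gb (lsub LI (ix k)) (w k) (qth k).
  by exists th', q'.
have [|g1 g1E] := @ec_point (lunion LI) (LField (iunion eI)) FF j D _ b i Q th' ec gb qth'.
  move=> k; apply/(thE k FF j (ired (iunion e) (ix k)) i (reduct_sub _ _)).
  rewrite ired_iunion.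
  apply: (iffRL (@ksat_embedding _ K (LField (e (ix k))) (N (ix k)) j (g (ix k)) _
    (th k) (fun l => i (w k l)) (eg (ix k)) (qth k))).
  have [v cv hv] := hth k.
  have -> : (fun x => g (ix k) (j x)) = mstr (N (ix k)) by apply/funext => x; rewrite gj.
  suff -> : (fun x => g (ix k) (i (w k x))) = v by [].
  apply: (fun cw => coords_uniq cw cv); have [h [hE wE]] := wP k.
  have g'P x : g (ix k) (i (kstr D x)) = kstr (fk (mstr (N (ix k)))) x.
    by rewrite khomP -[RHS]gj.
  pose g' : khom D (fk (mstr (N (ix k)))) :=
    @KHom K D (fk (mstr (N (ix k)))) (g (ix k) \o (i : {rmorphism D -> F})) g'P.
  exists (kcomp g' h); split; last by move=> x; rewrite wE.
  rewrite pmap_kcomp hE -pmap_kcomp; apply: pmap_ext => x /=.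
  by rewrite rdE -gE.
exists (kcomp g1 rd); split.
  have [|d dE] := unitD r0 r00; first by rewrite mem_cat inE eqxx orbT.
  move=> /= h0; have := congr1 g1 dE; rewrite rmorphM h0 mul0r rmorph1 => /esym/eqP.
  by apply/negP; apply: oner_neq0.
move=> k; exists (fun x => g1 (w k x)).
  have [h [hE wE]] := wP k; exists (kcomp g1 h); split; last by move=> x; rewrite wE.
  by rewrite !pmap_kcomp hE.
have := iffLR (thE k (LField (iunion eI)) idfun _ g1 (reduct_sub _ _)) (g1E k).
by rewrite ired_iunion.
Qed.

End Fusion.

(** * From (i) to (ii), (iii) and (iv) *)

Lemma finite_enum (I : Type) (S : set I) : finite_set S ->
  exists n (e : 'I_n -> I), forall i, S i <-> exists k, e k = i.
Proof.
move=> fS; have /finite_seqP[s sE] : finite_set (S : set {classic I}) by [].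
exists (size s), (tnth (in_tuple s)) => i; rewrite sE /=; split=> [si|[k <-]].
  by have /tnthP[k ->] : i \in in_tuple s := si; exists k.
exact: (mem_tnth k (in_tuple s)).
Qed.

Lemma ultra_ex (J : Type) (U : set (set J)) r (P : 'I_r -> set J) : ultra U ->
  U [set s | exists k, P k s]%classic -> exists k, U (P k).
Proof.
move=> uU; elim: r P => [|r IH] P h.
  by case: (ultra0 uU); apply: (ultraS uU _ h) => s [[]].
have [||h'] := ultra_or uU (A := P ord0)
    (B := [set s | exists k, P (lift ord0 k) s]%classic).
- apply: (ultraS uU _ h) => s [k]; case: (unliftP ord0 k) => [k' ->|->] hs; last by left.
  by right; exists k'.
- by exists ord0.
- by have [k hk] := IH _ h'; exists (lift ord0 k).
Qed.

(** Since R is a domain, the sets of points of S off the zeros of a nonzero function are closed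
    under finite intersection up to refinement; density makes them nonempty. *)
Lemma dense_ultra (K : fieldType) (V : kfunctor K) (A R : kalg K) (u : V R)
  (S : set (V A)) : scheme V -> is_field A -> zdense S -> open_immersion u ->
  domain R ->
  exists2 U : set (set (khom R A)), ultra U &
    forall r, r <> 0 -> U [set g : khom R A | S (pmap V g u) /\ g r <> 0]%classic.
Proof.
move=> sV fA dS ou dR.
have [||B|U uU BU] := @ultra_exists (khom R A) [set B | exists2 r : R, r <> 0 &
    B = [set g : khom R A | S (pmap V g u) /\ g r <> 0]]%classic.
- exists [set g : khom R A | S (pmap V g u) /\ g 1 <> 0]%classic; exists 1 => //.
  by apply/eqP; case: dR.
- by move=> _ [r r0 ->]; apply: zdense_chart.
- move=> _ [r r0 ->] [r' r0' ->].
  exists [set g : khom R A | S (pmap V g u) /\ g (r * r') <> 0]%classic.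
    by exists (r * r') => // /(dR.2)[].
  by move=> g /= [Sg h]; split; split=> // hr; apply: h; rewrite rmorphM hr ?mul0r ?mulr0.
- by exists U => // r r0; apply: BU; exists r.
Qed.

Section Consequences.
Context (L : lang) (T : theory L) (I : Type) (LI : I -> lang)
  (TI : forall i, theory (LI i)) (hrel : forall i, relational (LI i)).
Context (K : fieldType) (eL : interp L K) (eI : forall i, interp (LI i) K).
Context (hlarge : theory_of_large_fields T).

Lemma cond_i_ii : cond_i T TI eL eI -> cond_ii T TI eL eI false.
Proof.
move=> ci V [vV gV tV _] c p cp gp.
have [sV _ _ iV] := vV; have [c0 R1] := chart_exists vV.
have H i : exists N : kmodel (@TI i) (LField (eI i)),
    exists f : khom (cring c0) (fk (mstr N)), (forall r, f r = 0 -> r = 0) /\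
    exists2 v, coords (c := c i) (pmap V f (cmap c0)) v &
      forall phi, p i phi -> ksat (M := N) (mstr N) phi v.
  have [_ _ [N [v hv]]] := cp i; have [x [cx gx]] := gp i N v hv.
  have [f fE f0] := generic_open sV (is_field_fk _) (chart_open c0) R1 gx.
  by exists N, f; split=> //; exists v; rewrite ?fE.
have [N /dchoice[f fP]] := dchoice H.
set R := cring c0 in f fP R1 *; set u := cmap c0 in f fP R1 *.
have ou : open_immersion u := chart_open c0.
have dR : domain R by split=> // x y; apply: (iV.2 R u ou).
pose J := khom R (fk (idfun : {rmorphism K -> K})).
(* The K-points of the chart c0 that satisfy finitely many formulas of the types and avoid the zeros
   of r. [fusion] makes these sets nonempty, and sums of index types and products of functions
   refine their intersections. *)
pose W (Q : finType) (ix : Q -> I)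
    (th : forall k, kformula (LI (ix k)) K (cdim (c (ix k)))) (r : R) : set J :=
  [set g : J | g r <> 0 /\ forall k, exists2 v, coords (c := c (ix k)) (pmap V g u) v &
    ksat (M := LField (eI (ix k))) idfun (th k) v]%classic.
pose ix0 (k : void) : I := match k with end.
pose th0 (k : void) : kformula (LI (ix0 k)) K (cdim (c (ix0 k))) := match k with end.
have [||B|U uU BU] := @ultra_exists J [set B | exists Q ix th r,
    [/\ r <> 0, forall k, p (ix k) (th k) & B = @W Q ix th r]]%classic.
- exists (@W void ix0 th0 1).
  exists void, ix0, th0, 1.
  by split=> //; apply/eqP.
- move=> _ [Q [ix [th [r [r0 pth ->]]]]].
  apply: (fusion hrel hlarge (N := N) (f := f) ci vV gV tV R1 _ r0) => [i|k|k].
  + by have [] := fP i.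
  + by have [h _ _] := cp (ix k); apply: h.
  + by have [_ [v cv hv]] := fP (ix k); exists v => //; apply: hv.
- move=> _ [Q [ix [th [r [r0 pth ->]]]]] [Q' [ix' [th' [r' [r0' pth' ->]]]]].
  pose jx (k : Q + Q') := match k with inl k => ix k | inr k => ix' k end.
  pose jth (k : Q + Q') : kformula (LI (jx k)) K (cdim (c (jx k))) :=
    match k with inl k => th k | inr k => th' k end.
  exists (@W (Q + Q')%type jx jth (r * r')).
    exists (Q + Q')%type, jx, jth, (r * r'); split=> //; last by case.
    by move=> /(dR.2)[].
  move=> g [gr hg]; split; split.
  + by move=> h; apply: gr; rewrite rmorphM h mul0r.
  + by move=> k; apply: (hg (inl k)).
  + by move=> h; apply: gr; rewrite rmorphM h mulr0.
  + by move=> k; apply: (hg (inr k)).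
have one0 : (1 : R) <> 0 by apply/eqP.
have [|Ks [d [f' [ed _ fU]]]] := @ultra_point _ K (LField (isum eL (iunion eI)))
    (idfun : {rmorphism K -> K}) V R u U uU.
  move=> r r0; apply: (ultraS uU _ (BU (@W void ix0 th0 r) _)); first by move=> g [].
  by exists void, ix0, th0, r; split=> // -[].
have key i phi : p i phi -> exists2 v, coords (c := c i) (pmap V f' u) v &
    ksat (M := LField (ired (isumr (litp Ks)) i)) (d \o idfun) phi v.
  move=> pphi; have qphi : qfree phi by have [h _ _] := cp i; apply: h.
  have [|v cv hv] := fU (c i) (qtrans (lmpar (lbig L LI i) K) phi (@Var _ _)).
    apply: (ultraS uU _ (BU (@W unit (fun=> i) (fun=> phi) 1) _)); last first.
      by exists unit, (fun=> i), (fun=> phi), 1.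
    move=> g [_ /(_ tt)[v cv hv]]; exists v => //.
    apply/(ksat_trans (mu := lbig L LI i) _ _ _ (reduct_big _ _) qphi).
    by rewrite /= isumr_isum ired_iunion.
  exists v => //.
  by have := iffLR (ksat_trans (mu := lbig L LI i) _ _ _ (reduct_big _ _) qphi) hv.
exists Ks, (d \o idfun); split=> //.
exists (pmap V f' u) => i.
have [_ cmp _] := cp i.
(* A complete type decides [Bot], so p i is nonempty and the point does lie in the chart c i; its
   coordinates there are unique, hence common to all formulas of p i. *)
have [phi0 pphi0] : exists phi, p i phi.
  by have [h|h] := cmp (Bot _ _) isT; [exists (Bot _ _)|exists (Not (Bot _ _))].
have [v cv _] := key i _ pphi0; exists v => // phi /key[v' cv' hv'].
by rewrite (coords_uniq cv cv').
Qed.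

End Consequences.

Section Intersection.
Context (L : lang) (T : theory L) (I : Type) (LI : I -> lang)
  (TI : forall i, theory (LI i)) (hrel : forall i, relational (LI i)).
Context (K : fieldType) (eL : interp L K) (eI : forall i, interp (LI i) K).
Context (hlarge : theory_of_large_fields T).
Context (hexp : forall i, expandable T (@TI i) eL (eI i)).
Context (M : forall i, kmodel (@TI i) (LField (eI i))).

(** Density depends only on the field, so it may be proved for the expansion of M i to a model of
    T. *)
Lemma model_dense i V : variety V -> geom_integral V ->
  totally_variety T (K := LField eL) V ->
  zdense (X := V) (A := fk (mstr (M i))) setT.
Proof.
move=> vV gV tV; case: (M i) => N s eN mN /=.
have [e [me ee]] := hexp mN eN.
exact: (large_dense (M := @KModel L T (LField eL) (LField e) s ee me) hlarge vV gV tV).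
Qed.

Lemma dense_generic i (V : kfunctor K) (c0 : chart V) (X : set (fpts (mstr (M i)) V)) :
  variety V -> (1 : cring c0) != 0 -> zdense (X := V) (A := fk (mstr (M i))) X ->
  exists (N : kmodel (@TI i) (LField (eI i))) (f : khom (cring c0) (fk (mstr N)))
    (c : chart V) (th : kformula (LI i) K (cdim c)),
  [/\ qfree th, forall r, f r = 0 -> r = 0 &
    definable X ->
      (exists2 v, coords (c := c) (pmap V f (cmap c0)) v & ksat (M := N) (mstr N) th v) /\
      forall (x : fpts (mstr (M i)) V) v, coords (c := c) x v ->
        ksat (M := M i) (mstr (M i)) th v -> X x].
Proof.
move=> vV R1 dX; have [sV _ _ iV] := vV.
have dR : domain (cring c0).
  by split=> // x y; apply: (iV.2 _ _ (chart_open c0)).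
have [U uU hU] := dense_ultra sV (is_field_fk _) dX (chart_open c0) dR.
have [|N [d [f [ed f0 fP]]]] := ultra_point (cmap c0) uU.
  by move=> x x0; apply: (ultraS uU _ (hU x x0)) => g [].
have [eM mM] : embedding (A := LField (eI i)) (B := M i) (mstr (M i)) /\
    models (M i) (@TI i) by case: (M i).
have eN : embedding (A := LField (eI i)) (B := N) (d \o mstr (M i)).
  exact: (embedding_comp (elementary_embedding ed) eM).
exists (KModel eN (elementary_models ed mM)), f.
(* A dense set that is not definable still gives a generic point, here paired with a trivial
   formula: indices outside I0 need a generic point too. *)
have [[r [c [phi [qphi XE]]]]|nd] := pselect (definable X); last first.
  by exists c0, (Not (Bot _ _)); split.
have [k hk] : exists k, U [set g : khom (cring c0) (fk (mstr (M i))) |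
    exists2 v, coords (c := c k) (pmap V g (cmap c0)) v &
      ksat (M := M i) (mstr (M i)) (phi k) v]%classic.
  apply: (ultra_ex uU); apply: (ultraS uU _ (hU 1 _)); last exact/eqP.
  by move=> g [/XE[k [v [cv hv]]] _]; exists k, v.
exists (c k), (phi k); split=> // _; split; first exact: fP.
by move=> x v cv hv; apply/XE; exists k, v.
Qed.

Lemma cond_i_iii : cond_i T TI eL eI -> cond_iii T eL M false true.
Proof.
move=> ci V [vV gV tV _] I0 fI0 X hX XK [Z [pZ XZ]].
have [sV _ _ iV] := vV; have [c0 R1] := chart_exists vV.
(* A K-point in all the X i at which r is nonzero contradicts the inclusion in Z, so density comes
   from the freedom to choose r0 in [fusion]. *)
have [r r0 rP] := proper_open_fun sV iV pZ (chart_open c0) R1.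
have H i : exists N : kmodel (@TI i) (LField (eI i)),
    exists f : khom (cring c0) (fk (mstr N)), (forall r, f r = 0 -> r = 0) /\
    exists c : chart V, exists th : kformula (LI i) K (cdim c), qfree th /\
    (I0 i -> (exists2 v, coords (c := c) (pmap V f (cmap c0)) v & ksat (M := N) (mstr N) th v) /\
      forall (x : fpts (mstr (M i)) V) v, coords (c := c) x v ->
        ksat (M := M i) (mstr (M i)) th v -> X i x).
  have [Ii|nIi] := pselect (I0 i).
    have [dX zX] := hX i Ii.
    have [N [f [c [th [qth f0 hv]]]]] := dense_generic vV R1 zX.
    by exists N, f; split=> //; exists c, th; split=> // _; apply: hv.
  have [N [f [c [th [qth f0 hv]]]]] := dense_generic vV R1 (model_dense (i := i) vV gV tV).
  by exists N, f; split=> //; exists c, th.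
have [N /dchoice[f /all_and2[f0 /dchoice[c /dchoice[th /all_and2[qth hth]]]]]] := dchoice H.
have [m [e eE]] := finite_enum fI0.
have Ie k : I0 (e k) by apply/eE; exists k.
have [|g [gr hg]] := @fusion L T I LI TI hrel K eL eI hlarge V c0 N f r 'I_m e
    (fun k => c (e k)) (fun k => th (e k)) ci vV gV tV R1 f0 r0 (fun k => qth (e k)).
  by move=> k; have [] := hth _ (Ie k).
pose g1 : khom (cring c0) (kself K) :=
  @KHom K (cring c0) (kself K) g (fun a => khomP g a).
apply: gr; apply: (rP _ g1); apply: XZ => i Ii.
have [k ek] := (eE i).1 Ii; subst i.
have [v cv hv] := hg k; have [_ hx] := hth _ Ii.
apply: (hx _ (fun k0 => mstr (M (e k)) (v k0))).
  have [h [hE vE]] := cv.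
  pose h1 : khom (cring (c (e k))) (kself K) :=
    @KHom K (cring (c (e k))) (kself K) h (fun a => khomP h a).
  exists (kcomp (kext (mstr (M (e k)))) h1); split; last by move=> x /=; rewrite vE.
  have -> : pmap V g1 (cmap c0) = pmap V h1 (cmap (c (e k))).
    (* The identity, between two presentations of K as an algebra over itself. *)
    pose b : khom (fk (idfun : {rmorphism K -> K})) (kself K) :=
      @KHom K (fk (idfun : {rmorphism K -> K})) (kself K) idfun (fun=> erefl).
    have := congr1 (pmap V b) hE; rewrite -!pmap_kcomp => hb.
    rewrite (@pmap_ext _ V _ _ g1 (kcomp b g)) // -hb.
    exact: pmap_ext.
  by rewrite pmap_kcomp.
have eM : embedding (A := LField (eI (e k))) (B := M (e k)) (mstr (M (e k))) by case: (M _).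
exact: (iffLR (@ksat_embedding _ K (LField (eI (e k))) (M (e k)) idfun
  (mstr (M (e k))) _ (th (e k)) v eM (qth (e k))) hv).
Qed.

End Intersection.

(** * The affine line as an admissible variety *)

Section AffineLine.

Definition polalg (K : fieldType) : kalg K :=
  @KAlg K {poly K} (@polyC K : {rmorphism K -> {poly K}}).

Lemma polalg_gen (K : fieldType) : @generates K (polalg K) 1 (fun=> 'X).
Proof.
move=> S SC SX Sop; elim/poly_ind => [|p c Sp]; first by have := SC 0; rewrite rmorph0.
have [_ SpX] := Sop _ _ Sp (SX ord0).
by have [h _] := Sop _ _ SpX (SC c).
Qed.

Lemma polalg_domain (K : fieldType) : domain (polalg K).
Proof.
split=> [|x y]; first exact: oner_neq0.
by move/eqP; rewrite mulf_eq0 => /orP[/eqP|/eqP]; [left|right].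
Qed.

Lemma polalg_hom (K : fieldType) (A : kalg K) (x : A) :
  exists f : khom (polalg K) A, f 'X = x.
Proof.
exists (@KHom K (polalg K) A (evp (kstr A) x) (fun c => evpC (kstr A) x c)).
exact: evpX.
Qed.

Lemma polalg_smooth (K : fieldType) : formally_smooth_alg (polalg K).
Proof.
move=> B C pi pis _ y; have [b bE] := pis (y 'X).
have [z zX] := polalg_hom b; exists z.
by apply: (gen_eq (f := kcomp pi z) (@polalg_gen K)) => _ /=; rewrite zX.
Qed.

(** Identifies the base change of K[X] with E[X], a domain for every E; this gives geometric
    integrality of the line. *)
Lemma polalg_base (K E : fieldType) (j : {rmorphism K -> E}) :
  exists i : khom (polalg K) (kres j (polalg E)), is_base_ring i.
Proof.
have [i iX] := polalg_hom ('X : kres j (polalg E)).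
have iE p : i p = map_poly j p.
  pose i' : khom (polalg K) (kres j (polalg E)) :=
    @KHom K (polalg K) (kres j (polalg E)) (map_poly j) (fun c => map_polyC j c).
  apply: (gen_eq (g := i') (@polalg_gen K)) => _.
  by rewrite iX /= map_polyX.
exists i; split.
- move=> A f; have [f' f'X] := polalg_hom (f 'X : A); exists f'.
  apply: (gen_eq (f := kcomp (kres_hom j f') i) (@polalg_gen K)) => _ /=.
  by rewrite iX.
- move=> A f g fg; apply: (gen_eq (@polalg_gen E)) => _.
  by have := fg 'X; rewrite iX.
- move=> n a ga S SC Sa Sop.
  have Si r : S (i r).
    move: r; apply: (ga (fun r => S (i r))) => [c|//|x y Sx Sy].
      by rewrite khomP; apply: SC.
    by rewrite rmorphD rmorphM; apply: Sop.
  by apply: (@polalg_gen E S SC) => // _; rewrite -iX.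
- move=> m e x ie ex k; apply/polyP => l; rewrite coef0.
  apply: (ie (fun k => (x k : {poly K})`_l)).
  have := congr1 (fun p : {poly E} => p`_l) ex; rewrite coef0 coef_sum; apply: etrans.
  by apply: eq_bigr => k' _; rewrite iE /= coefCM coef_map mulrC.
Qed.

Lemma affine_line_admissible (L : lang) (T : theory L) (K : fieldType)
  (eL : interp L K) : admissible T eL false (spec (polalg K)).
Proof.
split=> //; first exact: spec_variety (@polalg_gen K) (@polalg_domain K).
- move=> E j; have [i bi] := polalg_base j.
  exact: (represents_integral (base_represents bi (spec_represents (polalg K)))
    (@polalg_domain E)).
- move=> M; have [x _] := polalg_hom (0 : fk (mstr M)).
  by exists x; apply: spec_smooth_point; apply: polalg_smooth.
Qed.

End AffineLine.

Section DefinableClosure.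
Context (L : lang) (T : theory L) (I : Type) (LI : I -> lang)
  (TI : forall i, theory (LI i)).
Context (K : fieldType) (eL : interp L K) (eI : forall i, interp (LI i) K).
Context (M : forall i, kmodel (@TI i) (LField (eI i))).

(** If a were transcendental over K, then {a} would be a definable dense subset of the affine line.
    Condition (iii) would give it a K-point, and a would come from K. *)
Lemma dcl_algebraic i a : cond_iii T eL M false false -> dcl (M := M i) a ->
  algebraicOver (mstr (M i)) a.
Proof.
move=> c3 [phi qphi hphi]; apply: contrapT => na.
pose V := spec (polalg K).
pose Xi : set (fpts (mstr (M i)) V) :=
  [set x : khom (polalg K) (fk (mstr (M i))) | x 'X = a]%classic.
(* The condition asks for a set at every index; Xi is transported along i = i', and the value
   elsewhere is arbitrary. *)
pose X i' : set (fpts (mstr (M i')) V) :=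
  match pselect (i = i') with
  | left e => match e in _ = i0 return set (fpts (mstr (M i0)) V) with erefl => Xi end
  | right _ => setT
  end.
have XE : X i = Xi.
  by rewrite /X; case: pselect => // e; rewrite (Prop_irrelevance e erefl).
have adV := affine_line_admissible T eL.
have vV : variety V by case: adV.
have [x0 x0X] := polalg_hom (a : fk (mstr (M i))).
have h1 : zdense (X := V) (A := fk (mstr (M i))) Xi.
  move=> [Z [[cZ [A [y ny]]] ZX]].
  have [S SP] := cZ (polalg K) (kid (polalg K)).
  have [s [Ss s0]] : exists s, S s /\ s <> 0.
    apply: contrapT => h; apply: ny.
    have -> : y = pmap V y (kid (polalg K)) by apply: khom_eq.
    apply/SP => s Ss; have -> : s = 0 by apply: contrapT => s0; apply: h; exists s.
    exact: rmorph0.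
  have Zx0 : Z (fk (mstr (M i))) (pmap V x0 (kid (polalg K))).
    by apply: ZX; apply: x0X.
  have xs := iffLR (SP _ x0) Zx0 s Ss.
  apply: na; exists s; first exact/eqP.
  have := gen_eq (f := x0) (g := @KHom K (polalg K) (fk (mstr (M i)))
    (evp (mstr (M i)) a) (fun c => evpC (mstr (M i)) a c)) (@polalg_gen K).
  rewrite /root -[_.[_]]evp_horner => <-; first exact/eqP.
  by move=> _; rewrite x0X /= evpX.
have dX : definable Xi.
  pose c := @Chart K V (polalg K) (kid (polalg K)) 1 (fun=> 'X)
    (represents_open (spec_represents _)) (@polalg_gen K).
  exists 1%N, (fun=> c), (fun=> phi); split=> // x; split.
    move=> xX; exists ord0, (fun=> a); split; last exact/hphi.
    by exists x; split; [apply: khom_eq|move=> k; exact: esym xX].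
  move=> [_ [v [[f [fE vE]] hv]]].
  have -> : x = f by rewrite -fE; apply: khom_eq.
  by apply/hphi; rewrite (_ : (fun=> f 'X) = v) //; apply/funext => k; rewrite vE.
have [|x xX] := c3 V adV [set i]%classic (finite_set1 i) X.
  by move=> _ ->; rewrite XE.
have := xX i erefl; rewrite /rational_points /= XE => xa.
apply: na; rewrite -xa; exists ('X - (x 'X)%:P); first by rewrite polyXsubC_eq0.
by rewrite rmorphB /= map_polyX map_polyC root_XsubC.
Qed.

End DefinableClosure.

(** * From (iv) to (iii) *)

Lemma sum_term (L : lang) n (C : Type) m (t : 'I_n -> term (params L C) m) :
  exists s, forall (N : lfield L) (h : C -> N) v,
    eval (M := sparams (M := N) h) v s =
    \sum_k (eval (M := sparams (M := N) h) v (t k) : N).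
Proof.
elim: n t => [|n IH] t; first by exists (Zero _ _) => N h v; rewrite big_ord0.
have [s sE] := IH (fun k => t (lift ord0 k)).
by exists (Add (t ord0) s) => N h v; rewrite big_ord_recl -sE.
Qed.

Section DenseOver.
Context (L : lang) (T : theory L) (qe : qelim T) (K : lfield L) (M : kmodel T K).

Let mT : models M T.
Proof. by case: M. Qed.

(* The coefficients of a normalized relation that is the only one satisfied on
   the definable set phi of homomorphisms are definable. *)
Lemma dcl_relation (R : kalg K) na (a : 'I_na -> R) (phi : kformula L K na)
  n (x : 'I_n -> R) (m : 'I_n -> M) k0 :
  generates a -> qfree phi -> m k0 = 1 ->
  (forall m' : 'I_n -> M, m' k0 = 1 /\
     (forall g : khom R (fk (mstr M)),
        ksat (M := M) (mstr M) phi (fun l => g (a l)) ->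
        \sum_k m' k * (g (x k) : M) = 0) <-> m' = m) ->
  forall k, dcl (M := M) (m k).
Proof.
move=> ga qphi mk0 mU k.
have [chi qchi chiE] := hom_formula L ga.
have /choice[t tE] := fun k => elem_term L ga (x k).
(* The variables are laid out as the na coordinates of a point, the n coefficients of a relation,
   and one value b. *)
pose y (l : 'I_na) : term (params L K) (na + (n + 1)) := Var _ (lshift _ l).
pose w (l : 'I_n) : term (params L K) (n + 1) := Var _ (lshift 1 l).
pose w' (l : 'I_n) : term (params L K) (na + (n + 1)) := Var _ (rshift na (lshift 1 l)).
have [s sE] := sum_term (fun k => Mul (w' k) (ttrans (lid (params L K)) y (t k))).
(* D says that the relation with the given coefficients holds at all points satisfying phi, and Psi
   that b is the k-th coefficient of a normalized such relation. Quantifier elimination then puts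
   Psi in the form required by [dcl]. *)
pose D := alln (n := na) (Imp (Conj (qtrans (lid (params L K)) chi y)
    (qtrans (lid (params L K)) phi y)) (Eqn s (Zero _ _))).
pose Psi := Not (alln (n := n) (Not (Conj D
  (Conj (Eqn (w k0) (One _ _)) (Eqn (w k) (Var _ (rshift n ord0))))))).
have yE (v : 'I_na -> M) (u : 'I_(n + 1) -> M) :
    (fun l => eval (M := sparams (M := M) (mstr M)) (vcat v u) (y l)) = v.
  by apply/funext => l /=; rewrite vcatl.
have qE (ph : kformula L K na) v u : qfree ph ->
    ksat (M := M) (mstr M) (qtrans (lid (params L K)) ph y) (vcat v u) <->
    ksat (M := M) (mstr M) ph v.
  move=> qph; have := @qtrans_sat _ _ (lid (params L K)) (rst (sparams (M := M) (mstr M)))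
    _ _ (reduct_id (itp (sparams (M := M) (mstr M)))) _ ph _ y (vcat v u) qph.
  move=> h; apply: (iff_trans h); rewrite -[in X in _ <-> X](yE v u).
  exact: iff_refl.
have tsE v u l : eval (M := sparams (M := M) (mstr M)) (vcat v u)
    (ttrans (lid (params L K)) y (t l)) = eval (M := sparams (M := M) (mstr M)) v (t l).
  have := @ttrans_eval _ _ (lid (params L K)) (rst (sparams (M := M) (mstr M)))
    _ _ (reduct_id (itp (sparams (M := M) (mstr M)))) _ _ y (t l) (vcat v u).
  by move=> h; apply: (etrans h); rewrite -[in RHS](yE v u).
have DE (u : 'I_n -> M) b : ksat (M := M) (mstr M) D (vcat u (fun=> b)) <->
    forall g : khom R (fk (mstr M)), ksat (M := M) (mstr M) phi (fun l => g (a l)) ->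
        \sum_k u k * (g (x k) : M) = 0.
  rewrite /ksat sat_alln; split=> [h g Sg|h v /sat_Conj[hc hp]].
    have hc : sat (sparams (M := M) (mstr M)) (Conj (qtrans (lid (params L K)) chi y)
        (qtrans (lid (params L K)) phi y)) (vcat (fun l => g (a l)) (vcat u (fun=> b))).
      apply/sat_Conj; split; last exact: (iffRL (qE _ _ _ qphi)).
      by apply: (iffRL (qE _ _ _ qchi)); apply/(chiE M (mstr M)); exists g.
    have := h _ hc; rewrite /= (sE M (mstr M)) => e; rewrite -[RHS]e.
    apply: eq_bigr => l _ /=; rewrite vcatr vcatl; congr (_ * _).
    by rewrite tsE tE.
  have [g gE] := iffLR (chiE M (mstr M) v) (iffLR (qE _ _ _ qchi) hc).
  have vE : v = fun l => g (a l) by apply/funext => l; rewrite gE.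
  rewrite /= (sE M (mstr M)) -[RHS](h g) -?vE; last exact: (iffLR (qE _ _ _ qphi) hp).
  apply: eq_bigr => l _ /=; rewrite vcatr vcatl; congr (_ * _).
  by rewrite tsE vE tE.
have [psi qpsi psiE] := qelim_params (0 : K) Psi qe.
exists psi => // b; rewrite -psiE //.
have E2 (u : 'I_n -> M) : sat (sparams (M := M) (mstr M)) (Conj D
    (Conj (Eqn (w k0) (One _ _)) (Eqn (w k) (Var _ (rshift n ord0))))) (vcat u (fun=> b)) <->
    u = m /\ b = m k.
  rewrite !sat_Conj [sat _ D _](DE u b) /= !vcatl vcatr; split.
    by move=> [hu [u1 ub]]; have um := iffLR (mU u) (conj u1 hu); rewrite -ub um.
  by move=> [um ->]; have [u1 hu] := iffRL (mU u) um; split=> //; split=> //; rewrite um.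
split=> [h|e].
  apply: contrapT => bm; apply: h; apply: (iffRL (sat_alln (M := sparams (M := M) (mstr M)) _ _)) => u hu.
  have [_ e] := iffLR (E2 u) hu.
  exact: bm.
rewrite /ksat => h; have hm := iffLR (sat_alln (M := sparams (M := M) (mstr M)) _ _) h m.
by apply: hm; apply: (iffRL (E2 m)); rewrite e.
Qed.

Lemma dense_over (V : kfunctor K) (X : set (fpts (mstr M) V)) :
  (forall a, dcl (M := M) a -> algebraicOver (mstr M) a) ->
  variety V -> geom_integral V -> definable X ->
  zdense (X := V) (A := fk (mstr M)) X -> zdense_over X.
Proof.
move=> da vV gV [q [c [phi [qphi XE]]]] dX; have [sV _ _ iV] := vV.
have [c0 c01] := chart_exists vV.
have dom (c1 : chart V) : (1 : cring c1) != 0 -> domain (cring c1).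
  by move=> c11; split=> // x y; apply: (iV.2 _ _ (chart_open c1)).
pose Xk k : set (fpts (mstr M) V) := [set x : fpts (mstr M) V | exists2 v, coords (c := c k) x v &
  ksat (M := M) (mstr M) (phi k) v]%classic.
(* One of the finitely many pieces of X is dense by itself, because an ultrafilter concentrated on X
   selects a piece. From then on a single chart and a single formula remain. *)
have [k dk] : exists k, zdense (X := V) (A := fk (mstr M)) (Xk k).
  have [U uU hU] := dense_ultra sV (is_field_fk _) dX (chart_open c0) (dom c0 c01).
  have [k hk] : exists k, U [set g : khom (cring c0) (fk (mstr M)) |
      Xk k (pmap V g (cmap c0))]%classic.
    apply: (ultra_ex uU); apply: (ultraS uU _ (hU 1 _)); last exact/eqP.
    by move=> g [/XE[k [v [cv hv]]] _]; exists k, v.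
  exists k => -[Z [pZ XZ]].
  have [r r0 rP] := proper_open_fun sV iV pZ (chart_open c0) c01.
  apply: (ultra0 uU); apply: (ultraS uU _ (ultraI uU hk (hU r r0))).
  by move=> g [/= /XZ/rP gr [_]].
have {XE} XkX (x : fpts (mstr M) V) : Xk k x -> X x by move=> [v cv hv]; apply/XE; exists k, v.
move: {dX} dk XkX; rewrite /Xk; move: (phi k) (qphi k); case: (c k) => R u na a ou ga /=.
move=> {phi qphi k c Xk q} phi qphi.
set X' := (X' in zdense X'); move=> dX' X'X.
pose S (g : khom R (fk (mstr M))) := ksat (M := M) (mstr M) phi (fun l => g (a l)).
have SX g : S g -> X' (pmap V g u).
  by move=> Sg; exists (fun l => g (a l)) => //; exists g.
have [R1 RS] : (1 : R) != 0 /\ forall r, r <> 0 -> exists2 g, S g & g r <> 0.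
  have R1 : (1 : R) != 0.
    have [] := zdense_chart sV (is_field_fk _) dX' (chart_open c0) (r := 1); first exact/eqP.
    move=> g [[v [f _] _] _]; apply/eqP => /(khom_zero_ring f) /eqP; apply/negP.
    exact: (is_field_fk _).1.
  split=> // r r0; have [g [[v [f [fE vE]] hv] gr]] := zdense_chart sV (is_field_fk _) dX' ou r0.
  exists g => //; rewrite /S (_ : (fun l => g (a l)) = v) //.
  by apply/funext => l; rewrite vE; apply/esym/(ou.1 _ f g).
have dR : domain R by split=> // x y; apply: (iV.2 R u ou).
have [RE [i bi]] := base_ring_exists (mstr M) ga.
have oE := base_open bi ou.
have RE1 : (1 : RE) != 0.
  apply: contraNneq R1 => e1; apply/eqP; apply: (base_inj bi).
  by rewrite rmorph1.
have dRE : domain RE by split=> // x y; apply: ((gV _ (mstr M)).2 _ _ oE RE1).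
have hatP (g : khom R (fk (mstr M))) : exists g' : khom RE (kself M), forall r, g' (i r) = g r.
  by have [h _ _ _] := bi; apply: (h (kself M) g).
move=> [Z [pZ XZ]].
have [sE _ _ _] := base_variety (mstr M) vV gV.
have [rho rho0 rhoP] := proper_open_fun sE (gV _ (mstr M)) pZ oE RE1.
have rhoS g (g' : khom RE (kself M)) : S g -> (forall r, g' (i r) = g r) -> g' rho = 0.
  move=> Sg gE; apply: rhoP; apply: XZ; apply: X'X.
  have -> : pmap (base_change (mstr M) V) g' (pmap V i u) = pmap V g u.
    by rewrite /= -pmap_kcomp; apply: pmap_ext.
  exact: SX.
(* A shortest relation over M satisfied on S is, once normalized, the only one
   of its support, so its coefficients are definable, hence algebraic over K. *)
pose rel n (x : 'I_n -> R) (m : 'I_n -> M) := forall g, S g -> \sum_k m k * (g (x k) : M) = 0.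
pose P n := `[< exists (x : 'I_n -> R) (m : 'I_n -> M),
  [/\ indep x, exists k, m k <> 0 & rel n x m] >].
have exP : exists n, P n.
  have [n [e [x [ix rE]]]] := base_repr bi ga rho.
  exists n; apply/asboolP; exists x, e; split=> //.
    apply: contrapT => /forallNP h; apply: rho0; rewrite rE big1 // => l _.
    by have /contrapT -> := h l; rewrite rmorph0 mul0r.
  move=> g Sg; have [g' gE] := hatP g; rewrite -[RHS](rhoS g g' Sg gE) rE rmorph_sum.
  by apply: eq_bigr => l _; rewrite rmorphM khomP gE.
case: (ex_minnP exP) => -[|n] /asboolP[x [m0 [ix [k0 mk0] relm]]] nmin {exP}.
  by case: k0 mk0.
move/eqP in mk0; pose m l := m0 l / m0 k0.
have m1 : m k0 = 1 by rewrite /m mulfV.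
have rm : rel _ x m.
  move=> g /relm h; rewrite -[RHS](mulr0 (m0 k0)^-1) -[X in _ * X]h mulr_sumr.
  by apply: eq_bigr => l _; rewrite /m; ring.
have mU (m' : 'I_n.+1 -> M) : m' k0 = 1 /\ rel _ x m' <-> m' = m.
  split=> [[m'1 rm']|-> //]; apply: contrapT => nm.
  (* The difference of two normalized relations has no term at k0; if nonzero, it would be a
     relation of length n. *)
  suff /nmin : P n by rewrite ltnn.
  apply/asboolP; exists (fun l => x (lift k0 l)), (fun l => m (lift k0 l) - m' (lift k0 l)).
  split.
  - move=> e eE l; pose e' l' := if unlift k0 l' is Some l0 then e l0 else 0.
    have e'l l0 : e' (lift k0 l0) = e l0 by rewrite /e' liftK.
    have e'0 : e' k0 = 0 by rewrite /e' unlift_none.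
    have := ix e' _ (lift k0 l); rewrite e'l; apply.
    rewrite (bigD1_ord k0) //= e'0 rmorph0 mul0r add0r -[RHS]eE.
    by apply: eq_bigr => l' _; rewrite e'l.
  - apply: contrapT => /forallNP h; apply: nm; apply/funext => l.
    case: (unliftP k0 l) => [l' ->|->]; last by rewrite m1.
    by have /contrapT/eqP := h l'; rewrite subr_eq0 => /eqP.
  - move=> g Sg; have := congr2 (fun s t => s - t) (rm g Sg) (rm' g Sg).
    rewrite subrr -sumrB (bigD1_ord k0) //= m1 m'1 subrr add0r => h.
    by rewrite -[RHS]h; apply: eq_bigr => l _; rewrite mulrBl.
have am k : algebraicOver (mstr M) (m k) by apply/da/(dcl_relation ga qphi m1 mU).
pose z := \sum_k kstr RE (m k) * i (x k).
have z0 : z <> 0.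
  move=> z0; have := base_indep bi ix z0 k0; rewrite m1 => /eqP.
  by rewrite oner_eq0.
have [r [w [r0 rE]]] := base_norm dR dRE am erefl z0.
have [g Sg] := RS r r0; apply; have [g' gE] := hatP g.
rewrite -gE rE rmorphM (_ : g' z = 0) ?mul0r //.
rewrite -[RHS](rm g Sg) rmorph_sum; apply: eq_bigr => l _.
by rewrite rmorphM khomP gE.
Qed.

End DenseOver.

(** * From (ii) and (iii) to (i) *)

Lemma elementary_ex (L : lang) (C : eqType) (x0 : C) (A B : structure L) (c : C -> A)
  (h : A -> B) n (th : kformula L C n) : elementary h ->
  (exists v, ksat (M := B) (fun x => h (c x)) th v) -> exists w, ksat c th w.
Proof.
move=> eh [v hv]; apply: contrapT => nw.
pose v0 : 'I_0 -> A := fun k => False_rect A (notF (ltn_ord k)).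
have hA : ksat c (closeall (Not th)) v0.
  by apply/sat_closeall => w hw; apply: nw; exists w.
have := iffLR (elementary_ksat x0 c (closeall (Not th)) v0 eh) hA.
by rewrite /ksat sat_closeall => /(_ v hv).
Qed.

Section Agreement.
Context (I : Type) (LI : I -> lang) (hrel : forall i, relational (LI i)).
Context (K : fieldType).

(** Relational languages add no terms, so a term of the union is a ring term with constants from K
    and makes sense over every [LI i]. The value at other function symbols is a placeholder. *)
Fixpoint tback i n (t : term (params (lunion LI) K) n) : term (params (LI i) K) n :=
  match t with
  | Var k => Var _ k
  | Zero => Zero _ _
  | One => One _ _
  | Add t u => Add (tback i t) (tback i u)
  | Opp t => Opp (tback i t)
  | Mul t u => Mul (tback i t) (tback i u)
  | App f _ => match f with
      | inl _ => Zero _ _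
      | inr c => @App (params (LI i) K) n (inr c) (fun=> Zero _ _)
      end
  end.

Lemma tback_eval i (B : lfield (lunion LI)) (h : {rmorphism K -> B}) n
  (t : term (params (lunion LI) K) n) v :
  eval (M := sparams (M := LField (ired (litp B) i)) h) v (tback i t) =
  eval (M := sparams (M := B) h) v t.
Proof.
elim: t => //= [t -> u ->|t ->|t -> u ->|[[i' f]|c] a _] //.
by case: (hrel f).
Qed.

Lemma term_value n (t : term (params (lunion LI) K) n) (F : lfield (lunion LI))
  (j : {rmorphism K -> F}) (w : 'I_n -> F) (B : lfield (lunion LI)) (h : {rmorphism K -> B})
  (D : kalg K) (io : khom D (fk j)) (x : khom D (fk h)) (d : 'I_n -> D) :
    (forall k, io (d k) = w k) ->
    exists e : D, io e = eval (M := sparams (M := F) j) w t /\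
      x e = eval (M := sparams (M := B) h) (fun k => x (d k)) t.
Proof.
move=> dE; elim: t => [k|||t [e [e1 e2]] u [e' [e1' e2']]|t [e [e1 e2]]|
      t [e [e1 e2]] u [e' [e1' e2']]|[[i f]|c] a _] /=.
- by exists (d k).
- by exists 0; rewrite !rmorph0.
- by exists 1; rewrite !rmorph1.
- by exists (e + e'); rewrite !rmorphD e1 e2 e1' e2'.
- by exists (- e); rewrite !rmorphN e1 e2.
- by exists (e * e'); rewrite !rmorphM e1 e2 e1' e2'.
- by case: (hrel f).
- by exists (kstr D c); rewrite !khomP.
Qed.

(** A formula in one language is completed by tautologies to a family over all i, which avoids
    restricting families to a finite index set. *)
Lemma single_formula i n (th : kformula (LI i) K n) (F : lfield (lunion LI))
  (j : {rmorphism K -> F}) v : qfree th ->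
  ksat (M := LField (ired (litp F) i)) j th v ->
  exists Th : forall i, kformula (LI i) K n, [/\ forall i, qfree (Th i),
    forall i, ksat (M := LField (ired (litp F) i)) j (Th i) v & Th i = th].
Proof.
move=> qth hth.
exists (fun i' => match pselect (i = i') with
  | left e => match e in _ = i0 return kformula (LI i0) K n with erefl => th end
  | right _ => Not (Bot _ _) end); split.
- by move=> i'; case: pselect => // e; subst i'.
- by move=> i'; case: pselect => e; [subst i'|exact: id].
- by case: pselect => // e; rewrite (Prop_irrelevance e erefl).
Qed.

(* Whether phi holds at a point of D is decided by the equations and
   inequations holding in F, once D contains the inverses l, and by one formula
   in each of finitely many LI i. *)
Lemma agreement (F : lfield (lunion LI)) (j : {rmorphism K -> F}) n
  (phi : kformula (lunion LI) K n) (v : 'I_n -> F) : qfree phi ->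
  exists (l : seq F) (I0 : set I) (Th : forall i, kformula (LI i) K n),
  [/\ finite_set I0, forall i, qfree (Th i),
      forall i, ksat (M := LField (ired (litp F) i)) j (Th i) v &
      forall (B : lfield (lunion LI)) (h : {rmorphism K -> B}) (D : kalg K)
        (io : khom D (fk j)) (x : khom D (fk h)) (d : 'I_n -> D),
        injective io -> (forall k, io (d k) = v k) ->
        (forall y, y \in l -> exists e, io e = y) ->
        (forall i, I0 i -> ksat (M := LField (ired (litp B) i)) h (Th i) (fun k => x (d k))) ->
        ksat (M := F) j phi v <-> ksat (M := B) h phi (fun k => x (d k))].
Proof.
elim: phi v => {n} [n|n t u|n r a|n p IHp q IHq|n p IH] v //=.
- by move=> _; exists [::], set0, (fun i => Not (Bot _ n)); split=> // i; exact: id.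
(* If the two terms differ at v, their difference becomes a unit of D and they differ at all points
   of D. If they agree, the listed inverse is 0, and injectivity of io makes them agree in D. *)
- move=> _; exists [:: (eval (M := sparams (M := F) j) v t -
    eval (M := sparams (M := F) j) v u)^-1], set0, (fun i => Not (Bot _ n)).
  split=> // [i|B h D io x d ioi dv hl _]; first exact: id.
  have [e [e1 e2]] := term_value t x dv.
  have [e' [e1' e2']] := term_value u x dv.
  rewrite /ksat /= -e2 -e2' -e1 -e1'; split=> [/ioi -> //|xe].
  apply: contrapT => /eqP ne; have [y yE] := hl _ (mem_head _ _).
  have y1 : (e - e') * y = 1.
    apply: ioi; rewrite rmorphM rmorphB yE -e1 -e1' rmorph1.
    by apply: mulfV; rewrite subr_eq0.
  have := congr1 x y1; rewrite rmorphM rmorphB [x e]xe subrr mul0r rmorph1.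
  by move=> /esym/eqP; apply/negP; apply: oner_neq0.
- case: r a => [[i r]|[]] a _.
  pose th : kformula (LI i) K n := @Rel (params (LI i) K) n (inl r) (fun k => tback i (a k)).
  have thE (B : lfield (lunion LI)) (h : {rmorphism K -> B}) w :
      ksat (M := LField (ired (litp B) i)) h th w <->
      ksat (M := B) h (@Rel (params (lunion LI) K) n (inl (existT _ i r)) a) w.
    rewrite /ksat /=; rewrite (_ : (fun k => _) =
      fun k => eval (M := sparams (M := B) h) w (a k)) //.
    by apply/funext => k; apply: tback_eval.
  have [hF|hF] := pselect (ksat (M := LField (ired (litp F) i)) j th v).
    have [Th [qTh hTh ThE]] := single_formula (isT : qfree th) hF.
    exists [::], [set i]%classic, Th; split=> //.
    move=> B h D io x d _ _ _ /(_ i erefl); rewrite ThE => hB.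
    by split=> _; [apply/thE|apply/thE].
  have [Th [qTh hTh ThE]] := single_formula (isT : qfree (Not th)) hF.
  exists [::], [set i]%classic, Th; split=> //.
  move=> B h D io x d _ _ _ /(_ i erefl); rewrite ThE => hB.
  by split=> /thE; [move/hF|move/hB].
- move=> /andP[qp qq].
  have [l [I0 [Th [fI qT hT hp]]]] := IHp v qp.
  have [l' [I0' [Th' [fI' qT' hT' hq]]]] := IHq v qq.
  exists (l ++ l'), (I0 `|` I0')%classic, (fun i => Conj (Th i) (Th' i)); split=> //.
  + by rewrite finite_setU.
  + by move=> i; rewrite qfree_Conj qT qT'.
  + by move=> i; apply/sat_Conj; split; [apply: hT|apply: hT'].
  + move=> B h D io x d ioi dv hl hB.
    have e1 := hp B h D io x d ioi dv; have e2 := hq B h D io x d ioi dv.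
    rewrite /ksat /= [sat _ p _]e1 ?[sat _ q _]e2 //.
    * by move=> y yl; apply: hl; rewrite mem_cat yl orbT.
    * by move=> i Ii; have := hB i (or_intror Ii); rewrite /ksat sat_Conj => -[].
    * by move=> y yl; apply: hl; rewrite mem_cat yl.
    * by move=> i Ii; have := hB i (or_introl Ii); rewrite /ksat sat_Conj => -[].
Qed.

End Agreement.

Section Converse.
Context (L : lang) (T : theory L) (I : Type) (LI : I -> lang)
  (TI : forall i, theory (LI i)) (hrel : forall i, relational (LI i))
  (hqe : forall i, qelim (@TI i)).
Context (K : fieldType) (eL : interp L K) (eI : forall i, interp (LI i) K).

Lemma model_variety (F : fieldType) (j : {rmorphism K -> F}) (l : seq F) :
  regular j -> totally_extension T (K := LField eL) j ->
  exists (D : kalg K) (io : khom D (fk j)) n (a : 'I_n -> D),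
  [/\ generates a, injective io, forall x, x \in l -> exists d, io d = x,
      domain D & admissible T eL true (spec D)].
Proof.
move=> rj tj; have [D0 [s [io0 [[ioi ios [n [a ga]] fsD] lD]]]] := smooth_model l rj.
pose D : kalg K := KAlg s.
pose io : khom D (fk j) := @KHom K D (fk j) io0 ios.
have dD : domain D.
  split=> [|x y]; first exact: oner_neq0.
  by move/eqP; rewrite mulf_eq0 => /orP[/eqP|/eqP]; [left|right].
exists D, io, n, a; split=> //; split=> //.
- exact: spec_variety ga dD.
- move=> E jE; have [RE [i bi]] := base_ring_exists jE ga.
  have dRE := regular_domain rj ga (ioi : injective io) bi.
  exact: (represents_integral (base_represents bi (spec_represents D)) dRE).
(* F embeds in an elementary extension N of M, so D has an N-point; having a point is expressed by
   [hom_formula] and descends to M. Formal smoothness of D makes whatever point is obtained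
   smooth. *)
- move=> M; have [N [h [g [eh gE]]]] := tj M.
  suff [x] : inhabited (khom D (fk (mstr M))).
    by exists x; apply: spec_smooth_point.
  have [chi qchi chiE] := hom_formula L ga.
  have gP c : g (io (kstr D c)) = kstr (fk (h \o mstr M)) c by rewrite khomP [LHS]gE.
  pose f : khom D (fk (h \o mstr M)) :=
    @KHom K D (fk (h \o mstr M)) (g \o (io : {rmorphism D -> F})) gP.
  have [|w hw] := @elementary_ex _ K 0 M N (mstr M) h _ chi eh.
    exists (fun k => f (a k)); apply: (iffRL (chiE N (h \o mstr M) _)).
    by exists f.
  by have [x _] := iffLR (chiE M (mstr M) w) hw.
- by move=> _; apply: spec_affine.
Qed.

Context (F : lfield (lunion LI)) (j : {rmorphism K -> F}).
Context (ej : embedding (A := LField (iunion eI)) (B := F) j).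
Context (mF : forall i, models (LField (ired (litp F) i)) (univ_part (@TI i))).

Lemma embedding_ired i :
  embedding (A := LField (eI i)) (B := LField (ired (litp F) i)) j.
Proof.
have [ji j01 jop jf jr] := ej; split=> // [f a|r a].
  exact: (jf (existT _ i f) a).
exact: (jr (existT _ i r) a).
Qed.

Context (D : kalg K) (io : khom D (fk j)) (n : nat) (a : 'I_n -> D).
Context (ga : generates a) (ioi : injective io).

(** Being a point of D that satisfies th and does not kill d is a quantifier-free condition; io
    satisfies it in F, and [transfer] makes it satisfiable in M. As d varies this yields density. *)
Lemma dense_transfer i (M : kmodel (@TI i) (LField (eI i))) (th : kformula (LI i) K n) d :
  qfree th -> ksat (M := LField (ired (litp F) i)) j th (fun k => io (a k)) -> d <> 0 ->
  exists g : khom D (fk (mstr M)), g d <> 0 /\ ksat (M := M) (mstr M) th (fun k => g (a k)).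
Proof.
move=> qth hth d0; have [chi qchi chiE] := hom_formula (LI i) ga.
have [t tE] := elem_term (LI i) ga d.
pose Fi : lfield (LI i) := LField (ired (litp F) i).
have [||y] := transfer (K := LField (eI i)) (F := Fi)
  (theta := Conj chi (Conj th (Not (Eqn t (Zero _ _))))) (a := fun k => io (a k))
  M (@hqe i) (embedding_ired i) (@mF i).
- by rewrite !qfree_Conj qchi qth.
- rewrite /ksat !sat_Conj; split; first by apply: (iffRL (chiE Fi j _)); exists io.
  split=> //= e; apply: d0; apply: ioi; rewrite rmorph0 -[LHS](tE Fi j io).
  exact: e.
rewrite /ksat !sat_Conj => -[hc [hy nt]].
have [g gE] := iffLR (chiE M (mstr M) y) hc.
have yE : y = fun k => g (a k) by apply/funext => k; rewrite gE.
exists g; split; last by rewrite -yE.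
by move=> g0; apply: nt; rewrite /= yE [LHS](tE M (mstr M) g).
Qed.

Definition gen_chart : chart (spec D) :=
  @Chart K (spec D) D (kid D) n a (represents_open (spec_represents D)) ga.

Lemma gen_chart_coords (A : kalg K) (x : khom D A) v :
  coords (c := gen_chart) (x : spec D A) v <-> v = fun k => x (a k).
Proof.
split=> [[f [fE vE]]|->].
  by apply/funext => k; rewrite vE -fE.
by exists x; split=> //; apply: khom_eq.
Qed.

End Converse.

Section Realization.
Context (L : lang) (T : theory L) (I : Type) (LI : I -> lang)
  (TI : forall i, theory (LI i)) (hrel : forall i, relational (LI i))
  (hqe : forall i, qelim (@TI i)).
Context (K : fieldType) (eL : interp L K) (eI : forall i, interp (LI i) K).
Context (M : forall i, kmodel (@TI i) (LField (eI i))).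

(** The common part of both converses: satisfying phi in K is reduced to finding a K-point of Spec D
    that satisfies finitely many formulas, one in each of finitely many languages. The point is over
    an arbitrary B because (ii) provides it only in an extension of K. *)
Lemma formula_model (F : lfield (lunion LI)) (j : {rmorphism K -> F}) n
  (phi : kformula (lunion LI) K n) v : qfree phi -> regular j ->
  totally_extension T (K := LField eL) j -> ksat (M := F) j phi v ->
  exists (D : kalg K) (io : khom D (fk j)) N (a : 'I_N -> D)
    (th : forall i, kformula (LI i) K N),
  [/\ generates a, injective io, domain D, admissible T eL true (spec D) &
    [/\ forall i, qfree (th i),
      forall i, ksat (M := LField (ired (litp F) i)) j (th i) (fun k => io (a k)) &
      exists2 I0, finite_set I0 &
      forall (B : lfield (lunion LI)) (h : {rmorphism K -> B}) (x : khom D (fk h)),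
        (forall i, I0 i ->
           ksat (M := LField (ired (litp B) i)) h (th i) (fun k => x (a k))) ->
        exists w, ksat (M := B) h phi w]].
Proof.
move=> qphi rj tj hv.
have [l [I0 [Th [fI0 qTh hTh agr]]]] := agreement hrel j v qphi.
have [D [io [N [a [ga ioi lD dD adD]]]]] := model_variety (codom v ++ l) rj tj.
have /choice[d dE] : forall k, exists d, io d = v k.
  by move=> k; apply: lD; rewrite mem_cat codom_f.
have /dchoice[th /all_and2[qth thE]] : forall i, exists th : kformula (LI i) K N, qfree th /\
    forall (B : lfield (LI i)) (h : {rmorphism K -> B}) (f : khom D (fk h)),
      ksat (M := B) h th (fun k => f (a k)) <-> ksat (M := B) h (Th i) (fun k => f (d k)).
  move=> i; have [th qt tE] := pull_formula ga (lid (LI i)) d (qTh i).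
  by exists th; split=> // B h f; apply: tE; apply: reduct_id.
have hF i : ksat (M := LField (ired (litp F) i)) j (th i) (fun k => io (a k)).
  apply: (iffRL (thE i (LField (ired (litp F) i)) j io)).
  by rewrite (_ : (fun k => io (d k)) = v) //; apply/funext.
exists D, io, N, a, th; split=> //; split=> //; exists I0 => // B h x hx.
exists (fun k => x (d k)); apply: (iffLR (agr B h D io x d ioi dE _ _)) hv.
  by move=> y yl; apply: lD; rewrite mem_cat yl orbT.
move=> i Ii; apply: (iffLR (thE i (LField (ired (litp B) i)) h x)); exact: hx.
Qed.

Lemma cond_iii_i : cond_iii T eL M true false -> cond_i T TI eL eI.
Proof.
move=> c3 F j ej mF rj tj n phi qphi [v hv].
have [D [io [N [a [th [ga ioi dD adD [qth hF [I0 fI0 agr]]]]]]]] :=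
  formula_model qphi rj tj hv.
pose V := spec D.
pose X i : set (fpts (mstr (M i)) V) :=
  [set x : khom D (fk (mstr (M i))) | ksat (M := M i) (mstr (M i)) (th i) (fun k => x (a k))]%classic.
have [|x xX] := c3 V adD I0 fI0 X.
  move=> i _; split.
    exists 1%N, (fun=> gen_chart ga), (fun=> th i); split=> // x; split.
      by move=> Xx; exists ord0, (fun k => x (a k)); split=> //; apply/gen_chart_coords.
    by move=> [_ [w [/gen_chart_coords -> hw]]].
  move=> [Z [pZ XZ]]; have [vV _ _ _] := adD; have [sV _ _ iV] := vV.
  have [r r0 rP] := proper_open_fun sV iV pZ (represents_open (spec_represents D)) dD.1.
  have [g [gr hg]] := dense_transfer hqe ej mF ga ioi (M i) (qth i) (hF i) r0.
  apply: gr; apply: rP; apply: XZ; exact: hg.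
pose x' : khom D (fk (idfun : {rmorphism K -> K})) :=
  @KHom K D (fk (idfun : {rmorphism K -> K})) x (fun c => khomP x c).
apply: (agr (LField (iunion eI)) idfun x') => i Ii; rewrite ired_iunion.
have eM : embedding (A := LField (eI i)) (B := M i) (mstr (M i)) by case: (M i).
apply: (iffRL (@ksat_embedding _ K (LField (eI i)) (M i) idfun (mstr (M i)) _ (th i)
  (fun k => x' (a k)) eM (qth i))).
exact: (xX i Ii).
Qed.

Lemma cond_ii_i : cond_ii T TI eL eI true -> cond_i T TI eL eI.
Proof.
move=> c2 F j ej mF rj tj n phi qphi [v hv].
have [D [io [N [a [th [ga ioi dD adD [qth hF [I0 fI0 agr]]]]]]]] :=
  formula_model qphi rj tj hv.
pose V := spec D; have [vV _ _ _] := adD; have [sV _ _ iV] := vV.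
pose Fi i : lfield (LI i) := LField (ired (litp F) i).
(* The quantifier-free type, in the reduct of F to [LI i], of the generators of D. Injectivity of io
   makes it generic, since it contains the negation of every equation r = 0 with r nonzero. *)
pose p i : set (kformula (LI i) K N) :=
  [set ph | qfree ph /\ ksat (M := Fi i) j ph (fun k => io (a k))]%classic.
have [||Ks [h [eh [x xP]]]] := c2 V adD (fun=> gen_chart ga) p.
- move=> i; split; first by move=> ph [].
    move=> ph qph; have [h|h] := pselect (ksat (M := Fi i) j ph (fun k => io (a k))).
      by left.
    by right; split=> //=; rewrite qph.
  (* The type is finitely satisfiable in M i by [dense_transfer], hence realized in an ultrapower of
     M i, again a model containing K. *)
  pose J := khom D (fk (mstr (M i))).
  have [||B|U uU BU] := @ultra_exists J [set B | exists r ph, [/\ r <> 0, p i ph &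
      B = [set g : J | g r <> 0 /\
        ksat (M := M i) (mstr (M i)) ph (fun k => g (a k))]%classic]]%classic.
  + exists [set g : J | g 1 <> 0 /\ ksat (M := M i) (mstr (M i)) (th i) (fun k => g (a k))]%classic.
    by exists 1, (th i); split=> //; apply/eqP; case: dD.
  + move=> _ [r [ph [r0 [qph hph] ->]]].
    exact: (dense_transfer hqe ej mF ga ioi (M i) qph hph r0).
  + move=> _ [r [ph [r0 [qph hph] ->]]] [r' [ph' [r0' [qph' hph'] ->]]].
    exists [set g : J | g (r * r') <> 0 /\
      ksat (M := M i) (mstr (M i)) (Conj ph ph') (fun k => g (a k))]%classic.
      exists (r * r'), (Conj ph ph'); split=> //; first by move=> /(dD.2)[].
      by split; [rewrite qfree_Conj qph qph'|apply/sat_Conj].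
    move=> g [gr]; rewrite /ksat sat_Conj => -[h1 h2]; split; split=> // hr;
      by apply: gr; rewrite rmorphM hr ?mul0r ?mulr0.
  have [|N0 [d0 [f [ed f0 fP]]]] := ultra_point (kid D : V D) uU.
    move=> r r0; apply: (ultraS uU _ (BU [set g : J | g r <> 0 /\
      ksat (M := M i) (mstr (M i)) (th i) (fun k => g (a k))]%classic _)); first by move=> g [].
    by exists r, (th i).
  have [eM mM] : embedding (A := LField (eI i)) (B := M i) (mstr (M i)) /\
      models (M i) (@TI i) by case: (M i).
  have eN : embedding (A := LField (eI i)) (B := N0) (d0 \o mstr (M i)).
    exact: (embedding_comp (elementary_embedding ed) eM).
  exists (KModel eN (elementary_models ed mM)), (fun k => f (a k)) => ph pph.
  have [|w cw hw] := fP (gen_chart ga) ph.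
    apply: (ultraS uU _ (BU [set g : J | g 1 <> 0 /\
      ksat (M := M i) (mstr (M i)) ph (fun k => g (a k))]%classic _)).
      move=> g [_ hg]; exists (fun k => g (a k)) => //.
      by apply/gen_chart_coords; apply/funext.
    by exists 1, ph; split=> //; apply/eqP; case: dD.
  by move/gen_chart_coords: cw hw => ->.
- move=> i N0 w hw; have [chi qchi chiE] := hom_formula (LI i) ga.
  have pchi : p i chi by split=> //; apply: (iffRL (chiE (Fi i) j _)); exists io.
  have [g gE] := iffLR (chiE N0 (mstr N0) w) (hw chi pchi).
  have wE : w = fun k => g (a k) by apply/funext => k; rewrite gE.
  exists g; split; first exact/gen_chart_coords.
  move=> Z pZ Zg.
  have [r r0 rP] := proper_open_fun sV iV pZ (represents_open (spec_represents D)) dD.1.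
  have gr : g r = 0.
    by apply: rP; rewrite (_ : pmap V g (kid D) = g) //; apply: khom_eq.
  have [t tE] := elem_term (LI i) ga r.
  have /hw : p i (Not (Eqn t (Zero _ _))).
    split=> // e; apply: r0; apply: ioi; rewrite rmorph0 -[LHS](tE (Fi i) j io).
    exact: e.
  by apply; rewrite /= wE [LHS](tE N0 (mstr N0) g).
have [|y hy] := agr (LField (isumr (litp Ks))) h x.
  move=> i _; have [w /gen_chart_coords -> hw] := xP i.
  by apply: hw; split; [apply: qth|apply: hF].
(* The point found lies over an elementary extension; only the satisfiability of phi is brought down
   to K. *)
have [|w hw] := @elementary_ex _ K 0 (LField (isum eL (iunion eI))) Ks idfun h n
    (qtrans (lmpar (linr L LI) K) phi (@Var _ _)) eh.
  exists y.
  exact: (iffRL (ksat_trans (mu := linr L LI) _ _ _ (reduct_inr _) qphi)).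
exists w; have := iffLR (ksat_trans (mu := linr L LI) _ _ _ (reduct_inr _) qphi) hw.
by rewrite /= isumr_isum.
Qed.

End Realization.

Lemma is_field_kself (K : fieldType) : is_field (kself K).
Proof.
split=> [|x x0]; first exact: oner_neq0.
by exists (x^-1 : K); rewrite mulfV.
Qed.

Lemma zdense_nonempty (K : fieldType) (V : kfunctor K) (A : kalg K) (S : set (V A)) :
  variety V -> is_field A -> zdense S -> (S !=set0)%classic.
Proof.
move=> vV fA dS; have [sV _ _ _] := vV; have [c c1] := chart_exists vV.
have [|g [Sg _]] := zdense_chart sV fA dS (chart_open c) (r := 1); first exact/eqP.
by exists (pmap V g (cmap c)).
Qed.

Section Weakenings.
Context (L : lang) (T : theory L) (I : Type) (LI : I -> lang)
  (TI : forall i, theory (LI i)).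
Context (K : fieldType) (eL : interp L K) (eI : forall i, interp (LI i) K).
Context (M : forall i, kmodel (@TI i) (LField (eI i))).

(** All comparisons between variants of (iii) and (iv) are of this kind: fewer varieties, a weaker
    conclusion, or a stronger density assumption. *)
Lemma intersection_weaken
  (dense dense' : forall (V : kfunctor K) i, set (fpts (mstr (M i)) V) -> Prop)
  (aff aff' zd zd' : bool) : (aff' -> aff) -> (zd -> zd') ->
  (forall V i X, admissible T eL aff V -> definable (M := M i) X -> dense V i X ->
     dense' V i X) ->
  intersection_property T eL dense' aff' zd' ->
  intersection_property T eL dense aff zd.
Proof.
move=> haff hzd dd h V adV I0 fI0 X hX XK; have [vV gV tV aV] := adV.
have {}h : if zd' then zdense XK else (XK !=set0)%classic.
  apply: (h V _ I0 fI0 X); first by split=> // /haff.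
  by move=> i Ii; have [h1 h2] := hX i Ii; split=> //; apply: dd h2.
case: zd zd' hzd h => [] [] hzd //= h; first by have := hzd isT.
exact: zdense_nonempty vV (is_field_kself K) h.
Qed.

End Weakenings.

Theorem proposition4p3
  (L : lang) (T : theory L)
  (hlarge : theory_of_large_fields T)
  (I : Type) (LI : I -> lang) (TI : forall i, theory (LI i))
  (hrel : forall i, relational (LI i)) (hqe : forall i, qelim (TI i))
  (K : fieldType) (hacf : acf_convention T K)
  (eL : interp L K) (eI : forall i, interp (LI i) K)
  (hK : forall i, models (LField (eI i)) (univ_part (TI i)))
  (hexp : forall i, expandable T (TI i) eL (eI i))
  (M : forall i, kmodel (TI i) (LField (eI i))) :
  (forall aff : bool,
     cond_i T TI eL eI <-> cond_ii T TI eL eI aff) /\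
  (forall aff zd : bool,
     cond_i T TI eL eI <-> cond_iii T eL M aff zd) /\
  (forall aff zd : bool,
     cond_i T TI eL eI <-> cond_iv T eL M aff zd).
Proof.
(* The variants of (iii) lie between two extremes. Condition (i) implies the strongest, for all
   varieties with dense intersections, and follows from the weakest, for affine varieties with
   nonempty intersections. *)
have i_iii : cond_i T TI eL eI -> cond_iii T eL M false true.
  by apply: cond_i_iii.
have iii_i : cond_iii T eL M true false -> cond_i T TI eL eI by apply: cond_iii_i.
split; first (move=> aff; split).
- by move=> ci V [vV gV tV _]; apply: (cond_i_ii hrel hlarge ci).
- move=> c2; apply: (cond_ii_i hrel hqe M) => V [vV gV tV aV].
  by apply: (c2 V); split=> // _; apply: aV.
split=> aff zd; split.
- by move/i_iii; apply: intersection_weaken.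
- by move=> c3; apply: iii_i; move: c3; apply: intersection_weaken.
- move=> ci; have c3 := i_iii ci; split.
    move=> i a da; apply: (dcl_algebraic _ da).
    by move: c3; apply: intersection_weaken.
  (* Density over M i implies density over K, so (iv) assumes more of the X i than (iii); the way
     back is [dense_over], with the condition on definable closures. *)
  move: c3; apply: intersection_weaken => // V i X [vV _ _ _] _.
  exact: zdense_base.
- move=> [da c4]; apply: iii_i; move: c4; apply: intersection_weaken => //.
  move=> V i X [vV gV _ _]; apply: dense_over => //; exact: da.
Qed.
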